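(* There exists a universal constant $\mathfrak q>0$ such that the following holds. Consider the equation $$\partial_s\mathbf u(s)=-\mathcal A(s)\mathbf u(s),\qquad\mathcal A(s)=\mathcal B(s)+\mathcal W(s),$$ on the time interval $\mathcal T=[-\sigma,0]$ with some $\sigma\in[K^{c_3},K^{1-c_3}]$, where $c_3>0$ is a positive constant. Fix $|Z|\le K/2$ and $\alpha\in[0,1/3]$. Suppose that conditions $(\mathbf{C1})_\rho$ and $(\mathbf{C2})_\xi$ (defined in the context) hold with some exponents $\xi,\rho$ small enough depending on $c_3$. Then for the solution $\mathbf u$ we have $$\sup_{|j-Z|+|j'-Z|\le\sigma^{1-\alpha}}|u_j(0)-u_{j'}(0)|\le C\sigma^{-\mathfrak q\alpha}\|\mathbf u(-\sigma)\|_\infty.$$ The constant $C$ depends only on $c_3$ and is uniform in $K$. The result holds for any $K\ge K_0$, where $K_0$ depends on $c_3$.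
   Context: $I=\{-K,-K+1,\ldots,K\}$, $\mathbf u(s)\in\mathbb C^I$. $[\mathcal B(s)\mathbf u]_j=-\sum_{k\ne j,\,k\in I}B_{jk}(s)(u_k-u_j)$ with $B_{jk}(s)=B_{kj}(s)\ge0$; $[\mathcal W(s)\mathbf u]_i=W_i(s)u_i$ with $W_i(s)\ge0$. $d_i=\min\{|i+K+1|,|K+1-i|\}$ is the distance of $i$ to the boundary of $I$. Regularity: the equation is regular at $(Z,t)\in I\times\mathcal T$ with exponent $\rho$ if $$\sup_{s\in\mathcal T}\ \sup_{1\le M\le K}\frac1{1+|s-t|}\Big|\int_s^t\frac1M\sum_{i\in I:|i-Z|\le M}\ \sum_{j\in I\setminus\{i\}:|j-Z|\le M}B_{ij}(u)\,du\Big|\le K^\rho,$$ and strongly regular at $(Z,t)$ with exponent $\rho$ if it is regular with exponent $\rho$ at all points of $\{Z\}\times\{\Xi+t\}$ (with time component in $\mathcal T$), $\Xi=\{-K\cdot2^{-m}(1+2^{-k}):0\le k,m\le C\log K\}$, $C$ a fixed constant. $(\mathbf{C1})_\rho$: the equation is strongly regular with exponent $\rho$ at the space-time point $(Z,0)$. $(\mathbf{C2})_\xi$: for some large constants $C,\widehat C\ge10$ (fixed, independent of $K$): - $B_{ij}(s)\ge K^{-\xi}|i-j|^{-2}$ for any $s\in\mathcal T$, $d_i\ge K/C$, $d_j\ge K/C$ ($i\ne j$); - $W_i(s)\le K^\xi/d_i$ if $d_i\ge K^{C\xi}$, $s\in\mathcal T$; - $\dfrac{\mathbf 1(\min\{d_i,d_j\}\ge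 K/C)}{C(i-j)^2}\le B_{ij}(s)\le\dfrac C{(i-j)^2}$ if $|i-j|\ge\widehat CK^\xi$ and $s\in\mathcal T$. *)

(* Defs.v *)
From HB Require Import structures.
From mathcomp Require Import all_boot all_order all_algebra.
From mathcomp Require Import complex.
From mathcomp Require Import all_classical all_reals all_analysis.

Set Implicit Arguments.
Unset Strict Implicit.
Unset Printing Implicit Defensive.

Import Order.TTheory GRing.Theory Num.Theory numFieldNormedType.Exports.

Local Open Scope classical_set_scope.
Local Open Scope ring_scope.

(* The index set I = {-K, ..., K}: the ordinal i stands for the integer i - K. *)
Notation site K := 'I_(K.*2.+1).

Definition pos (K : nat) (i : site K) : int := (i : nat)%:Z - K%:Z.

Definition sdist (R : realType) (K : nat) (i j : site K) : R :=
  `|pos i - pos j|%:~R.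

Definition bdist (R : realType) (K : nat) (i : site K) : R :=
  (Num.min `|pos i + K.+1%:Z| `|K.+1%:Z - pos i|)%:~R.

Definition cabs (R : realType) (z : R[i]) : R := ComplexField.Normc.normc z.

Definition supnorm (R : realType) (K : nat) (v : site K -> R[i]) : R :=
  \big[Num.max/0]_(i : site K) cabs (v i).

Definition opB (R : realType) (K : nat) (B : site K -> site K -> R -> R)
    (s : R) (v : site K -> R[i]) (j : site K) : R[i] :=
  - \sum_(k : site K | k != j) (B j k s)%:C%C * (v k - v j).

Definition opW (R : realType) (K : nat) (W : site K -> R -> R)
    (s : R) (v : site K -> R[i]) (i : site K) : R[i] :=
  (W i s)%:C%C * v i.

Definition opA (R : realType) (K : nat) (B : site K -> site K -> R -> R)
    (W : site K -> R -> R) (s : R) (v : site K -> R[i]) (i : site K) : R[i] :=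
  opB B s v i + opW W s v i.

(* Derivative of a complex-valued function of a real variable; R[i] carries no
   normed module structure over R, so it is taken on real and imaginary parts. *)
Definition cderive (R : realType) (f : R -> R[i]) (s : R) (l : R[i]) : Prop :=
  is_derive s 1 (fun t => complex.Re (f t)) (complex.Re l) /\
  is_derive s 1 (fun t => complex.Im (f t)) (complex.Im l).

Definition ccontinuous_on (R : realType) (T : set R) (f : R -> R[i]) : Prop :=
  {within T, continuous (fun t => complex.Re (f t))} /\
  {within T, continuous (fun t => complex.Im (f t))}.

(* Measurability of B is what gives a meaning to its time integrals. *)
Definition admissible (R : realType) (K : nat) (T : set R)
    (B : site K -> site K -> R -> R) (W : site K -> R -> R) : Prop :=
  [/\ forall i j : site K, measurable_fun T (B i j),
      forall (i j : site K) (s : R), T s -> B i j s = B j i s,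
      forall (i j : site K) (s : R), T s -> 0 <= B i j s
    & forall (i : site K) (s : R), T s -> 0 <= W i s].

(* Only continuity, not one-sided differentiability, is required at the two
   ends of the time interval. *)
Definition solution (R : realType) (K : nat) (a b : R)
    (B : site K -> site K -> R -> R) (W : site K -> R -> R)
    (u : R -> site K -> R[i]) : Prop :=
  forall j : site K,
    ccontinuous_on `[a, b] (fun s => u s j) /\
    forall s : R, a < s < b -> cderive (fun t => u t j) s (- opA B W s (u s) j).

(* The oriented integral of f from s to t. *)
Definition oriented_integral (R : realType) (s t : R) (f : R -> R) : \bar R :=
  if s <= t then (\int[lebesgue_measure]_(x in `[s, t]) (f x)%:E)%E
  else (- \int[lebesgue_measure]_(x in `[t, s]) (f x)%:E)%E.

Definition window_average (R : realType) (K : nat)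
    (B : site K -> site K -> R -> R) (Z : int) (M : nat) (x : R) : R :=
  M%:R^-1 * \sum_(i : site K | `|pos i - Z| <= M%:Z)
              \sum_(j : site K | (j != i) && (`|pos j - Z| <= M%:Z)) B i j x.

Definition regular (R : realType) (K : nat) (T : set R)
    (B : site K -> site K -> R -> R) (rho : R) (Z : int) (t : R) : Prop :=
  forall (s : R) (M : nat), T s -> (1 <= M <= K)%N ->
    ((1 + `|s - t|)^-1%:E *
      `|oriented_integral s t (window_average B Z M)| <= (K%:R `^ rho)%:E)%E.

Definition Xi (R : realType) (c : R) (K : nat) : set R :=
  [set x : R | exists k m : nat,
    [/\ k%:R <= c * ln K%:R, m%:R <= c * ln K%:R
      & x = - (K%:R * 2 ^- m * (1 + 2 ^- k))]].

Definition strongly_regular (R : realType) (K : nat) (c : R) (T : set R)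
    (B : site K -> site K -> R -> R) (rho : R) (Z : int) (t : R) : Prop :=
  forall x : R, Xi c K x -> T (x + t) -> regular T B rho Z (x + t).

Definition condC1 (R : realType) (K : nat) (c : R) (T : set R)
    (B : site K -> site K -> R -> R) (Z : int) (rho : R) : Prop :=
  strongly_regular c T B rho Z 0.

Definition condC2 (R : realType) (K : nat) (C Chat : R) (T : set R)
    (B : site K -> site K -> R -> R) (W : site K -> R -> R) (xi : R) : Prop :=
  [/\ forall (s : R) (i j : site K), T s -> i != j ->
        K%:R / C <= bdist R i -> K%:R / C <= bdist R j ->
        K%:R `^ (- xi) * sdist R i j ^- 2 <= B i j s,
      forall (s : R) (i : site K), T s ->
        K%:R `^ (C * xi) <= bdist R i ->
        W i s <= K%:R `^ xi / bdist R i
    & forall (s : R) (i j : site K), T s ->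
        Chat * K%:R `^ xi <= sdist R i j ->
        ((K%:R / C <= Num.min (bdist R i) (bdist R j))%R : nat)%:R
            / (C * sdist R i j ^+ 2) <= B i j s
        /\ B i j s <= C / sdist R i j ^+ 2].

(* Main.v *)
Require Import Defs.
From mathcomp Require Import all_boot all_order all_algebra.
From mathcomp Require Import complex.
From mathcomp Require Import all_classical all_reals all_analysis.
From mathcomp Require Import measurable_realfun.
From mathcomp Require Import ring lra zify.
Import Order.TTheory GRing.Theory Num.Theory numFieldNormedType.Exports.

Set Implicit Arguments.
Unset Strict Implicit.
Unset Printing Implicit Defensive.

Local Open Scope classical_set_scope.
Local Open Scope ring_scope.

(** By the maximum principle the real and imaginary parts of u, divided by the
    initial sup norm, stay in [-1, 1]; let v be one of them.

    Look at v on space-time windows of radius r_k = Lam sigma / 16^k around Z.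
    For a slowly moving level a, the sum of (v - a)^p over the window, with p
    large and even, is subject to three effects: the lower bound on B extracts a
    mean-field interaction of rate 1 / r_k^2 per pair, which makes it decay; the
    long range exchange is O(1 / r_k) per unit time by the upper bound on B; the
    short range exchange created by a cutoff is controlled by the regularity at
    one time of Xi close to 0. So (v - a)^p averages to at most 2^-k after k
    scales. Stopping at radius R = sigma^(1 - alpha) gives a level G with
    G^(4p) of order R / sigma, and going on for a few more scales shows that
    |v - a| > G holds for at most N0 = R sigma^-c sites at each time close to 0.

    On the last time interval, of length between N0 and R, the truncation
    (v - a - G - g)_+, for a barrier g, lives on N0 sites and hence jumps out of
    its support at rate 1 / N0; it is therefore tiny at time 0, so that
    |v - a| <= 2G on the whole ball of radius R. *)

(** The large power is what makes one scale close. The decay rate of the p-th moment carries the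
    factor p, whereas the cost of the cutoff and of the tails has a bound independent of p: the
    constant in [cutoff_form_ge] is 2, and the excess over the height w sums to O(1 / p). With p of
    order C Lam the moment contracts within a time r / Lam, during which the exchange with the
    exterior stays a small fraction of the moment bound. One scale halves w^p and divides r by 16 =
    2^4, whence the exponent 4p and the final [q] = 1 / (4p).

    The derivative of v exists at every interior time, but B is merely measurable in time and its
    short range part is bounded in time average. Differential inequalities are therefore integrated
    against a measurable, possibly unbounded source, which calls for a comparison lemma of its own.

    The losses K^xi and K^rho are absorbed by z = sigma^(1/400), while y = z^5 = sigma^(1/80)
    separates the scales: up to constants the last window has radius R / y^12, N0 is R / y^3, and
    the final time interval has length R / y. *)

(** * Integration of pointwise derivative bounds with a measurable source *)

Section ComparisonLemma.
Context {R : realType}.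
Local Notation mu := (@lebesgue_measure R).

Let le_mu (A B : set R) :
  measurable A -> measurable B -> A `<=` B -> (mu A <= mu B)%E.
Proof. by move=> mA mB AB; apply: le_measure => //; apply/mem_set. Qed.

(* A Vitali-Caratheodory majorant: s is sliced into level sets, each of which is enlarged to an open set of almost the same measure. *)
Lemma open_majorant (s : R -> R) (a b e : R) : a <= b -> 0 < e ->
    measurable_fun `[a, b] s -> (forall t, t \in `[a, b] -> 0 <= s t) ->
  exists g : R -> \bar R,
    [/\ measurable_fun [set: R] g, forall t, (0 <= g t)%E,
        (forall t, t \in `[a, b] -> exists2 c : R, s t < c &
           exists2 h : R, 0 < h & forall x, `|x - t| < h -> (c%:E <= g x)%E)
      & (\int[mu]_(x in `[a, b]) g x <=
          \int[mu]_(x in `[a, b]) (s x)%:E + e%:E)%E].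
Proof.
move=> ab e0 ms s0.
pose T : set R := `[a, b]%classic.
have mT : measurable T by exact: measurable_itv.
(* Replacing s by the top of its level of width [d] adds at most d (b - a) <= e / 2 to the integral;
   the 1 keeps the denominator positive when a = b. *)
pose d := e / (2 * (1 + (b - a))).
have ba0 : 0 <= b - a by rewrite subr_ge0.
have d0 : 0 < d by rewrite divr_gt0// mulr_gt0//; lra.
pose c (k : nat) : R := k.+1%:R * d.
have c0 k : 0 < c k by rewrite mulr_gt0.
pose E k := T `&` s @^-1` `[k%:R * d, c k[.
have mE k : measurable (E k) by apply: ms => //; exact: measurable_itv.
have muE k : (mu (E k) < +oo)%E.
  apply: (@le_lt_trans _ _ (mu T)).
    by apply: le_mu => //; apply: subIsetl.
  by rewrite lebesgue_measure_itv/=; case: ifP => // _; rewrite -EFinD ltry.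
(* The excess of the k-th open set costs c k times [dl k], that is e / 2 divided by 2^(k+1); these
   costs sum to e / 2. *)
pose dl k := e / 2 / (2 ^ k.+1)%:R / c k.
have dl0 k : 0 < dl k by rewrite !divr_gt0// ltr0n expn_gt0.
have /choice[U HU] k : exists U : set R,
    [/\ open U, E k `<=` U & (mu (U `\` E k) < (dl k)%:E)%E].
  by apply: (@lebesgue_regularity_outer R (E k) (dl k) (mE k) (muE k) (dl0 k)).
have mU k : measurable (U k) by case: (HU k) => oU _ _; exact: open_measurable.
pose g x := (\big[+%E/0]_(0 <= k <oo) ((c k)%:E * (\1_(U k) x)%:E))%E.
have g1 k x : (0 <= (c k)%:E * (\1_(U k) x)%:E)%E.
  by rewrite mule_ge0// lee_fin// ltW.
have mI k : measurable_fun [set: R] (fun x : R => (\1_(U k) x)%:E : \bar R).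
  by apply/measurable_EFinP; exact: measurable_indic.
have mg1 k : measurable_fun setT (fun x => ((c k)%:E * (\1_(U k) x)%:E)%E).
  by apply: measurable_funeM; exact: mI.
exists g; split.
- by apply: ge0_emeasurable_sum.
- by move=> t; apply: nneseries_ge0.
- move=> t tab; have st0 := s0 t tab.
  pose k := Num.truncn (s t / d).
  have /andP[k1 k2] : k%:R <= s t / d < k.+1%:R.
    by apply: truncn_itv; rewrite divr_ge0// ltW.
  have tE : E k t.
    split; first by [].
    by rewrite /= in_itv/= /c -ler_pdivlMr// k1 -ltr_pdivrMr.
  have [oU EU _] := HU k.
  exists (c k); first by rewrite /c -ltr_pdivrMr.
  have /nbhs_ballP[h h0 Hh] : nbhs t (U k) by apply: open_nbhs_nbhs; split => //; apply: EU.
  exists h => // x xt.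
  have xU : U k x by apply: Hh; rewrite /ball/= distrC.
  rewrite /g.
  have := @nneseries_lim_ge _ (fun k => ((c k)%:E * (\1_(U k) x)%:E)%E) xpredT 0 k.+1 (fun n _ _ => g1 n x).
  apply: le_trans.
  rewrite big_nat_recr//= indicE mem_set// mule1 leeDr//.
  by apply: sume_ge0.
- rewrite integral_nneseries//; last first.
    by move=> k; apply: (measurable_funTS (mg1 k)).
  have -> : (\int[mu]_(x in `[a, b]) (s x)%:E = \int[mu]_(x in T) (s x)%:E)%E by [].
  have TE : T = \bigcup_k E k.
    apply/seteqP; split; last by move=> x [k _ []].
    move=> t tab; have st0 := s0 t tab.
    exists (Num.truncn (s t / d)) => //; split=> //.
    have /andP[k1 k2] : (Num.truncn (s t / d))%:R <= s t / d < (Num.truncn (s t / d)).+1%:R.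
      by apply: truncn_itv; rewrite divr_ge0// ltW.
    by rewrite /= in_itv/= /c -ler_pdivlMr// k1 -ltr_pdivrMr.
  have tE : trivIset setT E.
    apply/trivIsetP => i j _ _ ij; apply/seteqP; split=> // t [[_ /=]].
    rewrite in_itv/= => /andP[i1 i2] [_ /=]; rewrite in_itv/= => /andP[j1 j2].
    have h1 : (i%:R : R) < j.+1%:R by rewrite -(ltr_pM2r d0); apply: le_lt_trans i1 j2.
    have h2 : (j%:R : R) < i.+1%:R by rewrite -(ltr_pM2r d0); apply: le_lt_trans j1 i2.
    by move: h1 h2 ij; rewrite !ltr_nat !ltnS => h1 h2; rewrite eqn_leq h1 h2.
  have ms' : measurable_fun T (fun x => (s x)%:E) by exact/measurable_EFinP.
  have key k : (\int[mu]_(x in `[a, b]) ((c k)%:E * (\1_(U k) x)%:E) <=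
      \int[mu]_(x in E k) ((s x)%:E + d%:E) + (e / 2 / (2 ^ k.+1)%:R)%:E)%E.
    have [oU EU muU] := HU k.
    rewrite ge0_integralZl_EFin//; last 2 first.
    - exact: (measurable_funTS (mI k)).
    - exact: ltW.
    rewrite integral_indic//; last exact: mU.
    have h1 : (mu (U k `&` T) <= mu (E k) + (dl k)%:E)%E.
      have -> : U k `&` T = E k `|` ((U k `\` E k) `&` T).
        apply/seteqP; split => x.
          move=> [Ux Tx]; case: (pselect (E k x)) => Ex; [by left|by right].
        by case=> [Ex|[[Ux _] Tx]]; split=> //; [exact: EU|by case: Ex].
      have mUE : measurable (U k `\` E k) by exact: (measurableD (mU k) (mE k)).
      have mUT : measurable ((U k `\` E k) `&` T) by exact: measurableI.
      apply: le_trans (measureU2 mu (mE k) mUT) _.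
      apply: leeD => //; apply: le_trans (ltW muU).
      by apply: le_mu => //; exact: subIsetl.
    apply: (@le_trans _ _ ((c k)%:E * (mu (E k) + (dl k)%:E))%E).
      by apply: lee_wpmul2l => //; rewrite lee_fin ltW.
    rewrite ge0_muleDr//; last by rewrite lee_fin ltW.
    rewrite -EFinM; have -> : c k * dl k = e / 2 / (2 ^ k.+1)%:R.
      by rewrite /dl mulrC divfK// gt_eqF.
    apply: leeD => //.
    have -> : ((c k)%:E * mu (E k) = \int[mu]_(x in E k) (c k)%:E)%E by rewrite integral_cst//; exact: mE.
    apply: ge0_le_integral => //.
    - exact: mE.
    - by move=> x Ex; rewrite lee_fin ltW.
    - apply: emeasurable_funD; last by [].
      by apply: measurable_funS ms' => //; exact: subIsetl.
    - move=> x [_ /=]; rewrite in_itv/= -EFinD lee_fin /c => /andP[k1 _].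
      by rewrite -natr1 mulrDl mul1r lerD2r.
  apply: le_trans (lee_nneseries (v := fun k => (\int[mu]_(x in E k) ((s x)%:E + d%:E) + (e / 2 / (2 ^ k.+1)%:R)%:E)%E) _ _) _.
  - by move=> k _ _; apply: integral_ge0.
  - by move=> k _; exact: key.
  have sT x : T x -> 0 <= s x by move=> Tx; exact: s0.
  have sd0 x : T x -> (0 <= (s x)%:E + d%:E)%E.
    by move=> /sT Tx; rewrite -EFinD lee_fin addr_ge0// ltW.
  rewrite nneseriesD//; last 2 first.
  - move=> k _ _; apply: integral_ge0 => x [Tx _]; exact: sd0.
  - by move=> k _ _; rewrite lee_fin ltW// !divr_gt0// ltr0n expn_gt0.
  rewrite -ge0_integral_bigcup//; last 2 first.
  - rewrite -TE; apply: emeasurable_funD => //.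
  - by rewrite -TE.
  rewrite -TE ge0_integralD//; last by move=> x Tx; rewrite lee_fin ltW.
  rewrite integral_cst// -addeA leeD2l//.
  have e20 : 0 <= e / 2 by rewrite divr_ge0// ltW.
  apply: le_trans (leeD (lexx _) (epsilon_trick0 xpredT e20)) _.
  rewrite /T/= lebesgue_measure_itv/= lte_fin.
  have -> : ((if (a < b)%R then (b%:E - a%:E)%E else 0) = (b - a)%:E)%E.
    case: ifPn => [_|]; first by rewrite EFinB.
    rewrite -leNgt => ba; have -> : a = b by apply/le_anti; rewrite ab ba.
    by rewrite subrr.
  rewrite -EFinM -EFinD lee_fin.
  have : d * (2 * (1 + (b - a))) = e by rewrite /d divfK// gt_eqF// mulr_gt0//; lra.
  nra.
Qed.

Let continuous_within_eps (F : R -> R) (a b t e : R) :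
    {within `[a, b], continuous F} -> t \in `[a, b] -> 0 < e ->
  exists2 h : R, 0 < h &
    forall x, x \in `[a, b] -> `|x - t| < h -> `|F x - F t| < e.
Proof.
move=> /subspace_continuousP cF tab e0.
have /cvgrPdist_lt/(_ e e0) := cF t tab.
rewrite near_withinE => /nbhs_ballP[h /= h0 Hh].
exists h => // x xab xt; rewrite distrC; apply: Hh => //.
by rewrite /ball/= distrC.
Qed.

Let derive_slope (F : R -> R) (t d k : R) : is_derive t 1 F d -> d < k ->
  exists2 h : R, 0 < h & forall x, t < x < t + h -> F x - F t <= k * (x - t).
Proof.
move=> [dF Fd] dk.
have := dF => /cvg_ex[/= l Hl].
have ld : l = d by rewrite -Fd /derive; apply/esym/cvg_lim.
move: Hl; rewrite ld => /cvgrPdist_lt /(_ (k - d)); rewrite subr_gt0 => /(_ dk).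
rewrite near_withinE => /nbhs_ballP[h /= h0 Hh].
exists h => // x /andP[tx xth].
have xt0 : 0 < x - t by rewrite subr_gt0.
have := Hh (x - t); rewrite /ball/= sub0r normrN gtr0_norm// ltrBlDl.
move=> /(_ xth); rewrite gt_eqF// => /(_ isT).
rewrite /GRing.scale/= mulr1 subrK => H.
have : (x - t)^-1 * (F x - F t) < k.
  by move: H; rewrite ltr_norml => /andP[H _]; lra.
by rewrite mulrC ltr_pdivrMr// => /ltW.
Qed.

Let itv_cat (a b c : R) : a <= b -> b <= c ->
  `[a, c]%classic = `[a, b]%classic `|` `]b, c]%classic /\
  [disjoint `[a, b]%classic & `]b, c]%classic].
Proof.
move=> ab bc; split.
  apply/seteqP; split => z /=; rewrite !in_itv/=.
    by move=> /andP[az zx]; have [zc|zc] := leP z b; [left; rewrite az|right; rewrite zx].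
  case=> /andP[h1 h2]; apply/andP; split => //; first exact: le_trans bc.
  exact: le_trans ab (ltW h1).
apply/disj_setPS => z [/=]; rewrite !in_itv/= => /andP[_ h1] /andP[h2 _].
by move: h1; rewrite leNgt h2.
Qed.

(** Absolute continuity of F is not known beforehand, so a continuation argument replaces the
    fundamental theorem of calculus. The majorant g of [open_majorant] is bounded below near t by a
    constant above s t; hence just to the right of each interior time F grows no faster than the
    integral of g, and the inequality with g in place of s propagates. *)
Lemma le_integral_derive (F s : R -> R) (a b : R) : a <= b ->
    {within `[a, b], continuous F} ->
    measurable_fun `[a, b] s -> (forall t, t \in `[a, b] -> 0 <= s t) ->
    (forall t, a < t < b -> exists2 d, is_derive t 1 F d & d <= s t) ->
  ((F b - F a)%:E <= \int[mu]_(x in `[a, b]) (s x)%:E)%E.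
Proof.
move=> ab cF ms s0 dF.
have cont t e := @continuous_within_eps F a b t e cF.
have addeP (x y : \bar R) : (forall e : R, 0 < e -> (x <= y + e%:E)%E) -> (x <= y)%E.
  by move=> H; apply/lee_addgt0Pr.
apply: (addeP) => e e0.
have [g [mg g0 Hg Ig]] := open_majorant ab e0 ms s0.
apply: le_trans Ig.
apply: (addeP) => n n0.
pose G t := (\int[mu]_(x in `[a, t]) g x)%E.
have G0 t : (0 <= G t)%E by apply: integral_ge0.
have mgT (A : set R) : measurable_fun A g by exact: (measurable_funTS mg).
have Gmono t t' : t <= t' -> (G t <= G t')%E.
  move=> tt; apply: ge0_subset_integral => //; first exact: mgT.
  by move=> x /=; rewrite !in_itv/= => /andP[-> /le_trans->].
(* The times up to which the bound holds with slack [n]; their supremum is shown to be b. *)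
pose S := [set t | t \in `[a, b] /\
  forall x, a <= x <= t -> ((F x - F a)%:E <= G x + n%:E)%E].
have Sa : S a.
  split; first by rewrite in_itv/= lexx.
  move=> x; rewrite -eq_le => /eqP <-; rewrite subrr.
  by apply: adde_ge0 => //; rewrite lee_fin ltW.
have supS : has_sup S.
  split; first by exists a.
  by exists b => x [+ _]; rewrite in_itv/= => /andP[].
pose c := sup S.
have ac : a <= c by apply: ub_le_sup => //; case: supS.
have cb : c <= b.
  by apply: ge_sup; [exists a|move=> x [+ _]; rewrite in_itv/= => /andP[]].
have below x : a <= x -> x < c -> ((F x - F a)%:E <= G x + n%:E)%E.
  move=> ax xc.
  have [t [St xt]] : exists t, S t /\ x < t.
    have cx0 : 0 < c - x by rewrite subr_gt0.
    have [t St xt] := sup_adherent cx0 supS.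
    by exists t; split => //; move: xt; rewrite -/c; lra.
  by apply: (St.2); rewrite ax ltW.
have cin : c \in `[a, b] by rewrite in_itv/= ac.
have atc : ((F c - F a)%:E <= G c + n%:E)%E.
  rewrite leNgt; apply/negP => H.
  have Gfin : G c \is a fin_num.
    rewrite ge0_fin_numE//; apply: (@le_lt_trans _ _ (G c + n%:E)%E).
      by rewrite leeDl// lee_fin ltW.
    by apply: lt_trans H _; rewrite ltry.
  move: H; rewrite -(fineK Gfin) -EFinD lte_fin => H.
  have ac' : a < c.
    rewrite lt_neqAle ac andbT; apply/eqP => acE.
    move: H; rewrite -acE subrr; have := fine_ge0 (G0 a); lra.
  have [h h0 Hh] := cont c (F c - F a - (fine (G c) + n)) cin ltac:(by rewrite subr_gt0).
  pose x := Num.max a (c - h / 2).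
  have xc : x < c by rewrite gt_max ac'/=; lra.
  have ax : a <= x by rewrite le_max lexx.
  have cx : c - h / 2 <= x by rewrite le_max lexx orbT.
  have := Hh x; rewrite in_itv/= ax (le_trans (ltW xc) cb) => /(_ isT).
  rewrite ler0_norm; last by lra.
  move=> /(_ ltac:(lra)); rewrite ltr_norml => /andP[H1 _].
  have := below x ax xc; apply/negP; rewrite -ltNge.
  apply: (@le_lt_trans _ _ (G c + n%:E)%E); first by apply: leeD => //; apply: Gmono; exact: ltW.
  by rewrite -(fineK Gfin) -EFinD lte_fin; lra.
have Sup x : S x -> x <= c by move=> Sx; apply: ub_le_sup => //; case: supS.
have uptoc x : a <= x -> x <= c -> ((F x - F a)%:E <= G x + n%:E)%E.
  by move=> ax; rewrite le_eqVlt => /orP[/eqP->//|]; exact: below.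
have [<-//|cb'] : c = b \/ c < b.
  by move: cb; rewrite le_eqVlt => /orP[/eqP|]; [left|right].
exfalso.
suff [h h0 Hh] : exists2 h : R, 0 < h & forall x, c < x < c + h -> x < b ->
    ((F x - F a)%:E <= G x + n%:E)%E.
  pose y := Num.min (c + h / 2) ((c + b) / 2).
  have y1 : y <= c + h / 2 by rewrite ge_min lexx.
  have y2 : y <= (c + b) / 2 by rewrite ge_min lexx orbT.
  have cy : c < y by rewrite lt_min; apply/andP; split; lra.
  suff /Sup : S y by rewrite leNgt cy.
  split; first by rewrite in_itv/=; apply/andP; split; lra.
  move=> x /andP[ax xy].
  have [xc|xc] := leP x c; first exact: uptoc.
  apply: Hh; last by lra.
  by apply/andP; split; lra.
(* At the left end F is continuous but no derivative is given; there the slack [n] provides the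
   first interval. *)
have [ca|ca] := leP c a.
  have [h h0 Hh] := cont a n ltac:(by rewrite in_itv/= lexx) n0.
  exists h => // x /andP[cx xch] xb.
  have := Hh x; rewrite in_itv/= => /(_ ltac:(apply/andP; split; lra)).
  rewrite gtr0_norm; last lra.
  move=> /(_ ltac:(lra)); rewrite ltr_norml => /andP[_ H1].
  apply: (@le_trans _ _ (n%:E)%E); first by rewrite lee_fin ltW.
  by rewrite leeDr.
have [d dFc dsc] := dF c ltac:(by rewrite ca).
have [k sk [h2 h20 Hk]] := Hg c cin.
have [h1 h10 Hh1] := derive_slope dFc (le_lt_trans dsc sk).
have k0 : 0 <= k by apply: ltW; apply: le_lt_trans sk; exact: s0.
exists (Num.min h1 h2); first by rewrite lt_min h10.
move=> x /andP[cx]; rewrite -ltrBlDl lt_min => /andP[xh1 xh2] xb.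
have F1 := Hh1 x ltac:(apply/andP; split; lra).
have GE : (G c + (k * (x - c))%:E <= G x)%E.
  rewrite /G.
  have [UE dis] := itv_cat ac (ltW cx).
  rewrite UE ge0_integral_setU//; last exact: mgT.
  apply: leeD => //.
  apply: (@le_trans _ _ (\int[mu]_(z in `]c, x]) k%:E)%E).
    rewrite integral_cst//= lebesgue_measure_itv/= lte_fin cx -EFinD -EFinM//.
  apply: ge0_le_integral => //; first exact: mgT.
  move=> z /=; rewrite in_itv/= => /andP[cz zx]; apply: Hk.
  by rewrite gtr0_norm; lra.
apply: (@le_trans _ _ (G c + (k * (x - c))%:E + n%:E)%E); last exact: leeD.
have -> : F x - F a = F c - F a + (F x - F c) by lra.
by rewrite EFinD addeAC; apply: leeD.
Qed.
End ComparisonLemma.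

(** * Gronwall's inequality and the scalar equation a' = l (A - a) *)

Section OneDimensional.
Context {R : realType}.
Local Notation mu := (@lebesgue_measure R).

Lemma is_derive_expR_affine (k b t : R) :
  is_derive t 1 (fun t => expR (k * (t - b))) (k * expR (k * (t - b))).
Proof.
have H : is_derive t 1 (fun t : R => k * (t - b)) k.
  by apply: is_derive_eq; rewrite /GRing.scale/= ?(subr0,mulr1,mulr0,addr0,scaler0).
rewrite [X in is_derive _ _ _ X]mulrC.
exact: (@is_derive1_comp _ expR (fun t : R => k * (t - b)) t _ _ (is_derive_expR _) H).
Qed.

(** The integrating factor exp(k (t - b)) is normalised at the right end. It is at most 1 on [a, b],
    so the source enters through its plain time integral, which is the form in which regularity
    controls B. *)
Lemma gronwall_le (F s : R -> R) (a b k M : R) : a <= b -> 0 <= k ->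
    (forall t, a <= t <= b -> {for t, continuous F}) ->
    measurable_fun `[a, b] s -> (forall t, a <= t <= b -> 0 <= s t) ->
    (forall t, a < t < b -> exists2 d, is_derive t 1 F d & d <= - k * F t + s t) ->
    (\int[mu]_(x in `[a, b]) (s x)%:E <= M%:E)%E ->
  F b <= expR (- k * (b - a)) * F a + M.
Proof.
move=> ab k0 cF ms s0 dF sM.
pose e t := expR (k * (t - b)).
have de (t : R) : is_derive t 1 e (k * e t).
  exact: is_derive_expR_affine.
pose G t := e t * F t.
have cG : {within `[a, b], continuous G}.
  apply/continuous_in_subspaceT => t /set_mem/=; rewrite in_itv/= => tab.
  apply: continuousM; last exact: cF.
  by apply/differentiable_continuous/derivable1_diffP; apply: (ex_derive (is_derive := de t)).
have e1 t : a <= t <= b -> e t <= 1.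
  move=> /andP[_ tb]; rewrite /e -expR0 ler_expR; nra.
have := @le_integral_derive R G s a b ab cG ms.
have si t : t \in `[a, b] -> 0 <= s t by rewrite in_itv/=; exact: s0.
move=> /(_ si) H.
have : ((G b - G a)%:E <= M%:E)%E.
  apply: le_trans sM; apply: H => t tab.
  have [d dFt dle] := dF t tab.
  have tab' : a <= t <= b by case/andP: tab => ? ?; rewrite !ltW.
  exists (e t * d + F t * (k * e t)).
    exact: is_deriveM.
  have := e1 t tab'; have := s0 t tab'; have : 0 <= e t by exact: expR_ge0.
  move=> E0 S0 E1; have h1 := ler_wpM2l E0 dle.
  have h2 := ler_wpM2r S0 E1; move: h1 h2; clear.
  by rewrite mulrDr mul1r; lra.
rewrite lee_fin /G /e subrr mulr0 expR0 mul1r => h.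
have -> : - k * (b - a) = k * (a - b) by ring.
by rewrite -lerBlDl.
Qed.

Lemma linear_ode (A : R -> R) (t0 a0 l : R) : continuous A ->
  exists2 a : R -> R, a t0 = a0 & forall t, t0 <= t ->
    is_derive t 1 a (l * (A t - a t)).
Proof.
move=> cA.
pose f s := l * expR (l * (s - t0)) * A s.
have de (t : R) : is_derive t 1 (fun t => expR (l * (t - t0))) (l * expR (l * (t - t0))).
  exact: is_derive_expR_affine.
have ce (t : R) : {for t, continuous (fun t => expR (l * (t - t0)))}.
  by apply/differentiable_continuous/derivable1_diffP; apply: (ex_derive (is_derive := de t)).
have cf (t : R) : {for t, continuous f}.
  apply: continuousM; last exact: cA.
  apply: continuousM; [exact: cvg_cst|exact: ce].
(* Starting the primitive at t0 - 1 makes it differentiable from both sides at t0 as well. *)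
pose F t := (\int[mu]_(s in `[t0 - 1, t]) f s)%R.
have dF (t : R) : t0 <= t -> is_derive t 1 F (f t).
  move=> tt.
  have [] := @continuous_FTC1_closed R f (t0 - 1) t (t + 1).
  - by lra.
  - apply: continuous_compact_integrable; first exact: segment_compact.
    exact: continuous_subspaceT.
  - by lra.
  - exact: cf.
  move=> dF Fd; apply: DeriveDef; first exact: dF.
  by rewrite -derive1E.
move: F dF => F dF.
pose E t := expR (- l * (t - t0)).
have dE (t : R) : is_derive t 1 E (- l * E t).
  exact: is_derive_expR_affine.
exists (fun t => E t * (a0 + (F t - F t0))).
  by rewrite /E !subrr mulr0 expR0 mul1r addr0.
move=> t tt; have dFt := dF t tt.
have dg : is_derive t 1 (fun t => a0 + (F t - F t0)) (f t).
  have := is_deriveD (is_derive_cst a0 t 1) (is_deriveB dFt (is_derive_cst (F t0) t 1)).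
  by rewrite add0r subr0.
have dEt := dE t.
have H := is_deriveM dEt dg.
rewrite [X in is_derive _ _ _ X](_ : _ =
  E t *: f t + (a0 + (F t - F t0)) *: (- l * E t)); first exact: H.
rewrite /GRing.scale/= /f.
have -> : E t * (l * expR (l * (t - t0)) * A t) = l * A t.
  rewrite /E mulNr expRN; field.
  by rewrite gt_eqF// expR_gt0.
ring.
Qed.

(* The derivative of a is a multiple of A - a, so a stays below any upper bound of A and a t0. *)
Lemma linear_ode_ub (A a : R -> R) (t0 t1 l m : R) : 0 <= l ->
    (forall t, t0 <= t -> is_derive t 1 a (l * (A t - a t))) ->
    (forall t, t0 <= t <= t1 -> A t <= m) -> a t0 <= m ->
  forall t, t0 <= t <= t1 -> a t <= m.
Proof.
move=> l0 da Am am t /andP[t0t tt1].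
rewrite -subr_le0.
apply: le_trans (@gronwall_le (fun t => a t - m) (cst 0) t0 t l 0 t0t l0 _ _ _ _ _) _.
- move=> s /andP[s0 _]; apply: continuousB; last exact: cvg_cst.
  by apply/differentiable_continuous/derivable1_diffP; apply: (ex_derive (is_derive := da s s0)).
- exact: measurable_cst.
- by [].
- move=> s /andP[s0 st]; have das := da s (ltW s0).
  exists (l * (A s - a s)).
    by have := is_deriveB das (is_derive_cst m s 1); rewrite subr0.
  have : A s <= m by apply: Am; rewrite ltW//= (le_trans (ltW st)).
  rewrite /cst/=; move: l0; clear; nra.
- by rewrite integral0_eq.
rewrite addr0 mulr_ge0_le0 ?expR_ge0// subr_le0//.
Qed.

Lemma linear_ode_bound (A a : R -> R) (t0 t1 l m h : R) : 0 <= l ->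
    (forall t, t0 <= t -> is_derive t 1 a (l * (A t - a t))) ->
    (forall t, t0 <= t <= t1 -> `|A t - m| <= h) -> `|a t0 - m| <= h ->
  forall t, t0 <= t <= t1 -> `|a t - m| <= h.
Proof.
move=> l0 da Am am t tt; rewrite ler_distl.
apply/andP; split; last first.
  apply: (linear_ode_ub l0 da _ _ tt).
    by move=> s /Am; rewrite ler_distl => /andP[].
  by move: am; rewrite ler_distl => /andP[].
have daN s : t0 <= s -> is_derive s 1 (\- a) (l * ((\- A) s - (\- a) s)).
  by move=> ts; have := is_deriveN (da s ts); rewrite -mulrN opprB /= opprK addrC.
have := linear_ode_ub l0 daN (m := h - m) _ _ tt => /= H.
suff : - a t <= h - m by lra.
apply: H.
  by move=> s /Am; rewrite ler_distl => /andP[+ _]; lra.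
by move: am; rewrite ler_distl => /andP[+ _]; lra.
Qed.

(** A and a both stay within h of a t0, so the speed of a is at most 2 l h. This bounds the motion
    of the level over one scale. *)
Lemma linear_ode_drift (A a : R -> R) (t0 t1 l h : R) : 0 <= l -> 0 <= h ->
    (forall t, t0 <= t -> is_derive t 1 a (l * (A t - a t))) ->
    (forall t, t0 <= t <= t1 -> `|A t - a t0| <= h) ->
  forall t, t0 <= t <= t1 -> `|a t - a t0| <= 2 * l * (t1 - t0) * h.
Proof.
move=> l0 h0 da Ah t /andP[tt0 tt1].
have ca s : t0 <= s -> {for s, continuous a}.
  by move=> s0; apply/differentiable_continuous/derivable1_diffP; apply: (ex_derive (is_derive := da s s0)).
have ah s : t0 <= s <= t1 -> `|a s - a t0| <= h.
  by apply: (linear_ode_bound l0 da Ah); rewrite subrr normr0.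
have [->|ne] := eqVneq t t0.
  by rewrite subrr normr0 !mulr_ge0// subr_ge0 (le_trans tt0).
have tlt : t0 < t by rewrite lt_neqAle eq_sym ne.
have [s] : exists2 s, s \in `]t0, t[ & a t - a t0 = l * (A s - a s) * (t - t0).
  apply: MVT => //.
    by move=> s; rewrite in_itv/= => /andP[? _]; apply: da; exact: ltW.
  by apply/continuous_in_subspaceT => s /set_mem/=; rewrite in_itv/= => /andP[? _]; exact: ca.
rewrite in_itv/= => /andP[s0 s1] ->.
have sin : t0 <= s <= t1 by rewrite ltW//= ltW// (lt_le_trans s1).
have h1 := Ah s sin; have h2 := ah s sin.
rewrite !normrM (ger0_norm l0) (@ger0_norm _ (t - t0)) ?subr_ge0//.
have h3 : `|A s - a s| <= 2 * h.
  have -> : A s - a s = (A s - a t0) - (a s - a t0) by ring.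
  by apply: le_trans (ler_normB _ _) _; lra.
have -> : 2 * l * (t1 - t0) * h = l * (2 * h) * (t1 - t0) by ring.
by apply: ler_pM => //; rewrite ?mulr_ge0 ?subr_ge0 ?lerB// ler_wpM2l.
Qed.

End OneDimensional.

(** * Elementary inequalities between powers *)

Section PowerInequalities.
Context {R : realFieldType}.
Implicit Types (a b f g x y w e : R) (n : nat).

Let ler_eq x y : x = y -> x <= y. Proof. by move=> ->. Qed.

Lemma exprBn_ge n a b : 0 <= b -> b <= a ->
  n.+1%:R * (a - b) * b ^+ n <= a ^+ n.+1 - b ^+ n.+1.
Proof.
move=> b0 ba; have a0 := le_trans b0 ba.
elim: n => [|n IH]; first by rewrite expr0 !expr1 mulr1 mul1r.
have -> : a ^+ n.+2 - b ^+ n.+2 =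
    a * (a ^+ n.+1 - b ^+ n.+1) + (a - b) * b ^+ n.+1 by rewrite !exprS; ring.
have -> : n.+2%:R * (a - b) * b ^+ n.+1 =
    b * (n.+1%:R * (a - b) * b ^+ n) + (a - b) * b ^+ n.+1.
  by rewrite -[n.+2%:R]natr1 exprS; ring.
rewrite lerD2r; apply: ler_pM => //.
by rewrite !mulr_ge0 ?subr_ge0 ?exprn_ge0.
Qed.

Lemma exprBn_le n a b : 0 <= b -> b <= a ->
  a ^+ n.+1 - b ^+ n.+1 <= n.+1%:R * (a - b) * a ^+ n.
Proof.
move=> b0 ba; have a0 := le_trans b0 ba.
elim: n => [|n IH]; first by rewrite expr0 !expr1 mulr1 mul1r.
have -> : a ^+ n.+2 - b ^+ n.+2 =
    a * (a ^+ n.+1 - b ^+ n.+1) + (a - b) * b ^+ n.+1 by rewrite !exprS; ring.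
have -> : n.+2%:R * (a - b) * a ^+ n.+1 =
    a * (n.+1%:R * (a - b) * a ^+ n) + (a - b) * a ^+ n.+1.
  by rewrite -[n.+2%:R]natr1 exprS; ring.
apply: lerD; first exact: ler_wpM2l.
by apply: ler_wpM2l; rewrite ?subr_ge0// lerXn2r.
Qed.

Lemma exprn_tangent n x y : 0 <= x -> 0 <= y ->
  n.+1%:R * x ^+ n * (y - x) <= y ^+ n.+1 - x ^+ n.+1.
Proof.
move=> x0 y0; have [xy|/ltW yx] := leP x y.
  by apply: le_trans (exprBn_ge n x0 xy); rewrite mulrAC.
rewrite -lerN2 opprB -mulrN opprB; apply: le_trans (exprBn_le n y0 yx) _.
by rewrite mulrAC.
Qed.

(** Convexity at y = (x + e w) / (1 + e), written with tangents at y. It transfers a moment from one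
    level to another; the factor (1 + e)^n stays bounded because e will be O(1 / n). *)
Lemma exprDn_convex n x w e : 0 <= x -> 0 <= w -> 0 <= e ->
  (x + e * w) ^+ n.+1 <= (1 + e) ^+ n * (x ^+ n.+1 + e * w ^+ n.+1).
Proof.
move=> x0 w0 e0; have e1 : 0 < 1 + e by rewrite ltr_pwDl.
pose y := (x + e * w) / (1 + e).
have y0 : 0 <= y by rewrite divr_ge0 ?addr_ge0 ?mulr_ge0.
have yE : x + e * w = (1 + e) * y by rewrite /y; field; rewrite gt_eqF.
rewrite yE exprMn exprSr -mulrA ler_pM2l ?exprn_gt0//.
have h1 := exprn_tangent n y0 x0.
have h2 := ler_wpM2l e0 (exprn_tangent n y0 w0).
have h3 : n.+1%:R * y ^+ n * (x - y) + e * (n.+1%:R * y ^+ n * (w - y)) = 0.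
  have -> : n.+1%:R * y ^+ n * (x - y) + e * (n.+1%:R * y ^+ n * (w - y)) =
    n.+1%:R * y ^+ n * (x + e * w - (1 + e) * y) by ring.
  by rewrite yE subrr mulr0.
move: h1 h2 h3; set A := n.+1%:R * _ * _; set B := e * (n.+1%:R * _ * _).
by rewrite mulrBr mulrDl mul1r; lra.
Qed.

Lemma exprn_mul_le n x w : 0 <= x -> 0 <= w ->
  x ^+ n * w <= x ^+ n.+1 + w ^+ n.+1.
Proof.
move=> x0 w0; have [wx|/ltW xw] := leP w x.
  by apply: ler_wpDr; [exact: exprn_ge0|rewrite exprSr ler_wpM2l// exprn_ge0].
apply: ler_wpDl; first exact: exprn_ge0.
by rewrite exprSr ler_wpM2r// lerXn2r.
Qed.

(* Seen as a quadratic form in f and g, the difference of the two sides is nonnegative because its discriminant is; the constant 2 does not depend on n. *)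
Lemma cutoff_form_ge n a b f g : odd n ->
  - (2 * (f - g) ^+ 2 * (a ^+ n.+1 + b ^+ n.+1)) <=
    n.+1%:R * (a - b) * (f ^+ 2 * a ^+ n - g ^+ 2 * b ^+ n).
Proof.
move=> on; have en : ~~ odd n.+1 by rewrite /= on.
have main (x y u v : R) : 0 <= y -> y <= x ->
    - (2 * (u - v) ^+ 2 * (x ^+ n.+1 + y ^+ n.+1)) <=
      n.+1%:R * (x - y) * (u ^+ 2 * x ^+ n - v ^+ 2 * y ^+ n).
  move=> y0 yx; have x0 := le_trans y0 yx.
  case: n on {en} => // n _.
  pose S := x ^+ n.+2 + y ^+ n.+2; pose k := n.+2%:R * (x - y).
  have k0 : 0 <= k by rewrite mulr_ge0// subr_ge0.
  have X0 : 0 <= x ^+ n.+1 by exact: exprn_ge0.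
  have Y0 : 0 <= y ^+ n.+1 by exact: exprn_ge0.
  have XY : x ^+ n.+1 * x <= S by rewrite -exprSr /S lerDl exprn_ge0.
  have [x00|xn0] := eqVneq x 0.
    have -> : y = 0 by apply/le_anti; rewrite y0 andbT -x00.
    by rewrite x00 subrr !mulr0 mul0r !expr0n/= addr0 mulr0 oppr0.
  have S0 : 0 < S.
    by rewrite ltr_pwDl ?exprn_ge0// exprn_gt0// lt_neqAle eq_sym xn0.
  (* This is the sign of the discriminant. It rests on n + 2 <= 2 (n + 1), which is where the
     constant 2 comes from. *)
  have H : k * (x ^+ n.+1 * y ^+ n.+1) <= 2 * S * (x ^+ n.+1 - y ^+ n.+1).
    have h := exprBn_ge n y0 yx.
    have z0 : 0 <= (x - y) * y ^+ n by rewrite mulr_ge0 ?subr_ge0 ?exprn_ge0.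
    apply: (@le_trans _ _ (2 * S * (n.+1%:R * (x - y) * y ^+ n))); last first.
      by apply: ler_wpM2l => //; rewrite mulr_ge0// ltW.
    have -> : 2 * S * (n.+1%:R * (x - y) * y ^+ n) =
       (2 * n.+1%:R * S) * ((x - y) * y ^+ n) by ring.
    have -> : k * (x ^+ n.+1 * y ^+ n.+1) =
       (n.+2%:R * (x ^+ n.+1 * y)) * ((x - y) * y ^+ n) by rewrite /k exprS [y ^+ _]exprS; ring.
    apply: ler_wpM2r => //; apply: ler_pM => //; first by rewrite mulr_ge0.
      by rewrite -natrM ler_nat mul2n -addnn addSnnS leq_addl.
    by apply: le_trans XY; apply: ler_wpM2l.
  rewrite -subr_ge0 opprK.
  have -> : k * (u ^+ 2 * x ^+ n.+1 - v ^+ 2 * y ^+ n.+1) + 2 * (u - v) ^+ 2 * S =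
    (k * x ^+ n.+1 + 2 * S) * u ^+ 2 - 4 * S * (u * v) + (2 * S - k * y ^+ n.+1) * v ^+ 2.
    by ring.
  move: H X0 Y0 S0; move: (x ^+ n.+1) (y ^+ n.+1) S k0 {XY}; clear => X Y S k0 H X0 Y0 S0.
  have U2 : 0 < k * X + 2 * S by apply: ltr_wpDl; [exact: mulr_ge0|exact: mulr_gt0].
  rewrite -(pmulr_rge0 _ U2).
  have -> : (k * X + 2 * S) * ((k * X + 2 * S) * u ^+ 2 - 4 * S * (u * v) +
      (2 * S - k * Y) * v ^+ 2) = ((k * X + 2 * S) * u - 2 * S * v) ^+ 2 +
      k * (2 * S * (X - Y) - k * (X * Y)) * v ^+ 2 by ring.
  by rewrite addr_ge0 ?sqr_ge0// mulr_ge0 ?sqr_ge0// mulr_ge0// subr_ge0.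
wlog ba : a b f g / b <= a.
  move=> W; have [|/ltW ab] := leP b a; first exact: W.
  have := W b a g f ab; rewrite [b ^+ n.+1 + _]addrC -[(g - f) ^+ 2]sqrrN opprB.
  by move=> h; apply: le_trans h _; apply: ler_eq; ring.
have [b0|b0] := leP 0 b; first exact: main.
have [a0|a0] := leP a 0.
  have := main (- b) (- a) g f; rewrite oppr_ge0 lerN2 => /(_ a0 ba).
  have sN z : (- z) ^+ n = - z ^+ n by rewrite exprNn -signr_odd on expr1 mulN1r.
  have sN1 z : (- z) ^+ n.+1 = z ^+ n.+1 by rewrite exprSr sN mulrNN -exprSr.
  rewrite !sN !sN1 => H.
  apply: le_trans (le_trans H _).
    by apply: ler_eq; ring.
  by apply: ler_eq; ring.
(* Opposite signs, b < 0 < a: as n is odd the right side is nonnegative and the left side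
   nonpositive. *)
apply: (@le_trans _ _ 0).
  have s0 : 0 <= a ^+ n.+1 + b ^+ n.+1.
    by apply: addr_ge0; rewrite exprn_even_ge0//= on.
  by rewrite oppr_le0; apply: mulr_ge0 => //; apply: mulr_ge0 => //; exact: sqr_ge0.
apply: mulr_ge0; first by rewrite mulr_ge0// subr_ge0.
rewrite subr_ge0.
apply: (@le_trans _ _ 0); first by rewrite mulr_ge0_le0 ?sqr_ge0// exprn_odd_le0// ltW.
by rewrite mulr_ge0 ?sqr_ge0// exprn_ge0// ltW.
Qed.

(** Young's inequality with weight x - y: for Q = x^(n+1) - y^(n+1), Q d is at most Q (x - y) / 2 +
    Q d^2 / (2 (x - y)), and Q / (x - y) is at most (n + 1) (x^n + y^n). The first half will be
    absorbed by the energy. *)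
Lemma truncation_form_le n x y (d : R) : 0 <= x -> 0 <= y ->
  (x ^+ n.+1 - y ^+ n.+1) * d <=
    2^-1 * ((x - y) * (x ^+ n.+1 - y ^+ n.+1)) +
    2^-1 * (d ^+ 2 * n.+1%:R * (x ^+ n + y ^+ n)).
Proof.
wlog yx : x y d / y <= x.
  move=> W x0 y0; have [|/ltW xy] := leP y x; first by move=> yx; exact: W.
  have := W y x (- d) xy y0 x0; rewrite sqrrN [y ^+ n + _]addrC.
  move=> h; apply: le_trans (le_trans _ h) _; apply: ler_eq; ring.
move=> x0 y0.
have h := exprBn_le n y0 yx.
have M0 : x ^+ n <= x ^+ n + y ^+ n by rewrite lerDl exprn_ge0.
have x0n : 0 <= x ^+ n by exact: exprn_ge0.
have Q0 : 0 <= x ^+ n.+1 - y ^+ n.+1 by rewrite subr_ge0 lerXn2r.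
have D0 : 0 <= x - y by rewrite subr_ge0.
have h2 : x ^+ n.+1 - y ^+ n.+1 <= n.+1%:R * (x - y) * (x ^+ n + y ^+ n).
  by apply: le_trans h _; apply: ler_wpM2l => //; rewrite mulr_ge0.
move: h2 Q0 D0; move: (x ^+ n.+1 - y ^+ n.+1) (x - y) (x ^+ n + y ^+ n) (le_trans x0n M0).
move=> Q D M M1 h2 Q0 D0.
have [D1|D1] := eqVneq D 0.
  have Q1 : Q = 0 by apply/le_anti; rewrite Q0 andbT (le_trans h2)// D1 mulr0 mul0r.
  by rewrite Q1 !(mul0r, mulr0) add0r mulr_ge0// mulr_ge0// mulr_ge0// sqr_ge0.
have D2 : 0 < D by rewrite lt_neqAle eq_sym D1.
rewrite -(ler_pM2l D2).
have h3 := ler_wpM2r (sqr_ge0 d) h2.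
have h4 : 0 <= Q * (D - d) ^+ 2 by rewrite mulr_ge0// sqr_ge0.
move: h3 h4; rewrite sqrrB; lra.
Qed.

(** Compare x with s. It absorbs a moment of lower order into the dissipated one, at the price of
    s^n per site of the support. *)
Lemma expr_split_le n x (s : R) : 0 <= x -> 0 < s ->
  x ^+ n <= x ^+ n.+2 / s ^+ 2 + s ^+ n.
Proof.
move=> x0 s0; have [sx|/ltW xs] := leP s x.
  apply: ler_wpDr; first by rewrite exprn_ge0// ltW.
  rewrite ler_pdivlMr ?exprn_gt0// -[n.+2]addn2 exprD ler_wpM2l ?exprn_ge0//.
  by rewrite lerXn2r// nnegrE ltW.
have s1 := ltW s0; apply: ler_wpDl; first by rewrite divr_ge0 ?exprn_ge0.
by rewrite lerXn2r// nnegrE ltW.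
Qed.

End PowerInequalities.

(** * Counting sites and summing inverse squares *)

Section LatticeSums.
Context {R : realType}.

Definition coord (K : nat) (i : site K) : R := (pos i)%:~R.

Lemma coordB (K : nat) (i j : site K) : coord i - coord j = (i : nat)%:R - (j : nat)%:R.
Proof. by rewrite /coord /pos !rmorphB/=; ring. Qed.

Lemma sdistE (K : nat) (i j : site K) : sdist R i j = `|coord i - coord j|.
Proof. by rewrite /sdist /coord intr_norm rmorphB. Qed.

Lemma sdist_ge1 (K : nat) (i j : site K) : i != j -> 1 <= `|coord i - coord j|.
Proof.
move=> ij; rewrite -sdistE /sdist ler1z -gtz0_ge1 normr_gt0 subr_eq0.
apply: contra ij => /eqP; rewrite /pos => /addIr [] h; exact/eqP/val_inj.
Qed.

Let card_ord_itv_le n m M : (#|[pred i : 'I_n | (m <= i < M)%N]| <= M - m)%N.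
Proof.
rewrite cardE -(size_map val) -[X in (_ <= X)%N](size_iota m); apply: uniq_leq_size.
  by rewrite map_inj_uniq ?enum_uniq//; exact: val_inj.
move=> x; case/mapP => i; rewrite mem_enum inE mem_iota => /andP[mi iM] ->.
by rewrite mi subnKC// ltnW// (leq_ltn_trans mi).
Qed.

Let card_ord_itv_ge n m M : (M <= n)%N ->
  (M - m <= #|[pred i : 'I_n | (m <= i < M)%N]|)%N.
Proof.
move=> Mn; rewrite cardE -(size_map val) -[X in (X <= _)%N](size_iota m).
apply: uniq_leq_size; first exact: iota_uniq.
move=> x; rewrite mem_iota => /andP[mx].
have [mM|Mm] := leqP m M; last first.
  by rewrite (eqP (ltnW Mm : (M - m == 0)%N)) addn0 ltnNge mx.
rewrite subnKC// => xM.
by apply/mapP; exists (Ordinal (leq_trans xM Mn)) => //; rewrite mem_enum inE mx.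
Qed.

Lemma card_coord_le (K : nat) (l u : R) : l <= u ->
  #|[pred x : site K | l <= coord x <= u]|%:R <= u - l + 1.
Proof.
move=> lu; set A := [pred _ | _].
have [x0 x0A|A0] := pickP A; last by rewrite (eq_card0 A0); lra.
case: (arg_minnP (fun x : site K => nat_of_ord x) x0A) => m mA Hm.
have ul0 : 0 <= u - l by rewrite subr_ge0.
pose t := Num.truncn (u - l).
have AS : (A \subset [pred i : site K | (m <= i < m + t.+1)%N]).
  apply/fintype.subsetP => i iA; rewrite inE Hm//= addnS ltnS -leq_subLR.
  rewrite truncn_ge_nat// natrB ?Hm// -coordB.
  by move: iA mA; rewrite !inE => /andP[? ?] /andP[? ?]; lra.
have := leq_trans (subset_leq_card AS) (card_ord_itv_le _ m (m + t.+1)).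
rewrite addKn -(ler_nat R) => /le_trans; apply.
by rewrite -natr1 lerD2r; have /andP[] := truncn_itv ul0.
Qed.

Lemma card_coord_ge (K : nat) (l u : R) : - K%:R <= l -> l <= u -> u <= K%:R ->
  u - l - 1 <= #|[pred x : site K | l <= coord x <= u]|%:R.
Proof.
move=> Kl lu uK.
have l0 : 0 <= l + K%:R by lra.
have u0 : 0 <= u + K%:R by lra.
pose m := (Num.truncn (l + K%:R)).+1; pose M := (Num.truncn (u + K%:R)).+1.
have /andP[l1 l2] := truncn_itv l0; have /andP[u1 u2] := truncn_itv u0.
have Mn : (M <= K.*2.+1)%N.
  by rewrite /M ltnS -(ler_nat R) -addnn natrD (le_trans u1)// lerD2r.
have h := card_ord_itv_ge m Mn.
have AS : ([pred i : site K | (m <= i < M)%N] \subset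
    [pred x : site K | l <= coord x <= u]).
  apply/fintype.subsetP => i; rewrite !inE /m /M ltnS => /andP[h1 h2].
  have cE : coord i = (i : nat)%:R - K%:R by rewrite /coord /pos rmorphB.
  rewrite cE; apply/andP; split.
    by move: h1; rewrite -(ler_nat R); lra.
  by move: h2; rewrite -(ler_nat R); lra.
apply: le_trans (_ : (M - m)%:R <= _); last first.
  by rewrite ler_nat (leq_trans h)// subset_leq_card.
have mM : (m <= M)%N by rewrite ltnS le_truncn// lerD2r.
by rewrite natrB// /m /M -!natr1 in l2 u2 *; lra.
Qed.

(** A telescoping majorant for the sums of inverse squares. *)
Let inv_sq_le (x : R) : 1 <= x -> x ^- 2 <= 2 / x - 2 / (x + 1).
Proof.
move=> x1; rewrite -subr_ge0.
have x0 : x != 0 by apply/eqP; lra.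
have x2 : x + 1 != 0 by apply/eqP; lra.
have -> : 2 / x - 2 / (x + 1) - x ^- 2 = (x - 1) / (x ^+ 2 * (x + 1)).
  by field; rewrite x0 x2.
by rewrite divr_ge0 ?subr_ge0// mulr_ge0 ?sqr_ge0//; lra.
Qed.

Let sum_nat_inv_sq_le m N : (0 < m)%N ->
  \sum_(m <= d < N) (d%:R : R) ^- 2 <= 2 / m%:R.
Proof.
move=> m0; have [Nm|mN] := leqP N m; first by rewrite big_geq// divr_ge0.
suff : \sum_(m <= d < N) (d%:R : R) ^- 2 <= 2 / m%:R - 2 / N%:R.
  by move=> /le_trans; apply; rewrite lerBlDr lerDl divr_ge0.
elim: N mN => // N IH; rewrite ltnS leq_eqVlt => /orP[/eqP <-|mN].
  by rewrite big_nat1 -[m.+1%:R]natr1; apply: inv_sq_le; rewrite ler1n.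
rewrite big_nat_recr//=; last exact: ltnW.
have N0 : (0 < N)%N by exact: leq_trans mN.
have := inv_sq_le (_ : 1 <= N%:R); rewrite ler1n natr1 => /(_ N0) h.
by apply: le_trans (lerD (IH mN) h) _; rewrite addrA subrK.
Qed.

Let sum_ord_inv_sq_le n i m : (0 < m)%N ->
  \sum_(j < n | (m + i <= j)%N) ((j - i)%:R : R) ^- 2 <= 2 / m%:R.
Proof.
move=> m0; rewrite -(big_geq_mkord (m + i) n xpredT (fun j => ((j - i)%:R : R) ^- 2)).
rewrite big_addn; under eq_bigr do rewrite addnK.
exact: sum_nat_inv_sq_le.
Qed.

(** Each side of x contributes at most 2 / m, with m the integer part of r, and m >= r / 2 because r
    >= 1. *)
Lemma sum_inv_sq_le (K : nat) (x : site K) (r : R) : 1 <= r ->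
  \sum_(y : site K | r <= `|coord x - coord y|) (coord x - coord y) ^- 2 <= 8 / r.
Proof.
move=> r1; have r0 : 0 <= r by rewrite (le_trans _ r1).
pose m := Num.truncn r.
have /andP[mr rm] := truncn_itv r0.
have m0 : (0 < m)%N by rewrite /m -(ltr_nat R); move: rm; rewrite -natr1; lra.
have rm2 : r <= 2 * m%:R.
  by move: rm m0; rewrite -/m -[m.+1%:R]natr1 -(ler_nat R); lra.
have m0R : (0 : R) < m%:R by rewrite ltr0n.
apply: (@le_trans _ _ (2 / m%:R + 2 / m%:R)); last first.
  have -> : 2 / m%:R + 2 / m%:R = 4 / m%:R :> R by field; rewrite gt_eqF.
  by rewrite ler_pdivrMr// mulrAC ler_pdivlMr; [lra|lra].
pose n := K.*2.+1.
have right := sum_ord_inv_sq_le n x m0.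
have left : \sum_(j < n | (m + j <= x)%N) ((x - j)%:R : R) ^- 2 <= 2 / m%:R.
  apply: le_trans (sum_ord_inv_sq_le n (n.-1 - x) m0).
  rewrite (reindex_inj rev_ord_inj)/= le_eqVlt; apply/orP; left; apply/eqP.
  have xn := ltn_ord x; apply: eq_big => [j|j _].
    by have jn := ltn_ord j; rewrite /n/= in jn xn *; apply/idP/idP; lia.
  by have jn := ltn_ord j; congr (_%:R ^- 2); rewrite /n/= in jn xn *; lia.
apply: le_trans (lerD right left); rewrite -/n.
rewrite [X in X <= _]big_mkcond [X in _ <= X + _]big_mkcond [X in _ <= _ + X]big_mkcond.
rewrite -big_split/=.
apply: ler_sum => y _.
have p1 : 0 <= ((y - x)%:R : R) ^- 2 by rewrite invr_ge0 exprn_ge0.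
have p2 : 0 <= ((x - y)%:R : R) ^- 2 by rewrite invr_ge0 exprn_ge0.
case: ifPn => [rxy|_]; last by case: ifPn; case: ifPn; rewrite ?addr0 ?add0r// => _ _; exact: addr_ge0.
have key (a b : nat) : (a <= b)%N -> r <= `|(a%:R : R) - b%:R| -> (m + a <= b)%N.
  move=> ab; rewrite distrC -natrB// ger0_norm// => h.
  by rewrite addnC -leq_subRL// -(ler_nat R); exact: le_trans mr h.
move: rxy; rewrite coordB; have [xy|/ltnW yx] := leqP x y => h.
  rewrite key// -[X in X <= _]addr0 lerD//; last by case: ifP.
  by rewrite -sqrrN opprB -natrB.
rewrite addrC (key y x)//; last by rewrite distrC.
rewrite -[X in X <= _]addr0 lerD//; last by case: ifP.
by rewrite -natrB.
Qed.

End LatticeSums.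

(** * Summation by parts and pairwise estimates *)

Section CutoffEnergy.
Context {R : realFieldType} {T : finType}.
Implicit Types (B : T -> T -> R) (f g : T -> R) (D : pred T).

(** Summation by parts: the double sum is averaged with its image under the exchange of x and y. *)
Lemma sum_antisym B D (h : T -> R) (k : T -> R) :
    (forall x y, D x -> D y -> B x y = B y x) ->
  \sum_(x | D x) h x * \sum_(y | D y) B x y * (k y - k x) =
  - (2^-1 * \sum_(x | D x) \sum_(y | D y) B x y * ((h x - h y) * (k x - k y))).
Proof.
move=> sB; pose S := \sum_(x | D x) \sum_(y | D y) B x y * (h x * (k y - k x)).
have -> : \sum_(x | D x) h x * \sum_(y | D y) B x y * (k y - k x) = S.
  by apply: eq_bigr => x _; rewrite big_distrr/=; apply: eq_bigr => y _; rewrite mulrCA.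
have S2 : S = \sum_(x | D x) \sum_(y | D y) B x y * (h y * (k x - k y)).
  rewrite /S exchange_big/=; apply: eq_bigr => x Dx; apply: eq_bigr => y Dy.
  by rewrite sB.
have : S + S = - \sum_(x | D x) \sum_(y | D y) B x y * ((h x - h y) * (k x - k y)).
  rewrite {2}S2 /S -big_split -sumrN/=; apply: eq_bigr => x _.
  by rewrite -big_split -sumrN/=; apply: eq_bigr => y _; ring.
lra.
Qed.

(** After symmetrisation [cutoff_form_ge] applies to each pair. The dissipation is given up here:
    the part that yields decay is taken out of B beforehand. *)
Lemma cutoff_energy_le n B D f g : odd n ->
    (forall x y, D x -> D y -> B x y = B y x) ->
    (forall x y, D x -> D y -> 0 <= B x y) ->
  n.+1%:R * \sum_(x | D x) (g x ^+ 2 * f x ^+ n) *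
      (\sum_(y | D y) B x y * (f y - f x)) <=
  2 * \sum_(x | D x) f x ^+ n.+1 * \sum_(y | D y) B x y * (g x - g y) ^+ 2.
Proof.
move=> on sB B0; rewrite sum_antisym//.
pose S := \sum_(x | D x) \sum_(y | D y) B x y * ((g x - g y) ^+ 2 * f x ^+ n.+1).
have -> : \sum_(x | D x) f x ^+ n.+1 * \sum_(y | D y) B x y * (g x - g y) ^+ 2 = S.
  by apply: eq_bigr => x _; rewrite big_distrr/=; apply: eq_bigr => y _; ring.
have S2 : S = \sum_(x | D x) \sum_(y | D y) B x y * ((g x - g y) ^+ 2 * f y ^+ n.+1).
  rewrite /S exchange_big/=; apply: eq_bigr => x Dx; apply: eq_bigr => y Dy.
  by rewrite sB// -[(g y - g x) ^+ 2]sqrrN opprB.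
have -> : 2 * S = 2^-1 * (2 * (S + S)) by lra.
rewrite {2}S2 /S mulrN mulrCA -mulrN ler_pM2l ?invr_gt0// -big_split/= lerNl.
rewrite !big_distrr -sumrN/=; apply: ler_sum => x Dx.
rewrite -big_split !big_distrr -sumrN/=; apply: ler_sum => y Dy.
have := ler_wpM2l (B0 x y Dx Dy) (@cutoff_form_ge R n (f x) (f y) (g x) (g y) on).
set u := B x y; set P := n.+1%:R.
move: (f x ^+ n.+1) (f y ^+ n.+1) (f x ^+ n) (f y ^+ n) => a b a' b'.
by move=> h; apply: le_trans (le_trans _ h) _; rewrite le_eqVlt; apply/orP; left; apply/eqP; ring.
Qed.

(** The far value b is split at the height w. The part up to w is paid by the tangent inequality and
    costs w^(n+1) without the factor n + 1; the excess over w is left to the tail bound. *)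
Lemma far_pair_le n (a b w : R) : odd n -> 0 <= w ->
  n.+1%:R * a ^+ n * (b - a) <=
    w ^+ n.+1 + n.+1%:R * `|a| ^+ n * Num.max (`|b| - w) 0.
Proof.
move=> on w0.
have h1 : a ^+ n * a = `|a| ^+ n * `|a|.
  by rewrite -!exprSr -normrX ger0_norm// exprn_even_ge0//= on.
have h2 : a ^+ n * b <= `|a| ^+ n * `|b|.
  by rewrite -normrX -normrM ler_norm.
have h3 := exprn_tangent n (normr_ge0 a) w0.
have h4 : 0 <= `|a| ^+ n.+1 by exact: exprn_ge0.
have h5 : `|a| ^+ n * (`|b| - w) <= `|a| ^+ n * Num.max (`|b| - w) 0.
  by apply: ler_wpM2l; rewrite ?exprn_ge0// le_max lexx.
have h6 : a ^+ n * (b - a) <= `|a| ^+ n * (w - `|a|) + `|a| ^+ n * Num.max (`|b| - w) 0.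
  by move: h1 h2 h5; rewrite !mulrBr; lra.
have := ler_wpM2l (ler0n R n.+1) h6.
by move: h3 h4; rewrite mulrDr !mulrA; lra.
Qed.

End CutoffEnergy.

(** * Instantaneous growth of a localised moment *)

Section BallGrowth.
Context {R : realType} {K : nat}.
Implicit Types (B : site K -> site K -> R) (W f g v : site K -> R).

Definition ball (c r : R) : pred (site K) := [pred x | `|coord x - c| <= r].

Lemma ball_card_le (c r : R) : 0 <= r -> \sum_(x | ball c r x) (1 : R) <= 2 * r + 1.
Proof.
move=> r0; rewrite sumr_const.
have -> : #|[pred x | ball c r x]| = #|[pred x : site K | c - r <= coord x <= c + r]|.
  by apply: eq_card => x; rewrite !inE /ball/= ler_distl.
have cr : c - r <= c + r by lra.
by apply: le_trans (card_coord_le K cr) _; lra.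
Qed.

Lemma ball_card_ge (c r : R) : 0 <= r -> - K%:R <= c - r -> c + r <= K%:R ->
  2 * r - 1 <= \sum_(x | ball c r x) (1 : R).
Proof.
move=> r0 h1 h2; rewrite sumr_const.
have -> : #|[pred x | ball c r x]| = #|[pred x : site K | c - r <= coord x <= c + r]|.
  by apply: eq_card => x; rewrite !inE /ball/= ler_distl.
have cr : c - r <= c + r by lra.
by apply: le_trans (card_coord_ge h1 cr h2); lra.
Qed.

Lemma tail_le B (C L r : R) x (P : pred (site K)) : 1 <= r -> L <= r -> 0 <= C ->
    (forall y, L <= `|coord x - coord y| -> B x y <= C / `|coord x - coord y| ^+ 2) ->
    (forall y, P y -> r <= `|coord x - coord y|) ->
  \sum_(y | P y) B x y <= 8 * C / r.
Proof.
move=> r1 Lr C0 up Pr.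
apply: (@le_trans _ _ (\sum_(y : site K | r <= `|coord x - coord y|)
    C * (coord x - coord y) ^- 2)).
  rewrite big_mkcond [X in _ <= X]big_mkcond/=; apply: ler_sum => y _.
  case: ifPn => [/Pr h|_].
    by rewrite h; apply: le_trans (up _ (le_trans Lr h)) _; rewrite real_normK ?num_real.
  by case: ifP => // _; rewrite mulr_ge0// invr_ge0 sqr_ge0.
rewrite -big_distrr/=; apply: le_trans (ler_wpM2l C0 (sum_inv_sq_le x r1)) _.
by rewrite mulrCA mulrA.
Qed.

(** Beyond L the decay C / d^2 of B cancels the d^2 of the Lipschitz bound, so each site costs C
    k^2. Within L no pointwise upper bound is at hand, and the sum of B is kept, to be controlled in
    time average. *)
Lemma local_cutoff_le B g (C L r k : R) x (P : pred (site K)) :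
    0 <= C -> 0 <= L -> 0 <= k ->
    (forall y, 0 <= B x y) ->
    (forall y, L <= `|coord x - coord y| -> B x y <= C / `|coord x - coord y| ^+ 2) ->
    (forall y, `|g x - g y| <= k * `|coord x - coord y|) ->
    \sum_(y | P y) 1 <= 3 * r ->
  \sum_(y | P y && (y != x)) B x y * (g x - g y) ^+ 2 <=
    3 * C * k ^+ 2 * r + k ^+ 2 * L ^+ 2 * \sum_(y | P y && (y != x)) B x y.
Proof.
move=> C0 L0 k0 B0 up lip cP.
have -> : 3 * C * k ^+ 2 * r = C * k ^+ 2 * (3 * r) by ring.
apply: le_trans (_ : \sum_(y | P y && (y != x)) (C * k ^+ 2 + k ^+ 2 * L ^+ 2 * B x y) <= _).
  apply: ler_sum => y /andP[Py yx].
  have d1 : (1 : R) <= `|coord x - coord y| by apply: sdist_ge1; rewrite eq_sym.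
  have gd : (g x - g y) ^+ 2 <= k ^+ 2 * `|coord x - coord y| ^+ 2.
    rewrite -real_normK ?num_real// -exprMn lerXn2r// ?nnegrE ?mulr_ge0//.
  have k20 : 0 <= k ^+ 2 by exact: sqr_ge0.
  have [Ld|/ltW dL] := leP L `|coord x - coord y|.
    apply: ler_wpDr; first by rewrite !mulr_ge0 ?sqr_ge0.
    apply: le_trans (ler_pM (B0 y) (sqr_ge0 _) (up y Ld) gd) _.
    rewrite le_eqVlt; apply/orP; left; apply/eqP; field.
    by rewrite gt_eqF// (lt_le_trans _ d1).
  apply: ler_wpDl; first by rewrite mulr_ge0.
  rewrite mulrC; apply: ler_wpM2r => //; apply: le_trans gd _.
  by apply: ler_wpM2l => //; rewrite lerXn2r// nnegrE.
rewrite big_split/= -[X in _ + X <= _]big_distrr/= lerD2r.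
have -> : \sum_(i | P i && (i != x)) C * k ^+ 2 = C * k ^+ 2 * \sum_(i | P i && (i != x)) 1.
  by rewrite big_distrr/=; apply: eq_bigr => *; rewrite mulr1.
apply: ler_wpM2l; first by rewrite mulr_ge0// sqr_ge0.
apply: le_trans cP; rewrite big_mkcond [X in _ <= X]big_mkcond; apply: ler_sum => y _.
by case: (P y) => //=; case: ifP.
Qed.

(** With f = v - a and N sites in the ball, the rate omega taken out of every pair contributes omega
    (sum f - N f x) at x; the motion of the level cancels sum f, and the rest is decay. What remains
    of B in the ball is charged to the cutoff, the exterior to the tail, the killing to [w0]. The
    384 is 2 times 3 times 8^2, with 8 / r the slope of the cutoff, and the 48 is 16 times 3. *)
Lemma ball_growth n (B : site K -> site K -> R) (W v g : site K -> R)
    (c a C L r w omega w0 Q1 T0 : R) :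
    odd n -> 1 <= r / 2 -> 0 <= L -> L <= r / 2 -> 0 <= C -> 0 < w -> 0 <= omega -> 0 <= T0 ->
    0 <= w0 ->
    (forall x y, B x y = B y x) -> (forall x y, 0 <= B x y) ->
    (forall x y, L <= `|coord x - coord y| -> B x y <= C / `|coord x - coord y| ^+ 2) ->
    (forall x y, ball c r x -> ball c r y -> x != y -> omega <= B x y) ->
    (forall x, 0 <= W x) -> (forall x, ball c r x -> W x <= w0) ->
    (forall x, `|v x| <= 1) -> `|a| <= 1 ->
    (forall x, 0 <= g x <= 1) -> (forall x, ~~ ball c (r / 2) x -> g x = 0) ->
    (forall x y, `|g x - g y| <= 8 / r * `|coord x - coord y|) ->
    \sum_(x | ball c r x) (v x - a) ^+ n.+1 <= Q1 * (r * w ^+ n.+1) ->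
    (forall x, ball c (r / 2) x ->
      \sum_(y | ~~ ball c r y) B x y * Num.max (`|v y - a| - w) 0 <= T0 * (w / r)) ->
  n.+1%:R * \sum_x g x ^+ 2 * (v x - a) ^+ n *
      (\sum_y B x y * (v y - v x) - W x * v x -
       omega * \sum_(y | ball c r y) (v y - a)) <=
  - (n.+1%:R * omega * \sum_(x | ball c r x) 1) * \sum_x g x ^+ 2 * (v x - a) ^+ n.+1
  + (384 * C * Q1 + 48 * C + n.+1%:R * T0 * (Q1 + 3)) * w ^+ n.+1
  + 128 * 2 ^+ n.+1 * L ^+ 2 / r ^+ 2 *
      \sum_(x | ball c r x) \sum_(y | ball c r y && (y != x)) B x y
  + 3 * r * n.+1%:R * 2 ^+ n * w0.
Proof.
move=> on r2 L0 Lr C0 w_gt0 om0 T00 w00 sB B0 up low W0 Ww v1 a1 g01 g0 lip HS HT.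
have r0 : 0 < r by lra.
have rn0 : r != 0 by rewrite gt_eqF.
have wge : 0 <= w by exact: ltW.
have wn0 : 0 <= w ^+ n.+1 by exact: exprn_ge0.
have r0' := ltW r0.
pose D : pred (site K) := ball c r.
pose f x := v x - a.
pose p : R := n.+1%:R.
have p0 : 0 <= p by exact: ler0n.
have en : ~~ odd n.+1 by rewrite /= on.
have fp0 x : 0 <= f x ^+ n.+1 by rewrite exprn_even_ge0.
have fabs x : `|f x| ^+ n.+1 = f x ^+ n.+1 by rewrite -normrX ger0_norm.
have f2 x : `|f x| <= 2.
  by apply: le_trans (ler_normB _ _) _; have := v1 x; lra.
have fn2 x : `|f x| ^+ n <= 2 ^+ n by rewrite lerXn2r ?nnegrE.
have fp2 x : f x ^+ n.+1 <= 2 ^+ n.+1 by rewrite -fabs lerXn2r ?nnegrE.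
have gsq x : 0 <= g x ^+ 2 <= 1.
  by rewrite sqr_ge0/=; have /andP[? ?] := g01 x; rewrite expr_le1.
have halfD x : ball c (r / 2) x -> D x.
  by rewrite /D /ball/= => h; apply: le_trans h _; lra.
have gD x : ~~ D x -> g x = 0.
  by move=> Dx; apply: g0; apply: contra Dx; exact: halfD.
have cD : \sum_(x | D x) (1 : R) <= 3 * r.
  by apply: le_trans (ball_card_le c (ltW r0)) _; lra.
have toD (F : site K -> R) : \sum_x g x ^+ 2 * F x = \sum_(x | D x) g x ^+ 2 * F x.
  rewrite [RHS]big_mkcond/=; apply: eq_bigr => x _.
  by case: ifPn => // /gD ->; rewrite expr0n mul0r.
(* The diagonal is set to 0 because [omega] is a lower bound off the diagonal; B x x multiplies f x
   - f x = 0. *)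
pose B' x y := if x == y then 0 else B x y - omega.
have sB' x y : D x -> D y -> B' x y = B' y x by rewrite /B' eq_sym sB.
have B'0 x y : D x -> D y -> 0 <= B' x y.
  by move=> Dx Dy; rewrite /B'; case: ifPn => // xy; rewrite subr_ge0 low.
have B'B x y : B' x y <= B x y by rewrite /B'; case: ifP => // _; rewrite gerBl.
have Bsplit x : D x -> \sum_y B x y * (v y - v x) =
    \sum_(y | D y) B' x y * (f y - f x) +
    omega * \sum_(y | D y) (f y - f x) +
    \sum_(y | ~~ D y) B x y * (f y - f x).
  move=> Dx; rewrite (bigID D)/=; congr (_ + _); last first.
    by apply: eq_bigr => y _; rewrite /f; ring.
  rewrite big_distrr -big_split/=; apply: eq_bigr => y _.
  rewrite /B' /f; case: eqP => [->|_]; ring.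
have sumf x : \sum_(y | D y) (f y - f x) =
    \sum_(y | D y) f y - f x * \sum_(y | D y) 1.
  rewrite big_split/= sumrN; congr (_ - _).
  by rewrite big_distrr/=; apply: eq_bigr => y _; rewrite mulr1.
have eqx x : D x -> g x ^+ 2 * f x ^+ n * (\sum_y B x y * (v y - v x) - W x * v x -
       omega * \sum_(y | D y) f y) =
    g x ^+ 2 * f x ^+ n * \sum_(y | D y) B' x y * (f y - f x)
    - omega * (\sum_(y | D y) 1) * (g x ^+ 2 * f x ^+ n.+1)
    + g x ^+ 2 * \sum_(y | ~~ D y) f x ^+ n * (B x y * (f y - f x))
    - g x ^+ 2 * f x ^+ n * (W x * v x).
  move=> Dx; rewrite Bsplit// sumf [f x ^+ n.+1]exprSr.
  have -> : \sum_(y | ~~ D y) f x ^+ n * (B x y * (f y - f x)) =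
    f x ^+ n * \sum_(y | ~~ D y) B x y * (f y - f x) by rewrite big_distrr.
  by ring.
(* The cutoff vanishes beyond r / 2, so exterior sites are at distance at least r / 2 and their
   total rate is at most 16 C / r. *)
have far x : D x -> p * (g x ^+ 2 * \sum_(y | ~~ D y) f x ^+ n * (B x y * (f y - f x))) <=
    16 * C / r * w ^+ n.+1 + p * T0 / r * (f x ^+ n.+1 + w ^+ n.+1).
  move=> Dx; have rhs0 : 0 <= 16 * C / r * w ^+ n.+1 + p * T0 / r * (f x ^+ n.+1 + w ^+ n.+1).
    apply: addr_ge0; first by apply: mulr_ge0 => //; apply: divr_ge0; [exact: mulr_ge0|exact: ltW].
    by apply: mulr_ge0; [apply: divr_ge0; [exact: mulr_ge0|exact: ltW]|exact: addr_ge0].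
  have [hx|/g0 ->] := boolP (ball c (r / 2) x); last by rewrite expr0n mul0r mulr0.
  rewrite mulrCA.
  have /andP[gx0 gx1] := gsq x.
  suff H : p * (\sum_(y | ~~ D y) f x ^+ n * (B x y * (f y - f x))) <=
    16 * C / r * w ^+ n.+1 + p * T0 / r * (f x ^+ n.+1 + w ^+ n.+1).
    by apply: le_trans (ler_wpM2l gx0 H) _; rewrite ler_piMl.
  have step1 : p * (\sum_(y | ~~ D y) f x ^+ n * (B x y * (f y - f x))) <=
      \sum_(y | ~~ D y) (w ^+ n.+1 * B x y +
         p * `|f x| ^+ n * (B x y * Num.max (`|f y| - w) 0)).
    rewrite big_distrr/=; apply: ler_sum => y _.
    have := ler_wpM2l (B0 x y) (far_pair_le (f x) (f y) on wge).
    rewrite mulrDr -/p => h; apply: le_trans (le_trans _ h) _;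
    rewrite le_eqVlt; apply/orP; left; apply/eqP; ring.
  apply: le_trans step1 _; rewrite big_split/= -!big_distrr/=; apply: lerD.
    rewrite mulrC; apply: ler_wpM2r; first exact: exprn_ge0.
    have -> : 16 * C / r = 8 * C / (r / 2) by field.
    apply: (@tail_le B C L (r / 2) x) => //; first exact: up.
    move=> y; rewrite /D /ball/= -ltNge => h.
    have := ler_distD (coord x) (coord y) c; move: hx; rewrite /ball/= => h1.
    by rewrite [`|coord y - coord x|]distrC => h2; clear -h h1 h2; lra.
  apply: le_trans (_ : p * `|f x| ^+ n * (T0 * (w / r)) <= _).
    by apply: ler_wpM2l; [rewrite mulr_ge0// exprn_ge0|exact: HT].
  have -> : p * `|f x| ^+ n * (T0 * (w / r)) = p * T0 / r * (`|f x| ^+ n * w) by ring.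
  apply: ler_wpM2l; first by rewrite !mulr_ge0 ?invr_ge0 ?(ltW r0).
  by rewrite -fabs; exact: exprn_mul_le.
have kill x : D x -> - (p * (g x ^+ 2 * f x ^+ n * (W x * v x))) <= p * 2 ^+ n * w0.
  move=> Dx; rewrite -mulrN -[p * _ * w0]mulrA; apply: ler_wpM2l => //.
  have /andP[gx0 gx1] := gsq x.
  apply: le_trans (ler_norm _) _; rewrite normrN normrM (normrM (g x ^+ 2)) (normrM (W x)).
  rewrite (ger0_norm gx0) normrX.
  rewrite -[2 ^+ n * w0]mul1r -mulrA; apply: ler_pM => //.
  apply: ler_pM => //.
  by rewrite ger0_norm// -[w0]mulr1; apply: ler_pM => //; exact: Ww.
have near_ : p * \sum_(x | D x) g x ^+ 2 * f x ^+ n * \sum_(y | D y) B' x y * (f y - f x)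
   <= 384 * C * Q1 * w ^+ n.+1 + 128 * 2 ^+ n.+1 * L ^+ 2 / r ^+ 2 *
      \sum_(x | D x) \sum_(y | D y && (y != x)) B x y.
  apply: le_trans (cutoff_energy_le f g on sB' B'0) _.
  have loc x : D x -> \sum_(y | D y) B' x y * (g x - g y) ^+ 2 <=
      192 * C / r + 64 * L ^+ 2 / r ^+ 2 * \sum_(y | D y && (y != x)) B x y.
    move=> Dx.
    have k0 : 0 <= 8 / r by rewrite divr_ge0// ltW.
    have := local_cutoff_le C0 L0 k0 (B0 x) (up x) (lip x) cD.
    have -> : 3 * C * (8 / r) ^+ 2 * r = 192 * C / r by field.
    have -> : (8 / r) ^+ 2 * L ^+ 2 = 64 * L ^+ 2 / r ^+ 2 by field.
    apply: le_trans; rewrite (bigID (fun y => y == x))/= big1; last first.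
      by move=> y /andP[_ /eqP ->]; rewrite /B' eqxx mul0r.
    by rewrite add0r; apply: ler_sum => y _; apply: ler_wpM2r; rewrite ?sqr_ge0.
  apply: (@le_trans _ _ (2 * \sum_(x | D x) (192 * C / r * f x ^+ n.+1 +
      2 ^+ n.+1 * (64 * L ^+ 2 / r ^+ 2) * \sum_(y | D y && (y != x)) B x y))).
    apply: ler_wpM2l => //; apply: ler_sum => x Dx.
    apply: le_trans (ler_wpM2l (fp0 x) (loc x Dx)) _.
    rewrite mulrDr mulrC lerD2l -[X in _ <= X]mulrA.
    apply: ler_wpM2r => //; apply: mulr_ge0; last exact: sumr_ge0.
    by apply: divr_ge0; [apply: mulr_ge0 => //|]; exact: sqr_ge0.
  rewrite big_split/= -!big_distrr/=.
  apply: le_trans (_ : 2 * (192 * C / r * (Q1 * (r * w ^+ n.+1)) + 2 ^+ n.+1 * (64 * L ^+ 2 / r ^+ 2) * \sum_(x | D x) \sum_(y | D y && (y != x)) B x y) <= _).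
    apply: ler_wpM2l => //; rewrite lerD2r; apply: ler_wpM2l => //.
    by rewrite divr_ge0 ?mulr_ge0// ltW.
  by rewrite le_eqVlt; apply/orP; left; apply/eqP; field.
have -> : \sum_x g x ^+ 2 * (v x - a) ^+ n *
      (\sum_y B x y * (v y - v x) - W x * v x - omega * \sum_(y | D y) (v y - a)) =
    \sum_(x | D x) (g x ^+ 2 * f x ^+ n * \sum_(y | D y) B' x y * (f y - f x)
    - omega * (\sum_(y | D y) 1) * (g x ^+ 2 * f x ^+ n.+1)
    + g x ^+ 2 * \sum_(y | ~~ D y) f x ^+ n * (B x y * (f y - f x))
    - g x ^+ 2 * f x ^+ n * (W x * v x)).
  under eq_bigr => x _ do rewrite -mulrA.
  by rewrite toD; apply: eq_bigr => x Dx; rewrite mulrA eqx.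
rewrite (toD (fun x => (v x - a) ^+ n.+1)) -/D.
rewrite big_split big_split big_split/= !sumrN.
set S1 := \sum_(x | D x) g x ^+ 2 * f x ^+ n * _ in near_ *.
set S2 := \sum_(x | D x) omega * _ * _.
set S3 := \sum_(x | D x) g x ^+ 2 * \sum_(y | ~~ D y) _.
set S4 := \sum_(x | D x) g x ^+ 2 * f x ^+ n * (W x * v x).
have E2 : S2 = omega * (\sum_(y | D y) 1) * \sum_(x | D x) g x ^+ 2 * (v x - a) ^+ n.+1.
  by rewrite big_distrr.
have E3 : p * S3 <= (48 * C + p * T0 * (Q1 + 3)) * w ^+ n.+1.
  apply: (@le_trans _ _ (\sum_(x | D x) ((16 * C / r * w ^+ n.+1 + p * T0 / r * w ^+ n.+1) * 1
     + p * T0 / r * f x ^+ n.+1))).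
    rewrite big_distrr; apply: ler_sum => x Dx /=; apply: le_trans (far x Dx) _.
    by rewrite le_eqVlt; apply/orP; left; apply/eqP; ring.
  rewrite big_split/= -!big_distrr/=.
  have c1 : 0 <= 16 * C / r * w ^+ n.+1 + p * T0 / r * w ^+ n.+1.
    by apply: addr_ge0; apply: mulr_ge0 => //; apply: divr_ge0 => //; exact: mulr_ge0.
  have c2 : 0 <= p * T0 / r by apply: divr_ge0 => //; exact: mulr_ge0.
  apply: le_trans (lerD (ler_wpM2l c1 cD) (ler_wpM2l c2 HS)) _.
  by rewrite le_eqVlt; apply/orP; left; apply/eqP; field.
have E4 : - (p * S4) <= 3 * r * p * 2 ^+ n * w0.
  rewrite big_distrr -sumrN/=.
  apply: (@le_trans _ _ (\sum_(x | D x) p * 2 ^+ n * w0 * 1)).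
    by apply: ler_sum => x Dx; rewrite mulr1; exact: kill.
  rewrite -big_distrr/=.
  have -> : 3 * r * p * 2 ^+ n * w0 = p * 2 ^+ n * w0 * (3 * r) by ring.
  by apply: ler_wpM2l => //; rewrite !mulr_ge0// exprn_ge0.
rewrite mulrDr mulrDr mulrBr mulrN E2.
move: near_ E3 E4; clear.
rewrite -/p; move: (\sum_(x | D x) \sum_(y | D y && (y != x)) B x y) => S.
set Y := \sum_(x | D x) g x ^+ 2 * _; set N := \sum_(y | D y) 1.
move=> h1 h3 h4.
have -> : p * (omega * N * Y) = p * omega * N * Y by ring.
have e1 : (384 * C * Q1 + 48 * C + p * T0 * (Q1 + 3)) * w ^+ n.+1 =
  384 * C * Q1 * w ^+ n.+1 + (48 * C + p * T0 * (Q1 + 3)) * w ^+ n.+1 by ring.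
rewrite e1 mulNr; move: h1 h3 h4.
move: (p * S1) (p * S3) (p * S4) (p * omega * N * Y) (384 * C * Q1 * w ^+ n.+1) (_ * w ^+ n.+1) (_ * S) (_ * w0).
move=> *; lra.
Qed.

End BallGrowth.

(** * Continuity and derivatives of finite sums and powers *)

Section PointwiseCalculus.
Context {R : realType}.

Lemma continuous_sum_at (I : Type) (r : seq I) (h : I -> R -> R) (t : R) :
  (forall i, {for t, continuous (h i)}) ->
  {for t, continuous (fun t => \sum_(i <- r) h i t)}.
Proof.
move=> ch; elim: r => [|i r IH].
  by rewrite (_ : (fun t => _) = cst 0); [exact: cvg_cst|apply/funext => u; rewrite big_nil].
rewrite (_ : (fun t => _) = h i \+ (fun t => \sum_(i <- r) h i t)); last first.
  by apply/funext => u; rewrite big_cons.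
by apply: continuousD.
Qed.

Lemma continuous_exprn_at (h : R -> R) n (t : R) :
  {for t, continuous h} -> {for t, continuous (fun t => h t ^+ n)}.
Proof.
move=> ch; elim: n => [|n IH].
  by rewrite (_ : (fun t => _) = cst 1); [exact: cvg_cst|apply/funext => u; rewrite expr0].
rewrite (_ : (fun t => _) = h \* (fun t => h t ^+ n)); last first.
  by apply/funext => u; rewrite exprS.
by apply: continuousM.
Qed.

Lemma is_derive_sum_at n (h : 'I_n -> R -> R) (dh : 'I_n -> R) (t : R) :
  (forall i, is_derive t 1 (h i) (dh i)) ->
  is_derive t 1 (fun t => \sum_i h i t) (\sum_i dh i).
Proof.
move=> dhE; have := is_derive_sum dhE.
by rewrite (_ : \sum_(i < n) h i = fun t => \sum_i h i t)//; apply/funext => u; rewrite fct_sumE.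
Qed.

Lemma is_derive_exprn_at (h : R -> R) n (dh t : R) :
  is_derive t 1 h dh -> is_derive t 1 (fun t => h t ^+ n.+1) (n.+1%:R * h t ^+ n * dh).
Proof.
move=> d; have := is_deriveX n.+1 d.
by rewrite (_ : h ^+ n.+1 = fun t => h t ^+ n.+1)//; apply/funext => u; rewrite exprfctE.
Qed.

End PointwiseCalculus.

(** * The normalised real system and its moments on windows *)

Section Flow.
Context {R : realType} {K : nat}.
Local Notation mu := (@lebesgue_measure R).
Local Notation coord := (@coord R K).
Implicit Types (B : site K -> site K -> R -> R) (W : site K -> R -> R) (v : R -> site K -> R).

Definition ball_energy B (c r t : R) : R :=
  \sum_(x | ball c r x) \sum_(y | ball c r y && (y != x)) B x y t.

(** The situation after passing to a real part and normalising. The powers of K are hidden in [L],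
    [l0], [w0] and [H]. Continuity and the bound are asked at all times because v will be frozen
    outside [-s, 0]. The lower bound is stated with a radius [rr] instead of the distance, so that
    close pairs, for which B obeys a weaker bound, are covered too. *)
Record flow (s C L l0 w0 H Z : R) B W v : Prop := Flow {
  flow_cont : forall x t, {for t, continuous (fun t => v t x)};
  flow_derive : forall x t, - s < t < 0 -> is_derive t 1 (fun t => v t x)
    (\sum_y B x y t * (v t y - v t x) - W x t * v t x);
  flow_bound : forall x t, `|v t x| <= 1;
  flow_meas : forall x y, measurable_fun `[- s, 0] (B x y);
  flow_sym : forall x y t, - s <= t <= 0 -> B x y t = B y x t;
  flow_ge0 : forall x y t, - s <= t <= 0 -> 0 <= B x y t;
  flow_up : forall x y t, - s <= t <= 0 -> L <= `|coord x - coord y| ->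
    B x y t <= C / `|coord x - coord y| ^+ 2;
  flow_low : forall x y t rr, - s <= t <= 0 -> l0 <= rr -> x != y ->
    `|coord x| <= 3 / 4 * K%:R -> `|coord y| <= 3 / 4 * K%:R ->
    `|coord x - coord y| <= rr -> 1 / (C * rr ^+ 2) <= B x y t;
  flow_W0 : forall x t, - s <= t <= 0 -> 0 <= W x t;
  flow_W : forall x t, - s <= t <= 0 -> `|coord x| <= 3 / 4 * K%:R -> W x t <= w0;
  flow_budget : forall rr t, 1 <= rr -> rr <= K%:R / 2 -> - s <= t <= 0 ->
    (\int[mu]_(u in `[t, 0%R]) (ball_energy B Z rr u)%:E <= (H * rr * (1 - t))%:E)%E
}.

Lemma ball_energy_ge0 B (s c r t : R) : (forall x y t, - s <= t <= 0 -> 0 <= B x y t) ->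
  - s <= t <= 0 -> 0 <= ball_energy B c r t.
Proof. by move=> B0 ts; apply: sumr_ge0 => x _; apply: sumr_ge0 => y _; exact: B0. Qed.

Lemma ball_energy_meas B (s c r : R) : (forall x y, measurable_fun `[- s, 0] (B x y)) ->
  measurable_fun `[- s, 0] (ball_energy B c r).
Proof.
move=> mB; rewrite (_ : ball_energy B c r = fun t => \sum_x
    if ball c r x then \sum_y (if ball c r y && (y != x) then B x y t else 0) else 0).
  apply: measurable_sum => x; case: (ball c r x); last exact: measurable_cst.
  by apply: measurable_sum => y; case: (_ && _); [exact: mB|exact: measurable_cst].
apply/funext => t; rewrite /ball_energy big_mkcond; apply: eq_bigr => x _.
by case: ifP => // _; rewrite big_mkcond.
Qed.

Lemma ball_energy_sub B (s c r c' r' t : R) :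
    (forall x y t, - s <= t <= 0 -> 0 <= B x y t) -> - s <= t <= 0 ->
    `|c - c'| + r <= r' -> ball_energy B c r t <= ball_energy B c' r' t.
Proof.
move=> B0 ts h.
have sub x : ball c r x -> ball c' r' x.
  rewrite /ball/= => hx; apply: le_trans (ler_distD c _ _) _.
  by move: hx h; lra.
rewrite /ball_energy [X in X <= _]big_mkcond [X in _ <= X]big_mkcond.
apply: ler_sum => x _; case: ifPn => [/sub ->|_]; last first.
  by case: ifP => // _; apply: sumr_ge0 => y _; exact: B0.
rewrite [X in X <= _]big_mkcond [X in _ <= X]big_mkcond/=.
apply: ler_sum => y _; case: ifPn => [/andP[/sub -> ->]//|_].
by case: ifP => // _; exact: B0.
Qed.

Lemma integral_affine_le (S : R -> R) (a b k1 k2 M : R) : a <= b -> 0 <= k1 -> 0 <= k2 ->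
    measurable_fun `[a, b] S -> (forall t, a <= t <= b -> 0 <= S t) ->
    (\int[mu]_(t in `[a, b]) (S t)%:E <= M%:E)%E ->
  (\int[mu]_(t in `[a, b]) (k1 + k2 * S t)%:E <= (k1 * (b - a) + k2 * M)%:E)%E.
Proof.
move=> ab k10 k20 mS S0 SM.
have S0' t : `[a, b]%classic t -> (0 <= (S t)%:E)%E.
  by move=> /=; rewrite in_itv/= lee_fin => /S0.
under eq_integral => t _ do rewrite EFinD EFinM.
have mab : measurable (`[a, b]%classic : set R) by exact: measurable_itv.
have mS' : measurable_fun `[a, b] (EFin \o S) by exact/measurable_EFinP.
rewrite ge0_integralD//; last 2 first.
- by move=> t tab; rewrite mule_ge0//; exact: S0'.
- by apply: measurable_funeM.
rewrite ge0_integralZl_EFin// integral_cst//= EFinD.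
apply: leeD; last by rewrite EFinM; apply: lee_wpmul2l.
rewrite lebesgue_measure_itv/= lte_fin; case: ifPn => _; first by rewrite -EFinD -EFinM.
by rewrite mule0 lee_fin mulr_ge0// subr_ge0.
Qed.

(** It is 1 up to r / 8 and 0 beyond r / 4. When the centre has moved by r / 4 the support is still
    within r / 2 of the old centre, hence far from the exterior, and the plateau contains the next
    window, of radius r / 16. *)
Definition cutoff (c r : R) (x : site K) : R :=
  Num.max 0 (Num.min 1 (2 - 8 / r * `|coord x - c|)).

Lemma cutoff_itv c r x : 0 <= cutoff c r x <= 1.
Proof.
by rewrite /cutoff le_max lexx/= ge_max ler01 ge_min lexx.
Qed.

Lemma cutoff1 c r x : 0 < r -> ball c (r / 8) x -> cutoff c r x = 1.
Proof.
move=> r0; rewrite /ball/= => h; rewrite /cutoff.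
have : 8 / r * `|coord x - c| <= 1.
  by rewrite mulrAC ler_pdivrMr//; lra.
move=> h1; rewrite min_l; last by lra.
by rewrite max_r.
Qed.

Lemma cutoff0 c r x : 0 < r -> ~~ ball c (r / 4) x -> cutoff c r x = 0.
Proof.
move=> r0; rewrite /ball/= -ltNge => h; rewrite /cutoff.
have : 2 <= 8 / r * `|coord x - c|.
  by rewrite mulrAC ler_pdivlMr//; lra.
move=> h1; rewrite min_r; last by lra.
by rewrite max_l; lra.
Qed.

Lemma cutoff_lip c r x y : 0 < r ->
  `|cutoff c r x - cutoff c r y| <= 8 / r * `|coord x - coord y|.
Proof.
move=> r0.
have clamp (s t : R) : `|Num.max 0 (Num.min 1 s) - Num.max 0 (Num.min 1 t)| <= `|s - t|.
  wlog st : s t / s <= t.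
    by move=> W; have [|/ltW] := leP s t => /W //; rewrite distrC [`|t - s|]distrC.
  rewrite (@ler0_norm _ (s - t)); last by lra.
  have cl (u : R) : [\/ u <= 0 /\ Num.max 0 (Num.min 1 u) = 0,
      0 <= u <= 1 /\ Num.max 0 (Num.min 1 u) = u |
      1 <= u /\ Num.max 0 (Num.min 1 u) = 1].
    have /orP[u0|u0] := le_total u 0.
      by constructor 1; split=> //; rewrite max_l// ge_min u0 orbT.
    have /orP[u1|u1] := le_total u 1.
      by constructor 2; split; [rewrite u0|rewrite min_r// max_r].
    by constructor 3; split; [|rewrite min_l ?max_r].
  rewrite ler_norml.
  case: (cl s) => -[hs ->]; case: (cl t) => -[ht ->]; clear -hs ht st; apply/andP; split; lra.
rewrite /cutoff; apply: le_trans (clamp _ _) _.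
have -> : 2 - 8 / r * `|coord x - c| - (2 - 8 / r * `|coord y - c|) =
  8 / r * (`|coord y - c| - `|coord x - c|) by ring.
have k0 : 0 <= 8 / r by rewrite divr_ge0// ltW.
rewrite normrM ger0_norm//; apply: ler_wpM2l => //.
have -> : coord x - coord y = (coord x - c) - (coord y - c) by ring.
by rewrite [X in _ <= X]distrC; exact: ler_dist_dist.
Qed.


Definition moment n (c r b : R) (u : site K -> R) : R :=
  \sum_x cutoff c r x ^+ 2 * (u x - b) ^+ n.+1.

(** The growth rate of the moment in units of w^(n+1): the coefficient in [ball_growth] for T0 = Ups
    + 16 C e. [Q1] is the moment about the moved level, and 16 C e is the price in the tail of
    moving the level by e w. *)
Definition growth_const n (C Ups e : R) : R :=
  let Q1 := 3 * (1 + e) ^+ n.+1 in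
  384 * C * Q1 + 48 * C + n.+1%:R * (Ups + 16 * C * e) * (Q1 + 3).

Lemma growth_const_ge0 n (C Ups e : R) : 0 <= C -> 0 <= Ups -> 0 <= e ->
  0 <= growth_const n C Ups e.
Proof.
move=> C0 U0 e0; rewrite /growth_const /=.
have Q0 : 0 <= 3 * (1 + e) ^+ n.+1 by rewrite mulr_ge0// exprn_ge0// addr_ge0.
move: (ler0n R 384) (ler0n R 48) (ler0n R 16).
move: (384%:R : R) (48%:R : R) (16%:R : R) => k1 k2 k3 k10 k20 k30.
apply: addr_ge0; first by apply: addr_ge0; [apply: mulr_ge0 => //; exact: mulr_ge0|exact: mulr_ge0].
apply: mulr_ge0; last exact: addr_ge0.
by apply: mulr_ge0 => //; apply: addr_ge0 => //; apply: mulr_ge0 => //; exact: mulr_ge0.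
Qed.

Lemma le_max_shift (b w d : R) : 0 <= d ->
  Num.max (b + d - w) 0 <= Num.max (b - w) 0 + d.
Proof.
move=> d0; rewrite ge_max; apply/andP; split; last first.
  by rewrite addr_ge0// le_max lexx orbT.
by rewrite addrAC lerD2r le_max lexx.
Qed.

(* The additive constant a moves with speed omega * sum (v - a): this cancels the mean-field part of the extracted rates omega and leaves pure decay. *)
Lemma energy_step (s C L l0 w0 H Z : R) B W v (F : flow s C L l0 w0 H Z B W v)
    n (omega b c c' r w e Ups t0 t1 MS : R) (a : R -> R) :
    odd n -> 1 <= r / 2 -> 0 <= L -> L <= r / 2 -> 0 <= C -> 0 < w -> 0 <= omega ->
    0 <= Ups -> 0 <= w0 -> 0 <= e -> - s <= t0 -> t0 <= t1 -> t1 <= 0 ->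
    `|c'- c| <= r / 4 -> `|c| + r <= 3 / 4 * K%:R ->
    (forall x y t, t0 <= t <= t1 -> ball c r x -> ball c r y -> x != y -> omega <= B x y t) ->
    (forall t, t0 <= t <= t1 -> {for t, continuous a}) ->
    (forall t, t0 < t < t1 -> is_derive t 1 a (omega * \sum_(y | ball c r y) (v t y - a t))) ->
    (forall t, t0 <= t <= t1 -> `|a t| <= 1 /\ `|a t - b| <= e * w) ->
    (forall t, t0 <= t <= t1 ->
      \sum_(x | ball c r x) (v t x - b) ^+ n.+1 <= 3 * r * w ^+ n.+1 /\
      forall x, ball c (r / 2) x ->
      \sum_(y | ~~ ball c r y) B x y t * Num.max (`|v t y - b| - w) 0 <= Ups * (w / r)) ->
    (\int[mu]_(t in `[t0, t1]) (ball_energy B c r t)%:E <= MS%:E)%E ->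
  moment n c' r (a t1) (v t1) <=
    expR (- (n.+1%:R * omega * \sum_(x : site K | ball c r x) 1) * (t1 - t0)) *
      moment n c' r (a t0) (v t0) +
    ((growth_const n C Ups e * w ^+ n.+1
      + 3 * r * n.+1%:R * 2 ^+ n * w0) * (t1 - t0)
    + 128 * 2 ^+ n.+1 * L ^+ 2 / r ^+ 2 * MS).
Proof.
move=> on r2 L0 Lr C0 w_gt0 om0 U0 w00 e0 st0 t01 t10 cc' bulk low ca da Ha Hinv HS.
have r0 : 0 < r by lra.
have en : ~~ odd n.+1 by rewrite /= on.
have wn0 : 0 <= w ^+ n.+1 by exact/exprn_ge0/ltW.
have tin t : t0 <= t <= t1 -> - s <= t <= 0.
  by move=> /andP[h1 h2]; rewrite (le_trans st0 h1) (le_trans h2 t10).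
set p : R := n.+1%:R.
set kap := p * omega * _.
set E := growth_const n C Ups e.
pose Q1 := 3 * (1 + e) ^+ n.+1.
have Q10 : 0 <= Q1 by rewrite /Q1 mulr_ge0// exprn_ge0// addr_ge0.
have p0 : 0 <= p by exact: ler0n.
have E0 : 0 <= E.
  exact: growth_const_ge0.
have cD0 : 0 <= \sum_(x : site K | ball c r x) (1 : R) by apply: sumr_ge0.
pose S t := (E * w ^+ n.+1 + 3 * r * p * 2 ^+ n * w0) +
   128 * 2 ^+ n.+1 * L ^+ 2 / r ^+ 2 * ball_energy B c r t.
have k20 : 0 <= 128 * 2 ^+ n.+1 * L ^+ 2 / r ^+ 2.
  by apply: divr_ge0; [apply: mulr_ge0 => //; exact: sqr_ge0|exact: sqr_ge0].
have k10 : 0 <= E * w ^+ n.+1 + 3 * r * p * 2 ^+ n * w0.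
  apply: addr_ge0; first exact: mulr_ge0.
  by do ?apply: mulr_ge0 => //; rewrite ?exprn_ge0 ?ltW.
have Sge0 t : t0 <= t <= t1 -> 0 <= ball_energy B c r t.
  by move=> /tin; apply: ball_energy_ge0; exact: flow_ge0 F.
have mSb : measurable_fun `[t0, t1] (ball_energy B c r).
  apply: measurable_funS (ball_energy_meas c r (flow_meas F)) => //.
pose Y t := moment n c' r (a t) (v t).
have cY t : t0 <= t <= t1 -> {for t, continuous Y}.
  move=> tt; apply: continuous_sum_at => x; apply: continuousM; first exact: cvg_cst.
  apply: continuous_exprn_at; apply: continuousB; [exact: (flow_cont F)|exact: ca].
apply: (@gronwall_le R Y S) => //.
- by rewrite /kap mulr_ge0// mulr_ge0.
- rewrite /S; apply: measurable_funD => //.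
  by apply: measurable_funM.
- by move=> t tt; rewrite addr_ge0// mulr_ge0// Sge0.
- move=> t tt.
  have tt' : t0 <= t <= t1 by case/andP: tt => h1 h2; rewrite !ltW.
  have ts := tin t tt'.
  have [ats ata0] := Ha t tt'.
  have [H1 H2] := Hinv t tt'.
  have tso : - s < t < 0.
    by case/andP: tt => h1 h2; rewrite (le_lt_trans st0 h1) (lt_le_trans h2 t10).
  pose dv x := \sum_y B x y t * (v t y - v t x) - W x t * v t x -
       omega * \sum_(y | ball c r y) (v t y - a t).
  have dY x : is_derive t 1 (fun t => cutoff c' r x ^+ 2 * (v t x - a t) ^+ n.+1)
      (p * (cutoff c' r x ^+ 2 * (v t x - a t) ^+ n * dv x)).
    have d1 := is_deriveB (flow_derive F x tso) (da t tt).
    have := is_deriveM (is_derive_cst (cutoff c' r x ^+ 2) t 1) (is_derive_exprn_at n d1).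
    rewrite /cst /GRing.scale/= mulr0 addr0 => d2.
    by rewrite [X in is_derive _ _ _ X](_ : _ = cutoff c' r x ^+ 2 * (p * (v t x - a t) ^+ n * dv x))//; ring.
  exists (p * \sum_x cutoff c' r x ^+ 2 * (v t x - a t) ^+ n * dv x).
    rewrite big_distrr; exact: (is_derive_sum_at dY).
  have fin x : ball c r x -> `|coord x| <= 3 / 4 * K%:R.
    rewrite /ball/= => h; apply: le_trans bulk.
    rewrite -[coord x](subrK c) addrC; apply: le_trans (ler_normD _ _) _.
    by rewrite lerD2l.
  have Hf0 x : `|v t x - a t| <= `|v t x - b| + e * w.
    have -> : v t x - a t = (v t x - b) - (a t - b) by ring.
    by apply: le_trans (ler_normB _ _) _; rewrite lerD2l.
  have ew0 : 0 <= e * w by rewrite mulr_ge0// ltW.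
  have cD3 : \sum_(x : site K | ball c r x) (1 : R) <= 3 * r.
    by apply: le_trans (ball_card_le c (ltW r0)) _; clear -r2; lra.
  have Hpow : \sum_(x | ball c r x) (v t x - a t) ^+ n.+1 <= Q1 * (r * w ^+ n.+1).
    have e1 : 0 <= (1 + e) ^+ n by rewrite exprn_ge0// addr_ge0.
    apply: (@le_trans _ _ (\sum_(x | ball c r x) ((1 + e) ^+ n * (v t x - b) ^+ n.+1 +
       (1 + e) ^+ n * (e * w ^+ n.+1) * 1))).
      apply: ler_sum => x _.
      have ev (z : R) : `|z| ^+ n.+1 = z ^+ n.+1.
        by rewrite -normrX ger0_norm// exprn_even_ge0.
      rewrite -ev -[(v t x - b) ^+ _]ev mulr1 -mulrDr.
      apply: le_trans (exprDn_convex n (normr_ge0 _) (ltW w_gt0) e0).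
      by rewrite lerXn2r// nnegrE// addr_ge0.
    rewrite big_split/= -!big_distrr/=.
    have := lerD (ler_wpM2l e1 H1) (ler_wpM2l (mulr_ge0 e1 (mulr_ge0 e0 wn0)) cD3).
    move=> /le_trans; apply.
    by rewrite /Q1 [(1 + e) ^+ n.+1]exprS le_eqVlt; apply/orP; left; apply/eqP; ring.
  have Htail x : ball c (r / 2) x -> \sum_(y | ~~ ball c r y) B x y t *
      Num.max (`|v t y - a t| - w) 0 <= (Ups + 16 * C * e) * (w / r).
    move=> hx.
    apply: (@le_trans _ _ (\sum_(y | ~~ ball c r y) (B x y t *
      Num.max (`|v t y - b| - w) 0 + e * w * B x y t))).
      apply: ler_sum => y _; rewrite [e * w * _]mulrC -mulrDr.
      apply: ler_wpM2l; first exact: (flow_ge0 F).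
      apply: le_trans (le_max_shift _ _ ew0).
      by rewrite ge_max !le_max lexx orbT andbT lerD2r Hf0.
    rewrite big_split/= -big_distrr/=.
    have tl : \sum_(y | ~~ ball c r y) B x y t <= 8 * C / (r / 2).
      apply: (@tail_le R K (fun x y => B x y t) C L (r / 2) x) => //.
        by move=> y; exact: (flow_up F).
      move=> y; rewrite /ball/= -ltNge => h; move: hx; rewrite /ball/= => hx.
      have := ler_distD (coord x) (coord y) c.
      by rewrite [`|coord y - coord x|]distrC => h2; clear -h hx h2; lra.
    apply: le_trans (lerD (H2 x hx) (ler_wpM2l ew0 tl)) _.
    by rewrite le_eqVlt; apply/orP; left; apply/eqP; field; rewrite gt_eqF.
  have g0 x : ~~ ball c (r / 2) x -> cutoff c' r x = 0.
    move=> hx; apply: cutoff0 => //; apply: contra hx; rewrite /ball/= => hx.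
    apply: le_trans (ler_distD c' _ _) _; clear -hx cc'; lra.
  have W' x : 0 <= W x t by exact: (flow_W0 F).
  have := @ball_growth R K n (fun x y => B x y t) (fun x => W x t) (v t) (cutoff c' r)
    c (a t) C L r w omega w0 Q1 (Ups + 16 * C * e) on r2 L0 Lr C0 w_gt0 om0 _ w00
    (fun x y => flow_sym F x y ts) (fun x y => flow_ge0 F x y ts)
    (fun x y => @flow_up _ _ _ _ _ _ _ _ _ _ F x y t ts) (fun x y => low x y t tt')
    W' (fun x hx => flow_W F ts (fin x hx)) (fun x => flow_bound F x t) ats
    (cutoff_itv c' r) g0 (fun x y => cutoff_lip c' x y r0) Hpow Htail.
  move=> /(_ (addr_ge0 U0 (mulr_ge0 (mulr_ge0 (ler0n _ _) C0) e0))) /le_trans; apply.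
  rewrite -/(moment n c' r (a t) (v t)) -/(Y t) -/p -/kap /S /E /growth_const -/Q1 -/p.
  rewrite -/(ball_energy (fun x y => B x y) c r t).
  by rewrite le_eqVlt; apply/orP; left; apply/eqP; ring.
- exact: integral_affine_le.
Qed.

End Flow.

(** * One step of the induction on scales *)

Section InvariantStep.
Context {R : realType} {K : nat}.
Local Notation mu := (@lebesgue_measure R).
Local Notation coord := (@coord R K).
Implicit Types (B : site K -> site K -> R -> R) (W : site K -> R -> R) (v : R -> site K -> R).

(** The tangent inequality between q and 1, with q^n >= 1/2. So lowering the height from w to w q
    changes it by at most w / (n + 1). *)
Lemma root_half_bounds n (q : R) : 0 <= q -> q <= 1 -> q ^+ n.+1 = 2^-1 ->
  2^-1 <= q /\ n.+1%:R * (1 - q) <= 1.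
Proof.
move=> q0 q1 qn; split; first by rewrite -qn exprS ler_piMr// exprn_ile1.
have := exprn_tangent n q0 (@ler01 R); rewrite expr1n qn => h.
have qn2 : 2^-1 <= q ^+ n by rewrite -qn exprS ler_piMl// exprn_ge0.
have q10 : 0 <= n.+1%:R * (1 - q) by rewrite mulr_ge0// subr_ge0.
have := ler_wpM2l q10 qn2; move: h; rewrite mulrAC.
by move: (n.+1%:R * (1 - q)) (q ^+ n) => A Q; lra.
Qed.

(** Dividing r by 16 multiplies the admissible tail by 16 q >= 8: one share carries the sites
    outside the old ball, seven are free. Inside the old ball the excess over w sums to at most 3 r
    w / p by the tangent inequality, and the kernel is at most C / (r / 32)^2, which gives 3072 C /
    p. The changes of level and of height meet a total rate 256 C / r, which gives 256 C e and 256 C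
    / p; and 3328 = 3072 + 256. *)
Lemma tail_step n (B : site K -> site K -> R) (u : site K -> R)
    (c c' a a' r w q C L Ups e : R) : odd n ->
    32 <= r -> L <= r / 32 -> 0 < C -> 0 < w -> 0 <= e -> 0 <= q -> q <= 1 ->
    q ^+ n.+1 = 2^-1 -> 3328 * (C / n.+1%:R) + 256 * (C * e) <= 7 * Ups ->
    (forall x y, 0 <= B x y) ->
    (forall x y, L <= `|coord x - coord y| -> B x y <= C / `|coord x - coord y| ^+ 2) ->
    `|c' - c| <= r / 4 -> `|a' - a| <= e * w ->
    \sum_(x | ball c r x) (u x - a) ^+ n.+1 <= 3 * r * w ^+ n.+1 ->
    (forall x, ball c (r / 2) x ->
      \sum_(y | ~~ ball c r y) B x y * Num.max (`|u y - a| - w) 0 <= Ups * (w / r)) ->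
  forall x, ball c' (r / 16 / 2) x ->
    \sum_(y | ~~ ball c' (r / 16) y) B x y * Num.max (`|u y - a'| - w * q) 0 <=
      Ups * (w * q / (r / 16)).
Proof.
move=> on r32 Lr C0 w0 e0 q0 q1 qn HU B0 up cc' aa' H1 H2 x hx.
have r0 : 0 < r by lra.
have [q2 pq] := root_half_bounds q0 q1 qn.
have en : ~~ odd n.+1 by rewrite /= on.
set p : R := n.+1%:R in HU pq *.
have p0 : 0 < p by rewrite ltr0n.
have X0 : 0 <= C / p by rewrite divr_ge0// ltW.
have Y0 : 0 <= C * e by rewrite mulr_ge0// ltW.
have U0 : 0 <= Ups.
  by move: HU X0 Y0; clear; move: (C / p) (C * e) => X Y; lra.
have [HA HAE] : exists A, A = 3328 * (C / p) + 256 * (C * e) by eexists.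
rewrite -HAE in HU.
have dist y : ~~ ball c' (r / 16) y -> r / 32 <= `|coord x - coord y|.
  rewrite /ball/= -ltNge => h; move: hx; rewrite /ball/= => hx.
  have := ler_distD (coord x) (coord y) c'.
  by rewrite [`|coord y - coord x|]distrC => h2; clear -h hx h2; lra.
have w1 : 0 <= w * (1 - q) by rewrite mulr_ge0 ?subr_ge0// ltW.
have ew0 : 0 <= e * w by rewrite mulr_ge0// ltW.
pose m y := Num.max (`|u y - a| - w) 0.
have m0 y : 0 <= m y by rewrite le_max lexx orbT.
have step y : Num.max (`|u y - a'| - w * q) 0 <= m y + (e * w + w * (1 - q)).
  apply: le_trans (le_max_shift _ _ (addr_ge0 ew0 w1)).
  rewrite ge_max !le_max lexx orbT andbT; apply/orP; left.
  have -> : u y - a' = (u y - a) - (a' - a) by ring.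
  have := ler_normB (u y - a) (a' - a); clear -aa'; lra.
apply: (@le_trans _ _ (\sum_(y | ~~ ball c' (r / 16) y) (B x y * m y +
    (e * w + w * (1 - q)) * B x y))).
  apply: ler_sum => y _; rewrite [(_ + _) * B x y]mulrC -mulrDr.
  by apply: ler_wpM2l.
rewrite big_split/= -big_distrr/=.
have tl : \sum_(y | ~~ ball c' (r / 16) y) B x y <= 8 * C / (r / 32).
  have r1 : 1 <= r / 32 by clear -r32; lra.
  by apply: (tail_le r1 Lr (ltW C0) (up x)).
have Z0 : 0 <= C / r ^+ 2 by rewrite divr_ge0 ?sqr_ge0// ltW.
have [c1 c1E c0] : exists2 c1, c1 = 1024 * (C / r ^+ 2) & 0 <= c1.
  exists (1024 * (C / r ^+ 2)); first reflexivity.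
  by move: Z0; clear; move: (C / _) => X h; lra.
have near_ : \sum_(y | ~~ ball c' (r / 16) y) B x y * m y <=
    Ups * (w / r) + c1 * \sum_(y | ball c r y) m y.
  rewrite (bigID (ball c r))/= addrC; apply: lerD.
    apply: le_trans (H2 x _).
      rewrite big_mkcond [X in _ <= X]big_mkcond; apply: ler_sum => y _.
      case: ifPn => [/andP[_ ->]//|_]; case: ifP => // _; exact: (mulr_ge0 (B0 x y) (m0 y)).
    rewrite /ball/=; apply: le_trans (ler_distD c' _ _) _.
    by move: hx; rewrite /ball/= => hx; clear -hx cc' r32; lra.
  rewrite big_distrr/= big_mkcond [X in _ <= X]big_mkcond; apply: ler_sum => y _.
  case: ifPn => [/andP[hy ->]|_]; last by case: ifP => // _; rewrite mulr_ge0.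
  apply: ler_wpM2r => //.
  have dy := dist y hy; have d0 : 0 < `|coord x - coord y| by clear -dy r32; lra.
  apply: le_trans (up x y (le_trans Lr dy)) _; rewrite c1E.
  have -> : 1024 * (C / r ^+ 2) = C / (r / 32) ^+ 2 by field; rewrite gt_eqF.
  have r320 : 0 < r / 32 by rewrite divr_gt0.
  apply: ler_wpM2l; first exact: ltW.
  by rewrite lef_pV2 ?posrE ?exprn_gt0// lerXn2r// nnegrE ltW.
have summ : \sum_(y | ball c r y) m y <= 3 * r * w / p.
  have pw : 0 < p * w ^+ n by rewrite mulr_gt0// exprn_gt0.
  rewrite -(ler_pM2l pw) big_distrr/=.
  have -> : p * w ^+ n * (3 * r * w / p) = 3 * r * w ^+ n.+1.
    by rewrite exprS; field; rewrite gt_eqF.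
  apply: le_trans H1; apply: ler_sum => y _.
  have ev (z : R) : `|z| ^+ n.+1 = z ^+ n.+1.
    by rewrite -normrX ger0_norm// exprn_even_ge0.
  rewrite -ev /m maxr_pMr ?(ltW pw)// mulr0 ge_max exprn_ge0// andbT.
  apply: le_trans (exprn_tangent n (ltW w0) (normr_ge0 _)) _.
  by rewrite gerBl exprn_ge0// ltW.
apply: le_trans (lerD (le_trans near_ (lerD (lexx _) (ler_wpM2l c0 summ)))
  (ler_wpM2l (addr_ge0 ew0 w1) tl)) _.
have -> : Ups * (w / r) + c1 * (3 * r * w / p) +
   (e * w + w * (1 - q)) * (8 * C / (r / 32)) =
   (w / r) * (Ups + 3072 * (C / p) + 256 * (C * e) + 256 * (C / p * (p * (1 - q)))).
  by rewrite c1E; field; rewrite !gt_eqF.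
have -> : Ups * (w * q / (r / 16)) = (w / r) * (16 * q * Ups).
  by field; rewrite gt_eqF.
apply: ler_wpM2l; first by rewrite divr_ge0// ltW.
have h1 := ler_wpM2l X0 pq.
have h2 := ler_wpM2r U0 q2.
move: HU h1 h2 X0 Y0; rewrite HAE; clear; set q' := p * (1 - q).
have -> : 16 * q * Ups = 16 * (q * Ups) by ring.
by move: (C / p * q') (C / p) (C * e) (q * Ups) => A1 A2 A3 A4; lra.
Qed.

(** What passes from scale to scale: w is the height, and the level a is constant over the time
    window. The tail clause belongs to the induction because the moment in the ball says nothing
    about the exterior, which the long range of B reaches. *)
Definition invar n (Lam Ups c e a r w : R) B v : Prop :=
  `|a| <= 1 /\ forall t, e - r / Lam <= t <= e ->
    \sum_(x | ball c r x) (v t x - a) ^+ n.+1 <= 3 * r * w ^+ n.+1 /\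
    forall x, ball c (r / 2) x ->
      \sum_(y | ~~ ball c r y) B x y t * Num.max (`|v t y - a| - w) 0 <= Ups * (w / r).

Lemma moment_le_ball n (c c' r b : R) (u : site K -> R) : odd n -> 0 < r ->
  `|c' - c| <= r / 4 -> moment n c' r b u <= \sum_(x | ball c r x) (u x - b) ^+ n.+1.
Proof.
move=> on r0 cc'; rewrite /moment [X in _ <= X]big_mkcond; apply: ler_sum => x _.
have f0 : 0 <= (u x - b) ^+ n.+1 by rewrite exprn_even_ge0//= on.
case: ifPn => [_|hx].
  have /andP[g0 g1] := cutoff_itv c' r x.
  by rewrite ler_piMl// expr_le1.
rewrite cutoff0// ?expr0n ?mul0r//; apply: contra hx; rewrite /ball/= => hx.
by apply: le_trans (ler_distD c' _ _) _; clear -hx cc' r0; lra.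
Qed.

Lemma ball_le_moment n (c r b : R) (u : site K -> R) : odd n -> 0 < r ->
  \sum_(x | ball c (r / 8) x) (u x - b) ^+ n.+1 <= moment n c r b u.
Proof.
move=> on r0; rewrite /moment [X in X <= _]big_mkcond; apply: ler_sum => x _.
have f0 : 0 <= (u x - b) ^+ n.+1 by rewrite exprn_even_ge0//= on.
case: ifPn => [hx|_]; first by rewrite cutoff1// expr1n mul1r.
by rewrite mulr_ge0// sqr_ge0.
Qed.

Lemma subset_integral_le (f : R -> R) (a b a' b' M : R) : a <= a' -> b' <= b ->
    measurable_fun `[a, b] f -> (forall t, a <= t <= b -> 0 <= f t) ->
    (\int[mu]_(t in `[a, b]) (f t)%:E <= M%:E)%E ->
  (\int[mu]_(t in `[a', b']) (f t)%:E <= M%:E)%E.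
Proof.
move=> aa bb mf f0; apply: le_trans; apply: ge0_subset_integral => //.
- exact/measurable_EFinP.
- move=> t /=; rewrite !in_itv/= => /andP[h1 h2].
  by rewrite (le_trans aa h1) (le_trans h2 bb).
Qed.

(** Sum the inequality w^n |u - a| <= w^(n+1) + |u - a|^(n+1). It confines the mean value that the
    level follows. *)
Lemma mean_dist_le n (P : pred (site K)) (u : site K -> R) (a w N k : R) :
    odd n -> 0 < w -> 0 < N -> \sum_(x | P x) 1 = N -> 0 <= k ->
    \sum_(x | P x) (u x - a) ^+ n.+1 <= k * N * w ^+ n.+1 ->
  `|(\sum_(x | P x) u x) / N - a| <= (1 + k) * w.
Proof.
move=> on w0 N0 NE k0 H.
have en : ~~ odd n.+1 by rewrite /= on.
have -> : (\sum_(x | P x) u x) / N - a = (\sum_(x | P x) (u x - a)) / N.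
  have sa : \sum_(x | P x) a = a * N.
    by rewrite -NE big_distrr/=; apply: eq_bigr => *; rewrite mulr1.
  by rewrite big_split/= sumrN sa; field; rewrite gt_eqF.
rewrite normrM normfV (gtr0_norm N0) ler_pdivrMr//.
apply: le_trans (ler_norm_sum _ _ _) _.
have wn0 : 0 < w ^+ n by rewrite exprn_gt0.
rewrite -(ler_pM2l wn0) big_distrr/=.
apply: (@le_trans _ _ (\sum_(x | P x) (w ^+ n.+1 * 1 + (u x - a) ^+ n.+1))).
  apply: ler_sum => x _; rewrite mulr1.
  have -> : (u x - a) ^+ n.+1 = `|u x - a| ^+ n.+1.
    by rewrite -normrX ger0_norm// exprn_even_ge0.
  exact: exprn_mul_le (ltW w0) (normr_ge0 _).
rewrite big_split/= -big_distrr/= NE.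
apply: le_trans (lerD (lexx _) H) _.
by rewrite exprSr le_eqVlt; apply/orP; left; apply/eqP; ring.
Qed.

(** Until [t1], the start of the new time window, the level moves and the moment decays; afterwards
    the level is frozen, as [invar] demands, and the moment grows little. The freedom to move the
    centre by r / 4 and the end time by r / (2 Lam) later gives access to all small windows from a
    single large one. *)
Lemma invar_step (s C L l0 w0 H Z : R) B W v (F : flow s C L l0 w0 H Z B W v)
    n (Lam Ups q e0 c c' e e' a r w MS : R) : odd n ->
    1 <= C -> 1 <= Lam -> 0 <= q -> q <= 1 -> q ^+ n.+1 = 2^-1 -> e0 = 6 / (C * Lam) ->
    0 <= Ups -> 3328 * (C / n.+1%:R) + 256 * (C * e0) <= 7 * Ups ->
    expR (- (7 / 64 * (n.+1%:R / (C * Lam)))) <= 100^-1 ->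
    growth_const n C Ups e0 <= Lam / 100 ->
    32 <= r -> 0 <= L -> L <= r / 32 -> l0 <= 2 * r -> 0 <= w0 -> 0 < w ->
    `|c| + r <= 3 / 4 * K%:R -> `|c' - c| <= r / 4 ->
    e - r / (2 * Lam) <= e' -> e' <= e -> e <= 0 -> - s <= e - r / Lam ->
    (\int[mu]_(t in `[(e - r / Lam)%R, e]) (ball_energy B c r t)%:E <= MS%:E)%E ->
    128 * 2 ^+ n.+1 * L ^+ 2 * MS <= r ^+ 3 * w ^+ n.+1 / 100 ->
    3 * r * n.+1%:R * 2 ^+ n * w0 <= w ^+ n.+1 / 100 ->
    invar n Lam Ups c e a r w B v ->
  exists2 a', `|a' - a| <= e0 * w & invar n Lam Ups c' e' a' (r / 16) (w * q) B v.
Proof.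
move=> on C1 Lam1 q0 q1 qn e0E U0 HU Hexp HG r32 L0 Lr l0r w00 w_gt0 bulk cc' ee' e'e e00 se HS SS WW.
case=> a1 inv.
have r0 : 0 < r by clear -r32; lra.
have r2 : 1 <= r / 2 by clear -r32; lra.
have Lr2 : L <= r / 2 by clear -Lr r0; lra.
have L_gt0 : 0 < Lam by clear -Lam1; lra.
have C0 : 0 < C by clear -C1; lra.
have rL0 : 0 < r / Lam by rewrite divr_gt0.
have wn0 : 0 < w ^+ n.+1 by rewrite exprn_gt0.
have e00' : 0 <= e0 by rewrite e0E divr_ge0// mulr_ge0// ltW.
(* At least 7/16 of the old window serves the decay: one half is lost to the displaced end time and
   1/16 to the new window. *)
pose t0 := e - r / Lam; pose t1 := e' - r / 16 / Lam.
have e2 : r / (2 * Lam) = r / Lam / 2 by rewrite invfM; ring.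
have t116 : r / 16 / Lam = r / Lam / 16 by ring.
have t01 : 7 / 16 * (r / Lam) <= t1 - t0.
  by move: ee'; rewrite /t0 /t1 e2 t116; clear; move: (r / Lam) => z; lra.
have t01' : t1 - t0 <= r / Lam.
  by move: rL0 e'e; rewrite /t0 /t1 t116; clear; move: (r / Lam) => z; lra.
have t0t1 : t0 <= t1.
  by move: rL0 t01; clear; move: (r / Lam) => z; lra.
have t1e' : t1 <= e'.
  by move: rL0; rewrite /t1 t116; clear; move: (r / Lam) => z; lra.
have inE t : t0 <= t <= e' -> t0 <= t <= e.
  by move=> /andP[-> h]; exact: le_trans e'e.
have inT t : t0 <= t <= e -> - s <= t <= 0.
  by move=> /andP[h1 h2]; rewrite (le_trans se h1) (le_trans h2 e00).
pose N : R := \sum_(x : site K | ball c r x) 1.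
have Nle : N <= 3 * r.
  by apply: le_trans (ball_card_le c (ltW r0)) _; clear -r32; lra.
have Nge : r <= N.
  have c1 : c <= `|c| by exact: ler_norm.
  have c2 : - c <= `|c| by rewrite -normrN; exact: ler_norm.
  have K0 : (0 : R) <= K%:R by exact: ler0n.
  have hk1 : - K%:R <= c - r by clear -c2 bulk K0; lra.
  have hk2 : c + r <= K%:R by clear -c1 bulk K0; lra.
  by apply: le_trans (ball_card_ge (ltW r0) hk1 hk2); clear -r32; lra.
have N0 : 0 < N by exact: lt_le_trans Nge.
pose om := 1 / (C * (2 * r) ^+ 2).
have om0 : 0 < om by rewrite /om divr_gt0// mulr_gt0// exprn_gt0// mulr_gt0.
have inD x : ball c r x -> `|coord x| <= 3 / 4 * K%:R.
  rewrite /ball/= => h; apply: le_trans bulk.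
  rewrite -[coord x](subrK c) addrC; apply: le_trans (ler_normD _ _) _.
  by rewrite lerD2l.
have low x y t : t0 <= t <= e -> ball c r x -> ball c r y -> x != y -> om <= B x y t.
  move=> /inT ts hx hy xy; apply: (flow_low F) => //; [exact: inD|exact: inD|].
  move: hx hy; rewrite /ball/= => hx hy.
  apply: le_trans (ler_distD c _ _) _; rewrite [`|c - _|]distrC.
  by clear -hx hy; lra.
pose l := om * N.
have l0' : 0 <= l by rewrite mulr_ge0// ltW.
have lub : l <= 3 / (4 * C * r).
  have -> : 3 / (4 * C * r) = om * (3 * r).
    by rewrite /om; field; rewrite !gt_eqF.
  by apply: ler_wpM2l Nle; exact: ltW.
have llb : 1 / (4 * C * r) <= l.
  have -> : 1 / (4 * C * r) = om * r.
    by rewrite /om; field; rewrite !gt_eqF.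
  by apply: ler_wpM2l Nge; exact: ltW.
pose A t := (\sum_(y | ball c r y) v t y) / N.
have cA : continuous A.
  have cA' t : {for t, continuous A}.
    apply: continuousM; last exact: cvg_cst.
    rewrite (_ : (fun t => _) = fun t => \sum_y (if ball c r y then v t y else 0)).
      by apply: continuous_sum_at => y; case: (ball c r y); [exact: (flow_cont F)|exact: cvg_cst].
    by apply/funext => u; rewrite big_mkcond.
  by move=> t; exact: cA'.
have [aa aat0 daa] := linear_ode t0 a l cA.
have caa t : t0 <= t -> {for t, continuous aa}.
  by move=> ht; apply/differentiable_continuous/derivable1_diffP; apply: (ex_derive (is_derive := daa t ht)).
have sumN (z : R) : \sum_(y : site K | ball c r y) z = z * N.
  by rewrite /N big_distrr/=; apply: eq_bigr => *; rewrite mulr1.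
have daa' t : t0 <= t -> is_derive t 1 aa (om * \sum_(y | ball c r y) (v t y - aa t)).
  move=> ht; have := daa t ht; rewrite (_ : l * _ = om * \sum_(y | ball c r y) (v t y - aa t))//.
  by rewrite big_split/= sumrN sumN /l /A; field; rewrite gt_eqF.
have aa1 t : t0 <= t <= t1 -> `|aa t| <= 1.
  move=> tt; rewrite -[aa t]subr0.
  apply: (linear_ode_bound l0' daa _ _ tt); rewrite ?aat0 ?subr0// => u _.
  rewrite subr0 /A normrM normfV (gtr0_norm N0) ler_pdivrMr// mul1r.
  apply: le_trans (ler_norm_sum _ _ _) _; rewrite /N.
  by apply: ler_sum => y _; exact: (flow_bound F).
(* [e0] = 6 / (C Lam) arises as 2 l (t1 - t0) times 4, where l <= 3 / (4 C r), t1 - t0 <= r / Lam,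
   and the mean stays within 4 w of a. *)
have aad t : t0 <= t <= t1 -> `|aa t - a| <= e0 * w.
  move=> tt.
  have Ad u : t0 <= u <= t1 -> `|A u - aa t0| <= (1 + 3) * w.
    move=> /andP[h1 h2]; rewrite aat0; apply: (@mean_dist_le n) => //.
    have [+ _] := inv u ltac:(by rewrite h1 (le_trans h2)// (le_trans t1e')).
    move=> /le_trans; apply; apply: ler_wpM2r; first exact: ltW.
    by apply: ler_wpM2l.
  have w4 : 0 <= (1 + 3) * w by rewrite mulr_ge0// ltW.
  have := linear_ode_drift l0' w4 daa Ad tt; rewrite aat0 => /le_trans; apply.
  have h1 : 2 * l * (t1 - t0) <= 2 * (3 / (4 * C * r)) * (r / Lam).
    apply: ler_pM => //; [exact: mulr_ge0|by rewrite subr_ge0|exact: ler_wpM2l].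
  apply: le_trans (ler_wpM2r w4 h1) _.
  by rewrite e0E le_eqVlt; apply/orP; left; apply/eqP; field; rewrite !gt_eqF.
pose a' := aa t1.
have t1in : t0 <= t1 <= t1 by rewrite t0t1 lexx.
exists a'; first exact: aad.
split; first exact: aa1.
set p : R := n.+1%:R in HU Hexp WW *.
have p0 : 0 < p by rewrite ltr0n.
have mB : measurable_fun `[e - r / Lam, e] (ball_energy B c r).
  by apply: measurable_funS (ball_energy_meas c r (flow_meas F)) => //.
have B0 t : t0 <= t <= e -> 0 <= ball_energy B c r t.
  by move=> /inT; apply: ball_energy_ge0; exact: flow_ge0 F.
have HSsub u u' : t0 <= u -> u' <= e ->
    (\int[mu]_(t in `[u, u']) (ball_energy B c r t)%:E <= MS%:E)%E.
  by move=> h1 h2; exact: (subset_integral_le h1 h2 mB B0 HS).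
have Y0 : moment n c' r (aa t0) (v t0) <= 3 * r * w ^+ n.+1.
  apply: le_trans (moment_le_ball _ _ on r0 cc') _; rewrite aat0.
  by have [] := inv t0 ltac:(by rewrite lexx (le_trans t0t1)// (le_trans t1e')).
have G0 := growth_const_ge0 n (ltW C0) U0 e00'.
have MS0 : 0 <= MS.
  rewrite -lee_fin; apply: le_trans (HSsub t0 t0 (lexx _) _); last first.
    by rewrite (le_trans t0t1)// (le_trans t1e').
  by apply: integral_ge0 => t /=; rewrite in_itv/= lee_fin => /andP[h1 h2]; apply: B0; rewrite h1 (le_trans h2)// (le_trans t0t1)// (le_trans t1e').
(* Growth, killing and short range exchange each contribute at most r w^(n+1) / 100. *)
have err u : 0 <= u -> u <= r / Lam ->
   (growth_const n C Ups e0 * w ^+ n.+1 + 3 * r * p * 2 ^+ n * w0) * u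
    + 128 * 2 ^+ n.+1 * L ^+ 2 / r ^+ 2 * MS <= 3 * (r * w ^+ n.+1 / 100).
  move=> u0 u1.
  have h1 : 128 * 2 ^+ n.+1 * L ^+ 2 / r ^+ 2 * MS <= r * w ^+ n.+1 / 100.
    have -> : 128 * 2 ^+ n.+1 * L ^+ 2 / r ^+ 2 * MS =
       (128 * 2 ^+ n.+1 * L ^+ 2 * MS) / r ^+ 2 by ring.
    rewrite ler_pdivrMr ?exprn_gt0//; apply: le_trans SS _.
    by rewrite le_eqVlt; apply/orP; left; apply/eqP; ring.
  have h2 : growth_const n C Ups e0 * w ^+ n.+1 + 3 * r * p * 2 ^+ n * w0 <=
      Lam * (2 * (w ^+ n.+1 / 100)).
    apply: le_trans (lerD (ler_wpM2r (ltW wn0) HG) WW) _.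
    have := ler_wpM2r (ltW wn0) Lam1; clear; move: (w ^+ n.+1) => z; lra.
  have h3 : Lam * (2 * (w ^+ n.+1 / 100)) * u <= 2 * (r * w ^+ n.+1 / 100).
    have -> : 2 * (r * w ^+ n.+1 / 100) = Lam * (2 * (w ^+ n.+1 / 100)) * (r / Lam).
      by field; rewrite gt_eqF.
    by apply: ler_wpM2l u1; rewrite mulr_ge0// ?mulr_ge0// ?divr_ge0// ltW.
  have := ler_wpM2r u0 h2; move: h1 h3; clear.
  by move: (_ * u) (_ * MS) (Lam * _ * u) (r * _ / _) => A1 A2 A3 A4; lra.
(* The decay leaves 3/100 from the initial moment, and the errors add 3/100. *)
have YA : moment n c' r a' (v t1) <= 6 * (r * w ^+ n.+1 / 100).
  have := energy_step F (b := a) (c := c) (c' := c') (t0 := t0) (t1 := t1) (a := aa)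
    on r2 L0 Lr2 (ltW C0) w_gt0 (ltW om0) U0 w00 e00' se t0t1
    (le_trans t1e' (le_trans e'e e00)) cc' bulk.
  move=> /(_ MS) H1; apply: le_trans (H1 _ _ _ _ _ _) _.
  - by move=> x y t /andP[h1 h2]; apply: low; rewrite h1 (le_trans h2)// (le_trans t1e').
  - by move=> t /andP[h1 _]; exact: caa.
  - by move=> t /andP[h1 _]; apply: daa'; exact: ltW.
  - by move=> t tt; split; [exact: aa1|exact: aad].
  - by move=> t /andP[h1 h2]; apply: inv; rewrite h1 (le_trans h2)// (le_trans t1e').
  - by apply: HSsub => //; exact: le_trans t1e' e'e.
  have u0 : 0 <= t1 - t0 by rewrite subr_ge0.
  have h3 : expR (- (p * om * N) * (t1 - t0)) <= 100^-1.
    apply: le_trans Hexp; rewrite ler_expR mulNr lerN2.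
    have -> : 7 / 64 * (p / (C * Lam)) = p * (1 / (4 * C * r)) * (7 / 16 * (r / Lam)).
      by field; rewrite !gt_eqF.
    have c4 : 0 < 4 * C * r by rewrite !mulr_gt0.
    apply: ler_pM t01.
    - by apply: mulr_ge0; [exact: ltW|apply: divr_ge0 => //; exact: ltW].
    - by apply: mulr_ge0; [exact: divr_ge0|exact: ltW].
    - by rewrite -[p * om * N]mulrA; apply: ler_wpM2l llb; exact: ltW.
  have Yz : 0 <= moment n c' r (aa t0) (v t0).
    by apply: sumr_ge0 => x _; rewrite mulr_ge0 ?sqr_ge0// exprn_even_ge0//= on.
  have h4 := ler_pM (expR_ge0 _) Yz h3 Y0.
  have := err _ u0 t01'; move: h4; rewrite -/p -/N; clear.
  have -> : 100^-1 * (3 * r * w ^+ n.+1) = 3 * (r * w ^+ n.+1 / 100) by ring.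
  by move: (expR _ * _) (r * _ / _) (_ + _ * MS) => A1 A2 A3; lra.
have YB t : t1 <= t <= e' -> moment n c' r a' (v t) <= 9 * (r * w ^+ n.+1 / 100).
  move=> /andP[ht1 ht2].
  have := energy_step F (b := a) (c := c) (c' := c') (t0 := t1) (t1 := t)
    (a := fun=> a') on r2 L0 Lr2 (ltW C0) w_gt0 (lexx 0) U0 w00 e00'
    (le_trans se t0t1) ht1 (le_trans ht2 (le_trans e'e e00)) cc' bulk.
  move=> /(_ MS) H1; apply: le_trans (H1 _ _ _ _ _ _) _.
  - move=> x y u /andP[h1 h2] hx hy xy; apply: (flow_ge0 F); apply: inT.
    by rewrite (le_trans t0t1 h1) (le_trans h2)// (le_trans ht2).
  - by move=> u _; exact: cvg_cst.
  - by move=> u _; rewrite mul0r; exact: is_derive_cst.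
  - by move=> u _; split; [exact: aa1|exact: aad].
  - by move=> u /andP[h1 h2]; apply: inv; rewrite (le_trans t0t1 h1) (le_trans h2)// (le_trans ht2).
  - by apply: HSsub => //; exact: le_trans ht2 e'e.
  rewrite mulr0 mul0r oppr0 mul0r expR0 mul1r.
  have u0 : 0 <= t - t1 by rewrite subr_ge0.
  have u1 : t - t1 <= r / Lam.
    apply: le_trans (_ : e' - t1 <= _); first by rewrite lerD2r.
    by move: rL0; rewrite /t1 t116; clear; move: (r / Lam) => z; lra.
  have := err _ u0 u1; move: YA; rewrite -/p; clear.
  by move: (moment n c' r a' (v t1)) (r * _ / _) (_ + _ * MS) => A1 A2 A3; lra.
move=> t /andP[ht1 ht2]; split.
  (* 9/100 is just below the 3/32 allowed by the radius r / 16 and the halved power of the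
     height. *)
  apply: le_trans (_ : 9 * (r * w ^+ n.+1 / 100) <= _).
    apply: le_trans (YB t _); last by rewrite ht1.
    apply: le_trans (ball_le_moment _ _ _ on r0).
    rewrite big_mkcond [X in _ <= X]big_mkcond; apply: ler_sum => x _.
    have f0 : 0 <= (v t x - a') ^+ n.+1 by rewrite exprn_even_ge0//= on.
    case: ifPn => [hx|_]; last by case: ifP.
    rewrite ifT//; apply: le_trans hx _; clear -r0; lra.
  rewrite exprMn qn; move: r0 wn0; clear; move: (w ^+ n.+1) => z; nra.
have tE : t0 <= t <= e by rewrite (le_trans t0t1 ht1) (le_trans ht2 e'e).
have [i1 i2] := inv t tE.
apply: (@tail_step n (fun x y => B x y t) (v t) c c' a a' r w q C L Ups e0) => //.
- by move=> x y; apply: (flow_ge0 F); exact: inT.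
- by move=> x y; apply: (flow_up F); exact: inT.
- exact: aad.
Qed.

End InvariantStep.

(** * Iteration over scales with fixed centre and end time *)

Section Iteration.
Context {R : realType} {K : nat}.
Local Notation mu := (@lebesgue_measure R).
Local Notation coord := (@coord R K).
Implicit Types (B : site K -> site K -> R -> R) (W : site K -> R -> R) (v : R -> site K -> R).

(** Regularity is known around Z, so a ball with another centre is enclosed in one around Z. *)
Lemma flow_budget_ball (s C L l0 w0 H Z : R) B W v (F : flow s C L l0 w0 H Z B W v)
    (c r M t0 t1 : R) : 0 <= H ->
    `|c - Z| + r <= M -> 1 <= M -> M <= K%:R / 2 -> - s <= t0 -> t0 <= t1 -> t1 <= 0 ->
  (\int[mu]_(t in `[t0, t1]) (ball_energy B c r t)%:E <= (H * M * (1 - t0))%:E)%E.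
Proof.
move=> H0 cM M1 MK st0 t01 t10.
have t00 := le_trans t01 t10.
have inT t : t0 <= t <= 0 -> - s <= t <= 0.
  by move=> /andP[h1 ->]; rewrite (le_trans st0).
have sub (A : set R) : A `<=` `[t0, 0] -> A `<=` `[- s, 0].
  by move=> h t /h /=; rewrite !in_itv/=; exact: inT.
have mE c1 r1 : measurable_fun `[t0, 0] (ball_energy B c1 r1).
  by apply: measurable_funS (ball_energy_meas c1 r1 (flow_meas F)) => //; exact: sub.
have E0 c1 r1 t : t0 <= t <= 0 -> 0 <= ball_energy B c1 r1 t.
  by move=> /inT; apply: ball_energy_ge0; exact: flow_ge0 F.
apply: (subset_integral_le (lexx t0) t10 (mE c r)); first exact: E0.
apply: le_trans (flow_budget F M1 MK (inT t0 _)); last by rewrite lexx.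
apply: ge0_le_integral => //.
- by move=> t /=; rewrite in_itv/= lee_fin; exact: E0.
- by apply/measurable_EFinP; exact: mE.
- by apply/measurable_EFinP; exact: mE.
- move=> t /=; rewrite in_itv/= lee_fin => tt.
  by apply: (@ball_energy_sub _ _ B s) => //; [exact: (flow_ge0 F)|exact: inT].
Qed.

(** The i-th scale moves the level by at most e0 w q^i; the geometric sum is kept multiplied by 1 -
    q. *)
Lemma invar_iter (s C L l0 w0 H Z : R) B W v (F : flow s C L l0 w0 H Z B W v)
    n (Lam Ups q e0 c e a r w : R) (MS : nat -> R) (k : nat) : odd n ->
    1 <= C -> 1 <= Lam -> 0 < q -> q <= 1 -> q ^+ n.+1 = 2^-1 -> e0 = 6 / (C * Lam) ->
    0 <= Ups -> 3328 * (C / n.+1%:R) + 256 * (C * e0) <= 7 * Ups ->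
    expR (- (7 / 64 * (n.+1%:R / (C * Lam)))) <= 100^-1 ->
    growth_const n C Ups e0 <= Lam / 100 ->
    0 <= L -> 0 <= w0 -> 0 < w -> 0 < r ->
    `|c| + r <= 3 / 4 * K%:R -> e <= 0 -> - s <= e - r / Lam ->
    (forall i, (i < k)%N -> let ri := r / 16 ^+ i in let wi := w * q ^+ i in
      [/\ 32 <= ri, L <= ri / 32, l0 <= 2 * ri,
        (\int[mu]_(t in `[(e - ri / Lam)%R, e]) (ball_energy B c ri t)%:E <= (MS i)%:E)%E &
       128 * 2 ^+ n.+1 * L ^+ 2 * MS i <= ri ^+ 3 * wi ^+ n.+1 / 100 /\
       3 * ri * n.+1%:R * 2 ^+ n * w0 <= wi ^+ n.+1 / 100]) ->
    invar n Lam Ups c e a r w B v ->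
  exists2 a', `|a' - a| * (1 - q) <= e0 * w * (1 - q ^+ k) &
    invar n Lam Ups c e a' (r / 16 ^+ k) (w * q ^+ k) B v.
Proof.
move=> on C1 Lam1 q0 q1 qn e0E U0 HU Hexp HG L0 w00 w_gt0 r0 bulk e_le0 se.
elim: k => [|k IH] Hk inv.
  by exists a; rewrite ?expr0 ?divr1 ?mulr1// !subrr normr0 mul0r mulr0.
have [a1 a1a inv1] := IH (fun i ik => Hk i (ltnW ik)) inv.
have [h1 h2 h3 h4 [h5 h6]] := Hk k (ltnSn k).
have rk : 0 < r / 16 ^+ k by rewrite divr_gt0// exprn_gt0.
have rkr : r / 16 ^+ k <= r.
  rewrite ler_pdivrMr ?exprn_gt0//; apply: ler_peMr; first exact: ltW.
  by apply: exprn_ege1; rewrite ler1n.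
have L0' : 0 < Lam by exact: lt_le_trans Lam1.
have bulk' : `|c| + r / 16 ^+ k <= 3 / 4 * K%:R by apply: le_trans bulk; rewrite lerD2l.
have se' : - s <= e - r / 16 ^+ k / Lam.
  by apply: le_trans se _; rewrite lerD2l lerN2 ler_pM2r ?invr_gt0.
have cc : `|c - c| <= r / 16 ^+ k / 4 by rewrite subrr normr0 divr_ge0// ltW.
have ee : e - r / 16 ^+ k / (2 * Lam) <= e.
  by rewrite gerBl divr_ge0// ?mulr_ge0// ltW.
have [a2 a2a inv2] := invar_step F on C1 Lam1 (ltW q0) q1 qn e0E U0 HU Hexp HG h1 L0 h2 h3 w00
  (mulr_gt0 w_gt0 (exprn_gt0 k q0)) bulk' cc ee (lexx e) e_le0 se' h4 h5 h6 inv1.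
exists a2; last first.
  move: inv2; congr (invar n Lam Ups c e a2 _ _ B v).
    by rewrite exprSr invfM mulrA.
  by rewrite exprSr mulrA.
have -> : a2 - a = (a2 - a1) + (a1 - a) by ring.
have q10 : 0 <= 1 - q by rewrite subr_ge0.
apply: le_trans (ler_wpM2r q10 (ler_normD _ _)) _.
have := ler_wpM2r q10 a2a; move: a1a; rewrite mulrDl exprSr; clear.
by move: (`|a2 - a1| * _) (`|a1 - a| * _) (q ^+ k) => A1 A2 Q; lra.
Qed.

(** Chebyshev's inequality with the power n + 1 about a, then the triangle inequality to replace a
    by a common reference level b. *)
Lemma invar_count n (Lam Ups c e a b r w G : R) B v : odd n -> 0 < G ->
    0 <= r -> 0 <= Lam -> invar n Lam Ups c e a r w B v ->
  \sum_(x | ball c r x && (`|a - b| + G < `|v e x - b|)) 1 <= 3 * r * (w / G) ^+ n.+1.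
Proof.
move=> on G0 r0 L0 [_ inv].
have [H _] := inv e ltac:(by rewrite lexx gerBl divr_ge0).
have Gn : 0 < G ^+ n.+1 by rewrite exprn_gt0.
rewrite expr_div_n mulrA ler_pdivlMr//; apply: le_trans H.
rewrite mulrC big_distrr/= big_mkcond [X in _ <= X]big_mkcond; apply: ler_sum => x _.
have f0 : 0 <= (v e x - a) ^+ n.+1 by rewrite exprn_even_ge0//= on.
case: ifPn => [/andP[-> h]|_]; last by case: ifP.
rewrite mulr1 -(ger0_norm f0) normrX lerXn2r// ?nnegrE ?(ltW G0)//.
have -> : v e x - a = (v e x - b) - (a - b) by ring.
by have := lerB_dist (v e x - b) (a - b); move: h; clear; lra.
Qed.

End Iteration.

(** * Powers of the positive part *)

Section PositivePart.
Context {R : realType}.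

(** The power is at least 2, so the two branches join at the origin with derivative 0; truncations
    can then be differentiated in time without exceptional times. *)
Lemma is_derive_pospart n (z : R) :
  is_derive z 1 (fun z => Num.max z 0 ^+ n.+2) (n.+2%:R * Num.max z 0 ^+ n.+1).
Proof.
have [z0|z0|->] := ltgtP z 0.
- rewrite expr0n/= mulr0.
  have h1 : \near z, cst 0 z = Num.max z 0 ^+ n.+2.
    near=> u; rewrite /cst max_r ?expr0n//.
    by apply: ltW; near: u; exact: lt_nbhsl.
  exact: (near_eq_is_derive h1 (is_derive_cst 0 z 1)).
- have h1 : \near z, z ^+ n.+2 = Num.max z 0 ^+ n.+2.
    near=> u; rewrite max_l//.
    by apply: ltW; near: u; exact: lt_nbhsr.
  have h2 := is_derive_exprn_at n.+1 (is_derive_id z (1 : R)).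
  by rewrite mulr1 in h2; exact: (near_eq_is_derive h1 h2).
- rewrite expr0n/= mulr0.
  have H : (fun h : R => h^-1 * (Num.max (h + 0) 0 ^+ n.+2 - Num.max 0 0 ^+ n.+2) : R) @ (0:R)^' --> (0 : R).
    apply/cvgrPdist_le => e e0; rewrite near_withinE.
    have pick (e' : R) : 0 < e' -> exists2 d : R, 0 < d & d <= e' /\ d <= 1.
      by move=> e'0; have /orP[h|h] := le_total e' 1; [exists e'|exists 1].
    have [d d0 [de d1]] := pick e e0.
    apply/nbhs_ballP; exists d => //=.
    move=> h; rewrite /pseudometric_structure.ball/= sub0r normrN => hd h0.
    have h1 := ltW (lt_le_trans hd de); have h2 := ltW (lt_le_trans hd d1).
    rewrite maxxx expr0n/= subr0 addr0 sub0r normrN normrM normfV normrX.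
    have h3 : `|Num.max h 0| <= `|h|.
      by rewrite ger0_norm ?le_max ?lexx ?orbT// ge_max ler_norm normr_ge0.
    have hp : 0 < `|h| by rewrite normr_gt0.
    rewrite mulrC ler_pdivrMr//.
    apply: (@le_trans _ _ (`|h| ^+ n.+2)); first by rewrite lerXn2r ?nnegrE.
    rewrite !exprS mulrA; apply: (@le_trans _ _ (`|h| * `|h|)).
      by rewrite ler_piMr ?mulr_ge0// exprn_ile1.
    by rewrite ler_wpM2r.
  have H' : (fun h : R => h^-1 *: (((fun z : R => Num.max z 0 ^+ n.+2) \o shift 0) (h *: 1)
      - Num.max 0 0 ^+ n.+2 : R)) @ (0:R)^' --> (0 : R).
    by under eq_fun => h do rewrite /= /GRing.scale/= mulr1.
  apply: DeriveDef; first by apply/cvg_ex; exists 0.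
  exact: cvg_lim H'.
Unshelve. all: by end_near.
Qed.

End PositivePart.

(** * Truncation above a barrier: from few bad sites to none *)

Section Truncation.
Context {R : realType} {K : nat}.
Local Notation mu := (@lebesgue_measure R).
Local Notation coord := (@coord R K).

(** On its support w equals v - b - g, and elsewhere it is larger, so v may be replaced by w + g.
    The symmetrised energy of w then comes with the factor -1/2. A quarter pays the cross term with
    the barrier through [truncation_form_le]; the other quarter is bounded below by the pairs in
    which one value vanishes, that is, by the jumps out of the support. *)
Lemma trunc_energy_le n (T : finType) (B : T -> T -> R) (v g w : T -> R) (b : R) :
    (forall x, w x = Num.max (v x - b - g x) 0) ->
    (forall x y, B x y = B y x) -> (forall x y, 0 <= B x y) ->
  n.+3%:R * \sum_x w x ^+ n.+2 * \sum_y B x y * (v y - v x) <=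
    - (n.+3%:R / 2 * \sum_x w x ^+ n.+3 * \sum_(y | w y == 0) B x y) +
    n.+3%:R * n.+2%:R / 2 * \sum_x w x ^+ n.+1 * \sum_y B x y * (g x - g y) ^+ 2.
Proof.
move=> wE sB B0.
have w0 x : 0 <= w x by rewrite wE le_max lexx orbT.
have first : \sum_x w x ^+ n.+2 * \sum_y B x y * (v y - v x) <=
    \sum_x w x ^+ n.+2 * \sum_y B x y * (w y - w x) +
    \sum_x w x ^+ n.+2 * \sum_y B x y * (g y - g x).
  rewrite -big_split; apply: ler_sum => x _ /=; rewrite -mulrDr -big_split/=.
  have [->|wx] := eqVneq (w x) 0; first by rewrite expr0n/= !mul0r.
  apply: ler_wpM2l; first exact: exprn_ge0.
  apply: ler_sum => y _; rewrite -mulrDr; apply: ler_wpM2l => //.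
  have wxE : w x = v x - b - g x.
    by move: wx; rewrite wE; case: ltP => // _; rewrite eqxx.
  have wy : v y - b - g y <= w y by rewrite wE le_max lexx.
  by rewrite wxE; move: wy; clear; lra.
pose I := \sum_x \sum_y B x y * ((w x - w y) * (w x ^+ n.+2 - w y ^+ n.+2)).
pose J := \sum_x w x ^+ n.+1 * \sum_y B x y * (g x - g y) ^+ 2.
have e1 : \sum_x w x ^+ n.+2 * \sum_y B x y * (w y - w x) = - (2^-1 * I).
  rewrite (@sum_antisym _ _ B xpredT (fun x => w x ^+ n.+2) w)//; congr (- (_ * _)).
  by apply: eq_bigr => x _; apply: eq_bigr => y _; rewrite [(_ - _) * (w x - _)]mulrC.
have e2 : \sum_x w x ^+ n.+2 * \sum_y B x y * (g y - g x) <=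
    4^-1 * I + 2^-1 * n.+2%:R * J.
  rewrite (@sum_antisym _ _ B xpredT (fun x => w x ^+ n.+2) g)//.
  pose J2 := \sum_x \sum_y B x y * ((g x - g y) ^+ 2 * w y ^+ n.+1).
  have JE : J = \sum_x \sum_y B x y * ((g x - g y) ^+ 2 * w x ^+ n.+1).
    by apply: eq_bigr => x _; rewrite big_distrr/=; apply: eq_bigr => y _; ring.
  have J2E : J2 = J.
    rewrite JE /J2 exchange_big; apply: eq_bigr => x _; apply: eq_bigr => y _.
    by rewrite sB -[(g y - g x) ^+ 2]sqrrN opprB.
  have -> : 4^-1 * I + 2^-1 * n.+2%:R * J = 2^-1 * (2^-1 * I + 2^-1 * n.+2%:R * (J + J2)).
    by rewrite J2E; field.
  rewrite -mulrN; apply: ler_wpM2l; first by rewrite invr_ge0.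
  rewrite JE /J2 /I -big_split !big_distrr -big_split -sumrN/=; apply: ler_sum => x _.
  rewrite -big_split !big_distrr -big_split -sumrN/=; apply: ler_sum => y _.
  have := ler_wpM2l (B0 x y) (truncation_form_le n.+1 (- (g x - g y)) (w0 x) (w0 y)).
  rewrite sqrrN => h; apply: le_trans (le_trans _ h) _;
    by rewrite le_eqVlt; apply/orP; left; apply/eqP; ring.
have e3 : 2 * \sum_x w x ^+ n.+3 * \sum_(y | w y == 0) B x y <= I.
  pose Q x y := if w y == 0 then B x y * w x ^+ n.+3 else 0.
  have -> : 2 * \sum_x w x ^+ n.+3 * \sum_(y | w y == 0) B x y =
     \sum_x \sum_y (Q x y + Q y x).
    have QE : \sum_x w x ^+ n.+3 * \sum_(y | w y == 0) B x y = \sum_x \sum_y Q x y.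
      apply: eq_bigr => x _; rewrite big_distrr/= big_mkcond/=; apply: eq_bigr => y _.
      by rewrite /Q; case: ifP => // _; rewrite mulrC.
    have -> : \sum_x \sum_y (Q x y + Q y x) = \sum_x \sum_y Q x y + \sum_x \sum_y Q y x.
      by rewrite -big_split; apply: eq_bigr => x _; rewrite big_split.
    by rewrite [X in _ = _ + X]exchange_big QE mulr2n mulrDl mul1r.
  apply: ler_sum => x _; apply: ler_sum => y _; rewrite /Q.
  have [wy|wy] := eqVneq (w y) 0; have [wx|wx] := eqVneq (w x) 0.
  - by rewrite wx wy !expr0n/= !mulr0 addr0 subrr mul0r mulr0.
  - by rewrite wy !expr0n/= !subr0 addr0 -exprS.
  - by rewrite wx !expr0n/= !sub0r add0r mulrNN -exprS sB.
  - rewrite addr0 mulr_ge0//.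
    have [xy|/ltW xy] := leP (w x) (w y).
      by rewrite mulr_le0// subr_le0// lerXn2r// nnegrE.
    by rewrite mulr_ge0// subr_ge0// lerXn2r// nnegrE.
have p0 : 0 <= n.+3%:R :> R by exact: ler0n.
have := ler_wpM2l p0 first; move=> /le_trans; apply; rewrite e1.
have p4 : 0 <= n.+3%:R / 4 :> R by rewrite divr_ge0.
have := ler_wpM2l p0 e2; have := ler_wpM2l p4 e3; rewrite -/J.
move: (\sum_x w x ^+ n.+3 * _) (\sum_x w x ^+ n.+2 * _) => S1 S2.
move=> h2 h1; move: h1 h2; clear; move: (n.+3%:R) (n.+2%:R) J I => a1 a2 a3 a4.
rewrite !mulrDr.
have -> : a1 / 4 * (2 * S1) = a1 / 2 * S1 by field.
have -> : a1 * (4^-1 * a4) = a1 / 4 * a4 by field.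
have -> : a1 * - (2^-1 * a4) = - (2 * (a1 / 4 * a4)) by field.
have -> : a1 * (2^-1 * a2 * a3) = a1 * a2 / 2 * a3 by field.
by move: (a1 / 4 * a4) (a1 / 2 * S1) (a1 * S2) (a1 * a2 / 2 * a3) => *; lra.
Qed.

(** The barrier is 0 on the ball of radius Rr and equals 2 outside the ball of radius 2 Rr, where v
    - a <= 2 leaves nothing above it. *)
Lemma trunc_supp (v : site K -> R) (a G Z Rr : R) x :
    `|v x| <= 1 -> `|a| <= 1 -> 0 < G -> 0 < Rr ->
  let w := Num.max (v x - (a + G) - 2 * (1 - cutoff Z (8 * Rr) x)) 0 in
  w <= 2 /\ (w != 0 -> ball Z (2 * Rr) x && (G < `|v x - a|)).
Proof.
move=> v1 a1 G0 R0 /=.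
have /andP[c0 c1] := cutoff_itv Z (8 * Rr) x.
have va : v x - a <= 2.
  by move: v1 a1; rewrite !ler_norml => /andP[_ h1] /andP[h2 _]; clear -h1 h2; lra.
split; first by rewrite ge_max ler0n andbT; clear -va G0 c1; lra.
have [h|h] := leP (v x - (a + G) - 2 * (1 - cutoff Z (8 * Rr) x)) 0.
  by rewrite ?max_r// eqxx.
move=> _ {v1}.
apply/andP; split.
  apply: contraTT h => hx; rewrite -leNgt cutoff0 ?mulr_gt0//.
    by clear -va G0; lra.
  by apply: contra hx; rewrite /ball/= => hx; apply: le_trans hx _; clear -R0; lra.
by apply: lt_le_trans (ler_norm _); clear -h c1; lra.
Qed.

Lemma trunc_moment_le (v : site K -> R) (a G Z Rr : R) m :
    (forall x, `|v x| <= 1) -> `|a| <= 1 -> 0 < G -> 0 < Rr -> (0 < m)%N ->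
  \sum_x Num.max (v x - (a + G) - 2 * (1 - cutoff Z (8 * Rr) x)) 0 ^+ m <=
    2 ^+ m * \sum_(x | ball Z (2 * Rr) x && (G < `|v x - a|)) 1.
Proof.
move=> v1 a1 G0 R0 m0; rewrite big_distrr [X in _ <= X]big_mkcond/=.
apply: ler_sum => x _; rewrite mulr1.
have [w2 wP] := trunc_supp Z (v1 x) a1 G0 R0.
have w0 : 0 <= Num.max (v x - (a + G) - 2 * (1 - cutoff Z (8 * Rr) x)) 0.
  by rewrite le_max lexx orbT.
case: ifPn => hx; first by rewrite lerXn2r// nnegrE.
have [->|/wP h] := eqVneq (Num.max (v x - (a + G) - 2 * (1 - cutoff Z (8 * Rr) x)) 0) 0.
  by rewrite expr0n; case: m m0.
by rewrite h in hx.
Qed.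

Let combine (y A1 A2 A3 A4 u e q1 q2 wv : R) :
  2 * y <= A1 -> A2 <= 22 * u + e -> A3 <= wv -> wv <= 2 * u -> u <= q1 + q2 ->
  24 * q1 <= y -> A4 <= - A1 + A2 -> A4 + A3 <= - y + (24 * q2 + e).
Proof. by move=> *; lra. Qed.

(** At most N0 sites carry w, whereas 4 N0 - 1 sites lie within 2 N0 of any of them. At least 2 N0
    of these are empty, so w leaves its support at rate at least 1 / (2 C N0). Barrier and killing
    cost O(C / Rr) times a moment of lower order; half of the gain absorbs it, up to sites where w
    is below the small height sg. *)
Lemma trunc_growth n (B : site K -> site K -> R) (W v : site K -> R)
    (a G C L Z N0 Rr w0 l0 sg : R) :
    (forall x y, B x y = B y x) -> (forall x y, 0 <= B x y) ->
    (forall x y, L <= `|coord x - coord y| -> B x y <= C / `|coord x - coord y| ^+ 2) ->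
    (forall x y rr, l0 <= rr -> x != y ->
      `|coord x| <= 3 / 4 * K%:R -> `|coord y| <= 3 / 4 * K%:R ->
      `|coord x - coord y| <= rr -> 1 / (C * rr ^+ 2) <= B x y) ->
    (forall x, 0 <= W x) -> (forall x, `|coord x| <= 3 / 4 * K%:R -> W x <= w0) ->
    (forall x, `|v x| <= 1) -> `|a| <= 1 -> 0 < G ->
    1 <= C -> 0 <= L -> L <= Rr -> 1 <= Rr -> 0 <= w0 -> w0 <= 1 / Rr ->
    1 <= N0 -> l0 <= 2 * N0 -> `|Z| + 2 * Rr + 2 * N0 <= 3 / 4 * K%:R ->
    0 < sg -> 192 * n.+2%:R * C ^+ 2 * N0 <= Rr * sg ^+ 2 ->
    \sum_(x | ball Z (2 * Rr) x && (G < `|v x - a|)) 1 <= N0 ->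
  forall w : site K -> R,
    (forall x, w x = Num.max (v x - (a + G) - 2 * (1 - cutoff Z (8 * Rr) x)) 0) ->
  n.+3%:R * \sum_x w x ^+ n.+2 * (\sum_y B x y * (v y - v x) - W x * v x) <=
    - (n.+3%:R / (8 * C * N0)) * \sum_x w x ^+ n.+3 +
    (24 * n.+3%:R * n.+2%:R * C / Rr * (N0 * sg ^+ n.+1) +
     2 * n.+3%:R * n.+2%:R * 2 ^+ n.+1 * L ^+ 2 / Rr ^+ 2 * ball_energy (fun x y _ => B x y) Z (3 * Rr) 0).
Proof.
move=> sB B0 up low W0 Ww v1 a1 G0 C1 L0 LR R1 w00 w0R N1 l0N bulk sg0 sgN count w wE'.
have R0 : 0 < Rr by exact: lt_le_trans R1.
have N00 : 0 < N0 by exact: lt_le_trans N1.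
have C0 : 0 < C by exact: lt_le_trans C1.
pose g (x : site K) : R := 2 * (1 - cutoff Z (8 * Rr) x).
have wE x : w x = Num.max (v x - (a + G) - g x) 0 by exact: wE'.
have w0' x : 0 <= w x by rewrite wE' le_max lexx orbT.
have w2 x : w x <= 2 by rewrite wE'; have [] := trunc_supp Z (v1 x) a1 G0 R0.
have wP x : w x != 0 -> ball Z (2 * Rr) x && (G < `|v x - a|).
  by rewrite wE'; have [] := trunc_supp Z (v1 x) a1 G0 R0.
have count' (P : pred (site K)) : \sum_(x | P x && (w x != 0)) 1 <= N0.
  apply: le_trans count; rewrite big_mkcond [X in _ <= X]big_mkcond; apply: ler_sum => x _.
  by case: ifPn => [/andP[_ /wP ->]//|_]; case: ifP.
have inB x d : ball Z (2 * Rr) x -> `|coord x| + d <= `|Z| + 2 * Rr + d.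
  rewrite /ball/= => h; rewrite lerD2r -[coord x](subrK Z) addrC.
  by apply: le_trans (ler_normD _ _) _; rewrite lerD2l.
have bulkx x : ball Z (2 * Rr) x -> `|coord x| <= 3 / 4 * K%:R.
  by move=> /(inB x 0); clear -bulk N1; lra.
pose p : R := n.+3%:R; pose k : R := n.+2%:R.
have p0 : 0 < p by rewrite ltr0n.
have k1 : 1 <= k by rewrite ler1n.
have lower x : w x != 0 -> 1 / (2 * C * N0) <= \sum_(y | w y == 0) B x y.
  move=> wx; have /andP[hx _] := wP x wx.
  pose D := ball (coord x) (2 * N0) : pred (site K).
  have N20 : 0 <= 2 * N0 by rewrite mulr_ge0// ltW.
  have cD : 2 * (2 * N0) - 1 <= \sum_(y | D y) (1 : R).
    have h := inB x (2 * N0) hx.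
    have c1 : coord x <= `|coord x| by exact: ler_norm.
    have c2 : - coord x <= `|coord x| by rewrite -normrN; exact: ler_norm.
    have K0 : (0 : R) <= K%:R by exact: ler0n.
    by apply: ball_card_ge => //; clear -h c1 c2 bulk K0; lra.
  have c0 : 2 * N0 <= \sum_(y | D y && (w y == 0)) (1 : R).
    rewrite (bigID (fun y => w y == 0))/= in cD.
    by have := count' D; clear -cD N1; lra.
  apply: (@le_trans _ _ (\sum_(y | D y && (w y == 0)) 1 / (C * (2 * N0) ^+ 2) * 1)).
    rewrite -big_distrr/=.
    have -> : 1 / (2 * C * N0) = 1 / (C * (2 * N0) ^+ 2) * (2 * N0).
      by field; rewrite !gt_eqF.
    apply: ler_wpM2l c0; apply: divr_ge0 => //.
    by apply: mulr_ge0; [exact: ltW|exact: sqr_ge0].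
  rewrite big_mkcond [X in _ <= X]big_mkcond; apply: ler_sum => y _.
  case: ifPn => [/andP[hy wy]|_]; last by case: ifP.
  rewrite wy mulr1.
  have hxy : `|coord x - coord y| <= 2 * N0 by move: hy; rewrite /D /ball/= distrC.
  have xy : x != y by apply: contra wx => /eqP ->.
  apply: low => //; first exact: bulkx.
  have := inB x (2 * N0) hx => h; apply: le_trans bulk; apply: le_trans h.
  rewrite -[coord y](subrK (coord x)) addrC; apply: le_trans (ler_normD _ _) _.
  by rewrite lerD2l distrC.
pose S x := \sum_(y | ball (coord x) Rr y && (y != x)) B x y.
(* Within Rr the slope 2 / Rr of the barrier yields 12 C / Rr; farther away its oscillation is at
   most 2 and the tail is 8 C / Rr, which yields 32 C / Rr. *)
have upper x : \sum_y B x y * (g x - g y) ^+ 2 <= 44 * (C / Rr) + 4 * (L ^+ 2 / Rr ^+ 2) * S x.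
  have gg y : g x - g y = 2 * (cutoff Z (8 * Rr) y - cutoff Z (8 * Rr) x) by rewrite /g; ring.
  have lipg y : `|g x - g y| <= 2 / Rr * `|coord x - coord y|.
    rewrite gg normrM (ger0_norm (ler0n R 2)) distrC.
    have R8 : 0 < 8 * Rr by rewrite mulr_gt0.
    apply: le_trans (ler_wpM2l (ler0n _ 2) (cutoff_lip Z x y R8)) _.
    by rewrite le_eqVlt; apply/orP; left; apply/eqP; field; rewrite gt_eqF.
  have g4 y : (g x - g y) ^+ 2 <= 4.
    have /andP[a1' a2] := cutoff_itv Z (8 * Rr) x; have /andP[b1 b2] := cutoff_itv Z (8 * Rr) y.
    rewrite gg; move: a1' a2 b1 b2; clear; move: (cutoff _ _ x) (cutoff _ _ y) => A A'.
    by nra.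
  rewrite (bigID (fun y => ball (coord x) Rr y))/=.
  have far : \sum_(y | ~~ ball (coord x) Rr y) B x y * (g x - g y) ^+ 2 <= 4 * (8 * C / Rr).
    apply: (@le_trans _ _ (\sum_(y | ~~ ball (coord x) Rr y) 4 * B x y)).
      by apply: ler_sum => y _; rewrite mulrC; apply: ler_wpM2r.
    rewrite -big_distrr/=; apply: ler_wpM2l => //.
    apply: (tail_le R1 LR (ltW C0) (up x)) => y.
    by rewrite /ball/= -ltNge distrC => /ltW.
  have near_ : \sum_(y | ball (coord x) Rr y) B x y * (g x - g y) ^+ 2 <=
      12 * (C / Rr) + 4 * (L ^+ 2 / Rr ^+ 2) * S x.
    rewrite (bigID (fun y => y == x))/= big1; last first.
      by move=> y /andP[_ /eqP ->]; rewrite subrr expr0n mulr0.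
    have k0 : 0 <= 2 / Rr by rewrite divr_ge0// ltW.
    have c3 : \sum_(y : site K | ball (coord x) Rr y) (1 : R) <= 3 * Rr.
      by apply: le_trans (ball_card_le _ (ltW R0)) _; clear -R1; lra.
    rewrite add0r; apply: le_trans (local_cutoff_le (ltW C0) L0 k0 (B0 x) (up x) lipg c3) _.
    by rewrite -/(S x) le_eqVlt; apply/orP; left; apply/eqP; field; rewrite gt_eqF.
  apply: le_trans (lerD near_ far) _.
  by rewrite le_eqVlt; apply/orP; left; apply/eqP; ring.
pose Y := \sum_x w x ^+ n.+3; pose V := \sum_x w x ^+ n.+1.
pose E := ball_energy (fun x y (_ : R) => B x y) Z (3 * Rr) 0.
have Slow : 1 / (2 * C * N0) * Y <= \sum_x w x ^+ n.+3 * \sum_(y | w y == 0) B x y.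
  rewrite /Y big_distrr/=; apply: ler_sum => x _.
  have [->|wx] := eqVneq (w x) 0; first by rewrite expr0n/= mulr0 mul0r.
  by rewrite mulrC; apply: ler_wpM2l (lower x wx); exact: exprn_ge0.
have Sup : \sum_x w x ^+ n.+1 * \sum_y B x y * (g x - g y) ^+ 2 <=
    44 * (C / Rr) * V + 2 ^+ n.+1 * (4 * (L ^+ 2 / Rr ^+ 2)) * E.
  have c4 : 0 <= 4 * (L ^+ 2 / Rr ^+ 2).
    by apply: mulr_ge0 => //; apply: divr_ge0; exact: sqr_ge0.
  have S0 x : 0 <= S x by exact: sumr_ge0.
  apply: (@le_trans _ _ (\sum_x (44 * (C / Rr) * w x ^+ n.+1 +
      2 ^+ n.+1 * (4 * (L ^+ 2 / Rr ^+ 2)) * (if ball Z (3 * Rr) x then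
        \sum_(y | ball Z (3 * Rr) y && (y != x)) B x y else 0)))).
    apply: ler_sum => x _.
    have [->|wx] := eqVneq (w x) 0.
      rewrite expr0n/= mul0r mulr0 add0r mulr_ge0//; first by rewrite mulr_ge0// exprn_ge0.
      by case: ifP => // _; exact: sumr_ge0.
    have /andP[hx _] := wP x wx.
    have hx3 : ball Z (3 * Rr) x.
      by move: hx; rewrite /ball/= => /le_trans; apply; clear -R0; lra.
    rewrite hx3.
    have Sx : S x <= \sum_(y | ball Z (3 * Rr) y && (y != x)) B x y.
      rewrite /S big_mkcond [X in _ <= X]big_mkcond; apply: ler_sum => y _.
      case: ifPn => [/andP[hy ->]|_]; last by case: ifP.
      rewrite andbT ifT//; move: hx hy; rewrite /ball/= => hx hy.
      by apply: le_trans (ler_distD (coord x) _ _) _; clear -hx hy; lra.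
    apply: le_trans (ler_wpM2l (exprn_ge0 _ (w0' x)) (upper x)) _.
    rewrite mulrDr mulrC lerD2l -[X in _ <= X]mulrA; apply: ler_pM.
    - exact: exprn_ge0.
    - exact: mulr_ge0.
    - by rewrite lerXn2r// nnegrE.
    - exact: ler_wpM2l.
  rewrite big_split/= -!big_distrr/= -/V lerD2l.
  by rewrite le_eqVlt; apply/orP; left; apply/eqP; congr (_ * _); rewrite /E /ball_energy [RHS]big_mkcond.
have Wpart : \sum_x w x ^+ n.+2 * (- (W x * v x)) <= 2 / Rr * V.
  rewrite /V big_distrr/=; apply: ler_sum => x _.
  have [->|wx] := eqVneq (w x) 0; first by rewrite !expr0n/= mul0r mulr0.
  have /andP[hx _] := wP x wx.
  have Wx : - (W x * v x) <= 1 / Rr.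
    apply: le_trans (ler_norm _) _; rewrite normrN normrM ger0_norm//.
    rewrite -[1 / Rr]mulr1; apply: ler_pM => //.
    by apply: le_trans (Ww x (bulkx x hx)) w0R.
  apply: le_trans (ler_wpM2l (exprn_ge0 _ (w0' x)) Wx) _.
  rewrite exprSr.
  have -> : 2 / Rr * w x ^+ n.+1 = w x ^+ n.+1 * 2 * (1 / Rr) by ring.
  apply: ler_wpM2r; first by rewrite divr_ge0// ltW.
  by apply: ler_wpM2l (w2 x); exact: exprn_ge0.
have Vle : V <= Y / sg ^+ 2 + N0 * sg ^+ n.+1.
  apply: (@le_trans _ _ (\sum_x (w x ^+ n.+3 / sg ^+ 2 + sg ^+ n.+1 * (if w x != 0 then 1 else 0)))).
    apply: ler_sum => x _; have [->|wx] := eqVneq (w x) 0.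
      by rewrite !expr0n/= mul0r mulr0 addr0.
    by rewrite mulr1; exact: expr_split_le.
  rewrite big_split/= -big_distrl/= -big_distrr/= -/Y lerD2l mulrC.
  apply: ler_wpM2r; first by apply: exprn_ge0; exact: ltW.
  by have := count' xpredT; rewrite [X in X <= _ -> _]big_mkcond.
have := trunc_energy_le n (b := a + G) wE sB B0.
under [X in _ -> _ * X <= _]eq_bigr => x _ do rewrite mulrDr.
rewrite big_split/= -/p -/k.
have Y0 : 0 <= Y by apply: sumr_ge0 => x _; exact: exprn_ge0.
have V0 : 0 <= V by apply: sumr_ge0 => x _; exact: exprn_ge0.
have p2 : 0 <= p / 2 by rewrite divr_ge0// ltW.
have pk : 0 <= p * k / 2 by rewrite divr_ge0// mulr_ge0// ?ltW// (lt_le_trans _ k1).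
have h1 := ler_wpM2l p2 Slow.
have h2 := ler_wpM2l pk Sup.
have h3 := ler_wpM2l (ltW p0) Wpart.
have kC : 1 <= k * C by rewrite mulr_ege1.
have pR : 0 <= p / Rr by rewrite divr_ge0// ltW.
have h4 : p * (2 / Rr * V) <= 2 * (p * k * C / Rr * V).
  have := ler_wpM2l (mulr_ge0 pR V0) kC.
  have -> : p / Rr * V * (k * C) = p * k * C / Rr * V by ring.
  move=> h; have -> : p * (2 / Rr * V) = 2 * (p / Rr * V * 1) by ring.
  by rewrite ler_pM2l.
have pkCR : 0 <= p * k * C / Rr.
  by apply: divr_ge0; [apply: mulr_ge0; [apply: mulr_ge0|]|]; rewrite ?(ltW p0) ?(ltW C0) ?(ltW R0)// (le_trans _ k1).
have h5 := ler_wpM2l pkCR Vle.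
(* The lower bound on sg is what lets half of the jump rate pay for the barrier and the killing. *)
have h6 : 24 * (p * k * C / Rr * (Y / sg ^+ 2)) <= p / (8 * C * N0) * Y.
  have -> : p / (8 * C * N0) * Y = p * Y / (8 * C * N0 * (Rr * sg ^+ 2)) * (Rr * sg ^+ 2).
    by field; rewrite !gt_eqF// !mulr_gt0// exprn_gt0.
  have -> : 24 * (p * k * C / Rr * (Y / sg ^+ 2)) =
     p * Y / (8 * C * N0 * (Rr * sg ^+ 2)) * (192 * k * C ^+ 2 * N0).
    by field; rewrite !gt_eqF// !mulr_gt0// exprn_gt0.
  apply: ler_wpM2l sgN; apply: divr_ge0; first by apply: mulr_ge0 => //; exact: ltW.
  by do ?apply: mulr_ge0 => //; rewrite ?(ltW C0) ?(ltW N00) ?(ltW R0) ?(ltW sg0).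
move=> HT; rewrite [p * (_ + _)]mulrDr mulNr.
have -> : 24 * p * k * C / Rr * (N0 * sg ^+ n.+1) = 24 * (p * k * C / Rr * (N0 * sg ^+ n.+1)).
  by ring.
apply: (combine _ _ h3 h4 _ h6 HT).
- by apply: le_trans h1; rewrite le_eqVlt; apply/orP; left; apply/eqP; field; rewrite !gt_eqF.
- apply: le_trans h2 _; rewrite -/E.
  by rewrite le_eqVlt; apply/orP; left; apply/eqP; field; rewrite gt_eqF.
- by rewrite -mulrDr.
Qed.

(** Gronwall's inequality for the sum of w^(n+3) on [-tau, 0], started from the crude bound 2^(n+3)
    N0. A single site is dominated by the sum, so smallness of the sum bounds each value, and on the
    inner ball the barrier is 0. Applied to -v it also gives the lower bound. *)
Lemma barrier (s C L l0 w0 H Z : R) (B : site K -> site K -> R -> R)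
    (W : site K -> R -> R) (v : R -> site K -> R) (F : flow s C L l0 w0 H Z B W v)
    n (a G N0 Rr sg tau : R) :
    `|a| <= 1 -> 0 < G -> 0 <= H ->
    1 <= C -> 0 <= L -> L <= Rr -> 1 <= Rr -> 0 <= w0 -> w0 <= 1 / Rr ->
    1 <= N0 -> l0 <= 2 * N0 -> `|Z| + 2 * Rr + 2 * N0 <= 3 / 4 * K%:R ->
    3 * Rr <= K%:R / 2 -> 0 <= tau -> tau <= s ->
    0 < sg -> 192 * n.+2%:R * C ^+ 2 * N0 <= Rr * sg ^+ 2 ->
    (forall t, - tau <= t <= 0 ->
      \sum_(x | ball Z (2 * Rr) x && (G < `|v t x - a|)) 1 <= N0) ->
    expR (- (n.+3%:R / (8 * C * N0)) * tau) * (2 ^+ n.+3 * N0) +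
    (24 * n.+3%:R * n.+2%:R * C / Rr * (N0 * sg ^+ n.+1) * tau +
     2 * n.+3%:R * n.+2%:R * 2 ^+ n.+1 * L ^+ 2 / Rr ^+ 2 * (H * (3 * Rr) * (1 + tau))) <= G ^+ n.+3 ->
  forall x, ball Z Rr x -> v 0 x - a <= 2 * G.
Proof.
move=> a1 G0 H0 C1 L0 LR R1 w00 w0R N1 l0N bulk RK tau0 taus sg0 sgN count fin x hx.
have R0 : 0 < Rr by exact: lt_le_trans R1.
have N00 : 0 < N0 by exact: lt_le_trans N1.
have C0 : 0 < C by exact: lt_le_trans C1.
pose g (x : site K) : R := 2 * (1 - cutoff Z (8 * Rr) x).
pose w t (x : site K) : R := Num.max (v t x - (a + G) - g x) 0.
pose Y t := \sum_x w t x ^+ n.+3.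
have w0' t y : 0 <= w t y by rewrite le_max lexx orbT.
have inT t : - tau <= t <= 0 -> - s <= t <= 0.
  by move=> /andP[h1 ->]; rewrite andbT; apply: le_trans h1; rewrite lerN2.
pose k1 := 24 * n.+3%:R * n.+2%:R * C / Rr * (N0 * sg ^+ n.+1).
pose k2 := 2 * n.+3%:R * n.+2%:R * 2 ^+ n.+1 * L ^+ 2 / Rr ^+ 2.
have pos2 m : 0 <= (2 : R) ^+ m by exact: exprn_ge0.
have k10 : 0 <= k1.
  apply: mulr_ge0; last by apply: mulr_ge0; [exact: ltW|apply: exprn_ge0; exact: ltW].
  by apply: divr_ge0; [do ?apply: mulr_ge0 => //; exact: ltW|exact: ltW].
have k20 : 0 <= k2.
  by apply: divr_ge0; [do ?apply: mulr_ge0 => //; exact: sqr_ge0|exact: sqr_ge0].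
have cw t y : {for t, continuous (fun t => w t y ^+ n.+3)}.
  apply: (@continuous_comp _ _ _ (fun t => v t y - (a + G) - g y) (fun z => Num.max z 0 ^+ n.+3)).
    by apply: continuousB; [apply: continuousB; [exact: (flow_cont F)|exact: cvg_cst]|exact: cvg_cst].
  apply/differentiable_continuous/derivable1_diffP.
  exact: (ex_derive (is_derive := is_derive_pospart n.+1 _)).
have HY : Y 0 <= expR (- (n.+3%:R / (8 * C * N0)) * (0 - - tau)) * Y (- tau) +
   (k1 * (0 - - tau) + k2 * (H * (3 * Rr) * (1 - - tau))).
  have ts0 : - s <= - tau <= 0 by apply: inT; rewrite lexx oppr_le0.
  have ntau : - tau <= 0 by rewrite oppr_le0.
  apply: (@gronwall_le R Y (fun t => k1 + k2 * ball_energy B Z (3 * Rr) t)) => //.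
  - by apply: divr_ge0 => //; apply: mulr_ge0; [exact: mulr_ge0 (ltW C0)|exact: ltW].
  - by move=> t _; apply: continuous_sum_at => y; exact: cw.
  - apply: measurable_funD => //; apply: measurable_funM => //.
    apply: measurable_funS (ball_energy_meas Z (3 * Rr) (flow_meas F)) => //.
  - move=> t /inT tt; rewrite addr_ge0// mulr_ge0//.
    exact: (ball_energy_ge0 _ _ (flow_ge0 F)).
  - move=> t tt.
    have tt' : - tau <= t <= 0 by case/andP: tt => h1 h2; rewrite !ltW.
    have ts := inT t tt'.
    have tso : - s < t < 0.
      by case/andP: tt => h1 ->; rewrite andbT; apply: le_lt_trans h1; rewrite lerN2.
    pose dv x := \sum_y B x y t * (v t y - v t x) - W x t * v t x.
    exists (n.+3%:R * \sum_x w t x ^+ n.+2 * dv x).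
      rewrite big_distrr; apply: is_derive_sum_at => y.
      have d1 := is_deriveB (is_deriveB (flow_derive F y tso) (is_derive_cst (a + G) t 1)) (is_derive_cst (g y) t 1).
      rewrite !subr0 in d1.
      have := is_derive1_comp (is_derive_pospart n.+1 _) d1.
      by rewrite /= -mulrA.
    have := @trunc_growth n (fun x y => B x y t) (fun x => W x t) (v t)
      a G C L Z N0 Rr w0 l0 sg (fun x y => flow_sym F x y ts) (fun x y => flow_ge0 F x y ts)
      (fun x y => @flow_up _ _ _ _ _ _ _ _ _ _ _ _ F x y t ts)
      (fun x y rr => @flow_low _ _ _ _ _ _ _ _ _ _ _ _ F x y t rr ts)
      (fun x => flow_W0 F x ts) (fun x => @flow_W _ _ _ _ _ _ _ _ _ _ _ _ F x t ts)
      (fun x => flow_bound F x t) a1 G0 C1 L0 LR R1 w00 w0R N1 l0N bulk sg0 sgN (count t tt') (w t) (fun x => erefl).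
    exact.
  - apply: integral_affine_le => //.
    + apply: measurable_funS (ball_energy_meas Z (3 * Rr) (flow_meas F)) => //.
      + by move=> t /inT tt; exact: (ball_energy_ge0 _ _ (flow_ge0 F)).
    + by apply: (flow_budget F) => //; clear -R1; lra.
have Ytau : Y (- tau) <= 2 ^+ n.+3 * N0.
  apply: le_trans (trunc_moment_le _ (flow_bound F ^~ (- tau)) a1 G0 R0 _) _ => //.
  by apply: ler_wpM2l => //; apply: count; rewrite lexx oppr_le0.
have hY : w 0 x ^+ n.+3 <= G ^+ n.+3.
  apply: le_trans fin.
  have := ler_wpM2l (expR_ge0 (- (n.+3%:R / (8 * C * N0)) * tau)) Ytau.
  move: HY; rewrite sub0r opprK -/k1 -/k2.
  have : w 0 x ^+ n.+3 <= Y 0.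
    rewrite /Y (bigD1 x)//= lerDl; apply: sumr_ge0 => y _; exact: exprn_ge0.
  move: (w 0 x ^+ n.+3) (Y 0) (expR _) (Y (- tau)); clear => A1 A2 A3 A4; lra.
have wG : w 0 x <= G by move: hY; rewrite ler_pXn2r// nnegrE ?w0' ?(ltW G0).
have gx : g x = 0.
  rewrite /g cutoff1 ?subrr ?mulr0//; first by rewrite mulr_gt0.
  by move: hx; rewrite /ball/= => /le_trans; apply; clear -R0; lra.
have : v 0 x - (a + G) - g x <= G by apply: le_trans wG; rewrite le_max lexx.
by rewrite gx; clear; lra.
Qed.

End Truncation.

(** * Few sites are far from the level, at every time close to 0 *)

Section Concentration.
Context {R : realType} {K : nat}.
Local Notation mu := (@lebesgue_measure R).
Local Notation coord := (@coord R K).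
Implicit Types (B : site K -> site K -> R -> R) (W : site K -> R -> R) (v : R -> site K -> R).

(* Double counting of the pairs (j, x) with x in A and |x - j| <= r. *)
Lemma covering_count (Z Rr r N : R) (A : pred (site K)) :
    2 <= r -> r <= 2 * Rr -> `|Z| + 2 * Rr <= K%:R ->
    (forall j, ball Z (2 * Rr) j ->
      \sum_(x | ball (coord j) r x && A x) 1 <= 3 * r * N) -> 0 <= N ->
  \sum_(x | ball Z (2 * Rr) x && A x) 1 <= 30 * Rr * N.
Proof.
move=> r2 rR bulk H N0.
have R1 : 1 <= Rr by clear -r2 rR; lra.
have r0 : 0 < r by clear -r2; lra.
pose D : pred (site K) := ball Z (2 * Rr).
have inner x : D x -> r / 2 <= \sum_(j | D j && ball (coord j) r x) 1.
  move=> hx.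
  have z1 : Z <= `|Z| by exact: ler_norm.
  have z2 : - Z <= `|Z| by rewrite -normrN; exact: ler_norm.
  move: (hx); rewrite /D /ball/= ler_distl => /andP[x1 x2].
  (* The interval of centres extends from x towards Z, so that a site at the edge of the ball has
     enough of them too. *)
  have [l [lx1 lx2 l1 l2]] : exists l, [/\ l <= coord x, coord x <= l + r,
      Z - 2 * Rr <= l & l + r <= Z + 2 * Rr].
    have [h|h] := leP Z (coord x).
      by exists (coord x - r); split; clear -x1 x2 h rR r0; lra.
    by exists (coord x); split; clear -x1 x2 h rR r0; lra.
  have h1 : - K%:R <= l by clear -l1 z2 bulk; lra.
  have h2 : l <= l + r by clear -r0; lra.
  have h3 : l + r <= K%:R by clear -l2 z1 bulk; lra.
  apply: (@le_trans _ _ (l + r - l - 1)); first by clear -r2; lra.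
  apply: le_trans (card_coord_ge h1 h2 h3) _.
  rewrite -sum1_card natr_sum big_mkcond [X in _ <= X]big_mkcond/=.
  apply: ler_sum => j _; rewrite inE; case: ifPn => [/andP[j1 j2]|_]; last by case: ifP.
  rewrite ifT//; apply/andP; split; rewrite ?/D /ball/= ler_distl; apply/andP; split; clear -j1 j2 l1 l2 lx1 lx2; lra.
have cD : \sum_(j | D j) (1 : R) <= 5 * Rr.
  have R20 : 0 <= 2 * Rr by clear -R1; lra.
  by apply: le_trans (ball_card_le Z R20) _; clear -R1; lra.
have r20 : 0 < r / 2 by rewrite divr_gt0.
rewrite -(ler_pM2l r20) big_distrr/=.
apply: (@le_trans _ _ (\sum_(x | D x && A x) \sum_(j | D j && ball (coord j) r x) 1)).
  by apply: ler_sum => x /andP[hx _]; rewrite mulr1; exact: inner.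
rewrite (exchange_big_dep D)/=; last by move=> x j _ /andP[].
apply: (@le_trans _ _ (\sum_(j | D j) (3 * r * N * 1))).
  apply: ler_sum => j hj; rewrite mulr1; apply: le_trans (H j hj).
  rewrite big_mkcond [X in _ <= X]big_mkcond; apply: ler_sum => x _.
  case: ifPn => [/andP[/andP[_ ->] /andP[_ ->]]//|_]; by case: ifP.
rewrite -big_distrr/=.
have c0 : 0 <= 3 * r * N by rewrite mulr_ge0// mulr_ge0// ltW.
apply: le_trans (ler_wpM2l c0 cD) _.
by rewrite le_eqVlt; apply/orP; left; apply/eqP; field.
Qed.

(** After k scales around Z at time 0 the level a is fixed. One more step moves the centre to any
    site j of the ball of radius 2 Rr and the end time to any t, and m - 1 further scales follow
    there. At the last radius a proportion of order 2^-m of the sites near j is bad, and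
    [covering_count] adds up over j. The levels reached are within e0 q^k / (1 - q) of a, which
    explains the threshold. *)
Lemma concentrate (s C L l0 w0 H Z : R) B W v (F : flow s C L l0 w0 H Z B W v)
    n (Lam Ups q e0 Rr tau : R) (k m : nat) : odd n ->
    1 <= C -> 1 <= Lam -> 0 < q -> q < 1 -> q ^+ n.+1 = 2^-1 -> e0 = 6 / (C * Lam) ->
    0 <= Ups -> 3328 * (C / n.+1%:R) + 256 * (C * e0) <= 7 * Ups ->
    expR (- (7 / 64 * (n.+1%:R / (C * Lam)))) <= 100^-1 ->
    growth_const n C Ups e0 <= Lam / 100 ->
    0 <= L -> 0 <= w0 -> 0 <= H -> 0 < s -> 0 < Rr -> (0 < m)%N ->
    let r0 := Lam * s in let rho := r0 / 16 ^+ k in let re := r0 / 16 ^+ (k + m) in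
    `|Z| + 2 * r0 <= 3 / 4 * K%:R -> 2 * r0 <= K%:R / 2 ->
    16 * Rr <= rho -> re <= 2 * Rr ->
    32 <= re -> L <= re / 32 -> l0 <= 2 * re ->
    100 * (768 * (2 ^+ n.+1 * L ^+ 2 * H * rho ^+ 2)) <= re ^+ 3 * 2 ^- (k + m) ->
    300 * (r0 * n.+1%:R * 2 ^+ n * w0) <= 1 ->
    0 <= tau -> tau <= rho / (2 * Lam) ->
  exists2 a, `|a| <= 1 & forall t, - tau <= t <= 0 ->
    \sum_(x | ball Z (2 * Rr) x && ((e0 / (1 - q) + 1) * q ^+ k < `|v t x - a|)) 1 <=
      30 * Rr * 2 ^- m.
Proof.
move=> on C1 Lam1 q0 q1 qn e0E U0 HU Hexp HG L0 w00 H0 s0 R0 m0 r0 rho re bulk bulk2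
  Rrho' reR' re32' Lre' lre' SS' WW tau0 taur'.
have L_gt0 : 0 < Lam by exact: lt_le_trans Lam1.
have r0_gt0 : 0 < r0 by rewrite mulr_gt0.
have r0L : r0 / Lam = s by rewrite /r0 mulrC mulKf// gt_eqF.
have X16 i : 0 < (16 : R) ^+ i by exact: exprn_gt0.
pose rr i := r0 / 16 ^+ i.
have Rrho : 16 * Rr <= rr k := Rrho'.
have reR : rr (k + m)%N <= 2 * Rr := reR'.
have re32 : 32 <= rr (k + m)%N := re32'.
have Lre : L <= rr (k + m)%N / 32 := Lre'.
have lre : l0 <= 2 * rr (k + m)%N := lre'.
have SS : 100 * (768 * (2 ^+ n.+1 * L ^+ 2 * H * rr k ^+ 2)) <= rr (k + m)%N ^+ 3 * 2 ^- (k + m) := SS'.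
have taur : tau <= rr k / (2 * Lam) := taur'.
move: Rrho' reR' re32' Lre' lre' SS' taur' => _ _ _ _ _ _ _.
clear rho re; clearbody r0.
have rr_0 : rr 0%N = r0 by rewrite /rr expr0 divr1.
have rr0 i : 0 < rr i by rewrite divr_gt0.
have rrD i j : rr (i + j)%N = rr i / 16 ^+ j by rewrite /rr exprD invfM mulrA.
have rrmono i j : (i <= j)%N -> rr j <= rr i.
  move=> ij; rewrite -(subnKC ij) rrD ler_pdivrMr//; apply: ler_peMr; first exact: ltW.
  by apply: exprn_ege1; rewrite ler1n.
have qX i : (q ^+ i) ^+ n.+1 = 2 ^- i by rewrite exprAC qn exprVn.
have H2 i : 0 < (2 : R) ^- i by rewrite invr_gt0 exprn_gt0.
have H2mono i j : (i <= j)%N -> (2 : R) ^- j <= 2 ^- i.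
  by move=> ij; rewrite lef_pV2 ?posrE ?exprn_gt0// ler_weXn2l// ler1n.
pose A0 := 2 ^+ n.+1 * L ^+ 2 * H.
have A00 : 0 <= A0 by rewrite mulr_ge0// mulr_ge0 ?exprn_ge0.
have WWi i : 3 * rr i * n.+1%:R * 2 ^+ n * w0 <= (q ^+ i) ^+ n.+1 / 100.
  rewrite qX /rr.
  have h : (16 : R) ^- i <= 2 ^- i.
    by rewrite lef_pV2 ?posrE ?exprn_gt0// lerXn2r ?nnegrE// ler_nat.
  have z0 : 0 <= r0 * n.+1%:R * 2 ^+ n * w0.
    by apply: mulr_ge0 => //; apply: mulr_ge0; [apply: mulr_ge0 => //; exact: ltW|exact: exprn_ge0].
  have -> : 3 * (r0 / 16 ^+ i) * n.+1%:R * 2 ^+ n * w0 =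
     3 * (r0 * n.+1%:R * 2 ^+ n * w0) * 16 ^- i by ring.
  apply: (@le_trans _ _ (3 * (r0 * n.+1%:R * 2 ^+ n * w0) * 2 ^- i)).
    by apply: ler_wpM2l => //; exact: mulr_ge0.
  rewrite [X in _ <= X]mulrC; apply: ler_wpM2r; first exact: ltW.
  by move: WW; clear; move: (_ * w0) => z; lra.
have geo i : (i < k + m)%N -> [/\ 32 <= rr i, L <= rr i / 32 & l0 <= 2 * rr i].
  move=> /ltnW /rrmono h.
  by split; [move: re32|move: Lre|move: lre]; move: h; clear; move: (rr (k + m)%N) (rr i) => *; lra.
have SSgen i (X M : R) : M <= 6 * (H * X ^+ 2) ->
    100 * (768 * (A0 * X ^+ 2)) <= rr i ^+ 3 * 2 ^- i ->
    128 * 2 ^+ n.+1 * L ^+ 2 * M <= rr i ^+ 3 * (q ^+ i) ^+ n.+1 / 100.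
  move=> HM HX; rewrite qX ler_pdivlMr//.
  have P0 : 0 <= 2 ^+ n.+1 * L ^+ 2 :> R by rewrite mulr_ge0 ?exprn_ge0.
  have := ler_wpM2l P0 HM; move: HX.
  have -> : 2 ^+ n.+1 * L ^+ 2 * (6 * (H * X ^+ 2)) = 6 * (A0 * X ^+ 2) by rewrite /A0; ring.
  have -> : 128 * 2 ^+ n.+1 * L ^+ 2 * M = 128 * (2 ^+ n.+1 * L ^+ 2 * M) by ring.
  by move: (2 ^+ n.+1 * L ^+ 2 * M) (A0 * X ^+ 2) (rr i ^+ 3 * _) => y1 y2 y3; clear => *; lra.
have rho0 : 0 < rr k by exact: rr0.
(* Once the centre has left Z, the energy is estimated in a window of radius 2 rr k around Z: hence
   the square of the large radius against the cube of the current one. The last scale is the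
   worst. *)
have SS2 i : (i <= k + m)%N -> 100 * (768 * (A0 * rr k ^+ 2)) <= rr i ^+ 3 * 2 ^- i.
  move=> ik; apply: le_trans SS _.
  apply: ler_pM; [by apply: exprn_ge0; exact: ltW|exact: ltW| |exact: H2mono].
  by apply: lerXn2r; rewrite ?nnegrE; [exact: ltW|exact: ltW|exact: rrmono].
(* For windows centred at Z the condition amounts to an upper bound on A0 by a multiple of rr i /
   2^i, which weakens as i decreases. *)
have SS1 i : (i <= k)%N -> 100 * (768 * (A0 * rr i ^+ 2)) <= rr i ^+ 3 * 2 ^- i.
  move=> ik; have := SS2 k (leq_addr _ _).
  have rk2 : 0 < rr k ^+ 2 by rewrite exprn_gt0.
  have ri2 : 0 < rr i ^+ 2 by rewrite exprn_gt0.
  have -> : 100 * (768 * (A0 * rr k ^+ 2)) = 100 * (768 * A0) * rr k ^+ 2 by ring.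
  have -> : rr k ^+ 3 * 2 ^- k = rr k * 2 ^- k * rr k ^+ 2 by rewrite /rr; ring.
  have -> : 100 * (768 * (A0 * rr i ^+ 2)) = 100 * (768 * A0) * rr i ^+ 2 by ring.
  have -> : rr i ^+ 3 * 2 ^- i = rr i * 2 ^- i * rr i ^+ 2 by ring.
  rewrite !ler_pM2r// => /le_trans; apply.
  by apply: ler_pM; [exact: ltW|exact: ltW|exact: rrmono|exact: H2mono].
(* At the top scale r0 / Lam = s is the whole time interval. With level 0 and height 1, |v| <= 1
   bounds the moment by the number of sites and makes the tail excess vanish. *)
have inv0 : invar n Lam Ups Z 0 0 r0 1 B v.
  split; first by rewrite normr0.
  move=> t _; split.
    apply: (@le_trans _ _ (\sum_(x : site K | ball Z r0 x) (1 : R))).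
      apply: ler_sum => x _; rewrite subr0; apply: le_trans (ler_norm _) _.
      by rewrite normrX exprn_ile1//; exact: (flow_bound F).
    apply: le_trans (ball_card_le Z (ltW r0_gt0)) _; rewrite expr1n mulr1.
    have := rrmono 0%N (k + m)%N (leq0n _); rewrite rr_0.
    by move: re32; clear; move: (rr (k + m)%N) => e'; lra.
  move=> x _; rewrite big1; last first.
    move=> y _; rewrite subr0 max_r ?mulr0// subr_le0; exact: (flow_bound F).
  by rewrite mulr_ge0// divr_ge0// ltW.
have rr1 i : (i <= k + m)%N -> 1 <= rr i.
  by move=> /rrmono; move: re32; clear; move: (rr (k + m)%N) (rr i) => *; lra.
have rri0 i : rr i <= r0 by have := rrmono 0%N i (leq0n _); rewrite rr_0.
have divL (y : R) : 0 <= y -> y / Lam <= y.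
  by move=> y0; rewrite ler_pdivrMr// ler_peMr.
have Zb (y : R) : y <= r0 -> `|Z| + y <= 3 / 4 * K%:R.
  by move: bulk r0_gt0; clear; move: (r0) => *; lra.
have [a _ inv1] : exists2 a', `|a' - 0| * (1 - q) <= e0 * 1 * (1 - q ^+ k) &
    invar n Lam Ups Z 0 a' (r0 / 16 ^+ k) (1 * q ^+ k) B v.
  apply: (invar_iter F (MS := fun i => 6 * (H * rr i ^+ 2)) on C1 Lam1 q0 (ltW q1) qn e0E U0
    HU Hexp HG L0 w00 ltr01 r0_gt0 _ (lexx 0)) => //.
  - exact: Zb.
  - by rewrite sub0r r0L.
  move=> i ik /=; rewrite mul1r -/(rr i).
  have ikm : (i < k + m)%N by rewrite (leq_trans ik)// leq_addr.
  have [g1 g2 g3] := geo i ikm; split => //.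
    have h1 := rr1 i (ltnW ikm).
    apply: le_trans (flow_budget_ball F (M := rr i) H0 _ h1 _ _ _ _) _ => //.
    - by rewrite subrr normr0 add0r.
    - by apply: le_trans bulk2; move: (rri0 i) r0_gt0; clear; move: (r0) => *; lra.
    - by rewrite sub0r -r0L lerN2 ler_pM2r ?invr_gt0.
    - by rewrite sub0r oppr_le0 divr_ge0// ltW.
    rewrite lee_fin sub0r opprK -mulrA.
    have -> : 6 * (H * rr i ^+ 2) = H * (rr i * (6 * rr i)) by ring.
    apply: ler_wpM2l => //; apply: ler_wpM2l; first exact: ltW.
    by have := divL _ (ltW (rr0 i)); move: h1; clear; move: (rr i / Lam) => *; lra.
  split; last exact: WWi.
  exact: SSgen (lexx _) (SS1 i (ltnW ik)).
rewrite mul1r -/(rr k) in inv1.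
exists a; first by case: inv1.
move=> t /andP[tt1 tt2].
have re2 : 2 <= rr (k + m)%N by move: re32; clear; move: (rr (k + m)%N) => *; lra.
apply: (covering_count (N := 2 ^- m)
  (A := fun x => (e0 / (1 - q) + 1) * q ^+ k < `|v t x - a|) re2 reR) => //.
  apply: le_trans (_ : 3 / 4 * K%:R <= _); last by have := ler0n R K; clear; lra.
  by apply: Zb; have := rri0 k; move: Rrho R0; clear; move: (rr k) (r0) => *; lra.
move=> j hj.
have kkm : (k < k + m)%N by rewrite -[X in (X < _)%N]addn0 ltn_add2l.
have [g1 g2 g3] := geo k kkm.
have rho16 : rr k.+1 = rr k / 16 by rewrite -addn1 rrD expr1.
have jZ : `|coord j| + rr k <= 3 / 4 * K%:R.
  apply: le_trans (_ : `|Z| + (2 * Rr + rr k) <= _).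
    rewrite addrA lerD2r -[coord j](subrK Z).
    by apply: le_trans (ler_normD _ _) _; rewrite [X in _ <= X]addrC lerD2r.
  apply: le_trans bulk; rewrite lerD2l.
  have := rri0 k; move: Rrho R0; clear; move: (rr k) (r0) => *; lra.
have e01 : e0 = e0 by [].
have jr : `|coord j - Z| <= rr k / 4.
  move: hj; rewrite /ball/= => /le_trans; apply.
  by move: Rrho R0; clear; move: (rr k) => *; lra.
have teL : 0 - rr k / (2 * Lam) <= t.
  by rewrite sub0r; apply: le_trans tt1; rewrite lerN2.
have sk : - s <= 0 - rr k / Lam.
  by rewrite sub0r -r0L lerN2 ler_pM2r ?invr_gt0.
have wk : 0 < q ^+ k by exact: exprn_gt0.
have k1 : 1 <= rr k by exact: rr1 (ltnW kkm).
have Hb1 : (\int[mu]_(u in `[(0 - rr k / Lam)%R, 0%R]) (ball_energy B Z (rr k) u)%:E <=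
    (6 * (H * rr k ^+ 2))%:E)%E.
  apply: le_trans (flow_budget_ball F (M := rr k) H0 _ k1 _ _ _ _) _ => //.
  - by rewrite subrr normr0 add0r.
  - by apply: le_trans bulk2; move: (rri0 k) r0_gt0; clear; move: (r0) => *; lra.
  - by rewrite sub0r oppr_le0 divr_ge0// ltW.
  rewrite lee_fin sub0r opprK -mulrA.
  have -> : 6 * (H * rr k ^+ 2) = H * (rr k * (6 * rr k)) by ring.
  apply: ler_wpM2l => //; apply: ler_wpM2l; first exact: ltW.
  by have := divL _ (ltW (rr0 k)); move: k1; clear; move: (rr k / Lam) => *; lra.
have [a1 a1a inv2] := invar_step F on C1 Lam1 (ltW q0) (ltW q1) qn e0E U0 HU Hexp HG g1 L0 g2 g3 w00
  wk (Zb _ (rri0 k)) jr teL tt2 (lexx 0) sk Hb1 (SSgen k (rr k) _ (lexx _) (SS2 k (ltnW kkm))) (WWi k) inv1.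
have mE : m = m.-1.+1 by rewrite prednK.
have wq : 0 < q ^+ k * q by rewrite mulr_gt0.
have rho160 : 0 < rr k / 16 by rewrite divr_gt0.
have [a2 a2a inv3] : exists2 a', `|a' - a1| * (1 - q) <= e0 * (q ^+ k * q) * (1 - q ^+ m.-1) &
    invar n Lam Ups (coord j) t a' (rr k / 16 / 16 ^+ m.-1) (q ^+ k * q * q ^+ m.-1) B v.
  apply: (invar_iter F (MS := fun i => 6 * (H * rr k ^+ 2)) on C1 Lam1 q0 (ltW q1) qn e0E U0
    HU Hexp HG L0 w00 wq rho160 _ tt2) => //.
  - apply: le_trans jZ; rewrite lerD2l -rho16.
    by have := rrmono k k.+1 (leqnSn k).
  - apply: le_trans sk _; rewrite -rho16.
    have h2 : rr k.+1 / Lam = rr k / Lam / 16 by rewrite rho16; ring.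
    have h3 : rr k / (2 * Lam) = rr k / Lam / 2 by rewrite invfM; ring.
    have h4 : 0 < rr k / Lam by rewrite divr_gt0.
    by move: teL h4; rewrite h2 h3; clear; move: (rr k / Lam) => *; lra.
  move=> i im.
  have ikm : (k.+1 + i < k + m)%N by rewrite addSnnS ltn_add2l mE ltnS.
  have riE : rr k / 16 / 16 ^+ i = rr (k.+1 + i)%N by rewrite rrD rho16.
  have wiE : q ^+ k * q * q ^+ i = q ^+ (k.+1 + i) by rewrite exprD exprSr.
  rewrite riE wiE /=.
  have [f1 f2 f3] := geo _ ikm; split => //.
    have c1 : 1 <= 2 * rr k.
      by move: k1; clear; move: (rr k) => *; lra.
    have t1 : - (2 * rr k) <= t - rr (k.+1 + i)%N / Lam.
      have h1 := divL _ (ltW (rr0 (k.+1 + i))).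
      have h2 := rrmono k (k.+1 + i)%N ltac:(by rewrite addSnnS leq_addr).
      have h3 : rr k / (2 * Lam) <= rr k.
        rewrite ler_pdivrMr ?mulr_gt0//; apply: ler_peMr; first exact: ltW.
        by move: Lam1; clear; lra.
      by move: teL h1 h2 h3; clear; move: (rr k / (2 * Lam)) (rr k) (rr (k.+1 + i)%N) (rr (k.+1 + i)%N / Lam) => *; lra.
    apply: le_trans (flow_budget_ball F (M := 2 * rr k) H0 _ c1 _ _ _ _) _ => //.
    - have h2 := rrmono k (k.+1 + i)%N ltac:(by rewrite addSnnS leq_addr).
      by move: jr h2; move: (rr0 k); clear; move: (rr k) (rr (k.+1 + i)%N) => *; lra.
    - by apply: le_trans bulk2; rewrite ler_pM2l//; exact: rri0.
    - apply: le_trans sk _.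
      have h1 : rr (k.+1 + i)%N / Lam <= rr k.+1 / Lam.
        by rewrite ler_pM2r ?invr_gt0//; apply: rrmono; exact: leq_addr.
      have h2 : rr k.+1 / Lam = rr k / Lam / 16 by rewrite rho16; ring.
      have h3 : rr k / (2 * Lam) = rr k / Lam / 2 by rewrite invfM; ring.
      have h4 : 0 < rr k / Lam by rewrite divr_gt0.
      move: teL h1 h4; rewrite h2 h3; clear; move: (rr k / Lam) => *; lra.
    - by rewrite gerBl divr_ge0// ltW.
    rewrite lee_fin.
    have -> : 6 * (H * rr k ^+ 2) = H * (2 * rr k) * (3 * rr k) by ring.
    apply: ler_wpM2l; first by rewrite mulr_ge0// mulr_ge0// ltW.
    by move: t1 k1; clear; move: (rr k) (rr (k.+1 + i)%N / Lam) => *; lra.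
  split; last exact: WWi.
  exact: SSgen (lexx _) (SS2 _ (ltnW ikm)).
have reE : rr k / 16 / 16 ^+ m.-1 = rr (k + m)%N.
  by rewrite -rho16 -rrD addSnnS -mE.
have weE : q ^+ k * q * q ^+ m.-1 = q ^+ (k + m) by rewrite -exprSr -exprD addSnnS -mE.
rewrite reE weE in inv3.
have q10 : 0 < 1 - q by rewrite subr_gt0.
have re0 : 0 <= rr (k + m)%N by exact: ltW.
have := @invar_count _ _ _ _ _ _ _ _ a _ _ _ _ _ on wk re0 (ltW L_gt0) inv3.
have -> : (q ^+ (k + m) / q ^+ k) ^+ n.+1 = 2 ^- m.
  by rewrite exprD mulrC mulKf ?qX// gt_eqF.
apply: le_trans; rewrite big_mkcond [X in _ <= X]big_mkcond; apply: ler_sum => x _.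
case: ifPn => [/andP[-> h]|_]; last by case: ifP.
rewrite ifT//; apply: le_lt_trans h.
rewrite mulrDl mul1r lerD2r.
have -> : a2 - a = (a2 - a1) + (a1 - a) by ring.
apply: le_trans (ler_normD _ _) _.
rewrite -(ler_pM2r q10) mulrDl.
have -> : e0 / (1 - q) * q ^+ k * (1 - q) = e0 * q ^+ k by field; rewrite gt_eqF.
have := ler_wpM2r (ltW q10) a1a.
have h1 : e0 * (q ^+ k * q) * (1 - q ^+ m.-1) <= e0 * q ^+ k * q.
  rewrite -mulrA -[X in _ <= X]mulrA; apply: ler_wpM2l.
    by rewrite e0E divr_ge0// mulr_ge0 ?(ltW L_gt0)// (le_trans _ C1).
  by rewrite ler_piMr ?(ltW wq)// gerBl exprn_ge0// ltW.
by move: a2a h1; clear; move: (`|_| * _) (`|a1 - a| * _) (e0 * q ^+ k) => y1 y2 y3; lra.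
Qed.

End Concentration.

(** * Choice of the constants and the numerical estimates *)

Section Constants.
Context {R : realType}.

Lemma expr_div_le_expR (y : R) M : (0 < M)%N -> 0 <= y -> (y / M%:R) ^+ M <= expR y.
Proof.
move=> M0 y0.
have -> : expR y = expR (y / M%:R) ^+ M.
  by rewrite -expRM_natl mulrCA divff ?mulr1// pnatr_eq0 -lt0n.
have h : 0 <= y / M%:R by rewrite divr_ge0.
apply: lerXn2r; rewrite ?nnegrE ?expR_ge0//.
by apply: le_trans (expR_ge1Dx _); rewrite lerDr.
Qed.

(** exp(5/32) >= 37/32 is squared five times, rounding down each time. *)
Lemma expRN5_le (x : R) : 5 <= x -> expR (- x) <= 100^-1.
Proof.
move=> x5; rewrite expRN lef_pV2 ?posrE ?expR_gt0//.
apply: le_trans (_ : expR 5 <= _); last by rewrite ler_expR.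
have -> : expR 5 = expR (5 / 32) ^+ 32 :> R.
  by rewrite -expRM_natl; congr expR; field.
have h1 : 37 / 32 <= expR (5 / 32) :> R.
  by apply: le_trans (expR_ge1Dx _); lra.
move: (expR _) h1 => a a1.
have sq (b c d : R) : 0 <= c -> c <= b -> d <= c * c -> d <= b * b.
  by move=> c0 cb dc; apply: le_trans dc _; apply: ler_pM.
rewrite (_ : a ^+ 32 = ((((a * a) * (a * a)) * ((a * a) * (a * a))) * (((a * a) * (a * a)) * ((a * a) * (a * a)))) * ((((a * a) * (a * a)) * ((a * a) * (a * a))) * (((a * a) * (a * a)) * ((a * a) * (a * a))))); last by ring.
have a2 : 1336 / 1000 <= a * a by apply: (sq _ _ _ _ a1); lra.
move: (a * a) a2 => b b1.
have b2 : 1784 / 1000 <= b * b by apply: (sq _ _ _ _ b1); lra.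
move: (b * b) b2 => c c1.
have c2 : 318 / 100 <= c * c by apply: (sq _ _ _ _ c1); lra.
move: (c * c) c2 => d d1.
have d2 : 101 / 10 <= d * d by apply: (sq _ _ _ _ d1); lra.
by apply: (sq _ _ _ _ d2); lra.
Qed.

(* n.+1 is of order C Lam: large enough for the contraction over one scale, and
   small enough for growth_const to be bounded independently of Lam. *)
Lemma scale_constants (C : R) (N : nat) : 1 <= C ->
  exists (n : nat) (Lam Ups q : R),
    [/\ odd n, (N <= n.+1)%N, 256 <= Lam, 0 < q < 1 & q ^+ n.+1 = 2^-1] /\
    [/\ 0 <= Ups,
        3328 * (C / n.+1%:R) + 256 * (C * (6 / (C * Lam))) <= 7 * Ups,
        expR (- (7 / 64 * (n.+1%:R / (C * Lam)))) <= 100^-1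
      & growth_const n C Ups (6 / (C * Lam)) <= Lam / 100].
Proof.
move=> C1.
have C0 : 0 < C by apply: lt_le_trans C1.
(* [E] bounds (1 + e0)^p because p e0 <= 300, and [g] then bounds [growth_const] before [Lam] is
   chosen; 173 hundreds are 500 + 56 times 300. *)
pose E : R := expR (3 * 100).
have E1 : 1 <= E by rewrite -(expR0 R) ler_expR mulr_ge0.
pose g : R := C * (384 * (3 * E) + 48 + 173 * 100 * (3 * E + 3)).
pose Lam : R := 256 + N%:R + 100 * g.
have g0 : 0 <= g.
  by rewrite /g; apply: mulr_ge0; [exact: ltW|move: E1; clear; move: E => *; lra].
have NN : 0 <= N%:R :> R by exact: ler0n.
have Lam256 : 256 <= Lam by rewrite /Lam; move: g0 NN; clear; move: g (N%:R) => *; lra.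
have LamN : N%:R <= Lam by rewrite /Lam; move: g0; clear; move: g (N%:R) => *; lra.
have gL : g <= Lam / 100 by rewrite /Lam; move: g0 NN; clear; move: g (N%:R) => *; lra.
have gE : g = C * (384 * (3 * E) + 48 + 173 * 100 * (3 * E + 3)) by [].
clear NN; clearbody Lam g.
have Lam0 : 0 < Lam by move: Lam256; clear; lra.
have CL : Lam <= C * Lam by rewrite ler_peMl// ltW.
have CL0 : 0 < C * Lam by rewrite mulr_gt0.
(* The even number p = 2 (h + 1) lies between 46 C Lam and 50 C Lam, and 46 times 7/64 exceeds 5. *)
pose h := Num.truncn (23 * (C * Lam)).
have h0 : 0 <= 23 * (C * Lam) by rewrite mulr_ge0// ltW.
have /andP[h1 h2] := truncn_itv h0; rewrite -/h in h1 h2.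
pose n := (h.*2).+1.
have p1 : 46 * (C * Lam) <= n.+1%:R.
  have -> : n.+1%:R = 2 * h.+1%:R :> R by rewrite /n -doubleS -mul2n natrM.
  by move: h2; clear; move: (C * Lam) (h.+1%:R) => *; lra.
have p2 : n.+1%:R <= 50 * (C * Lam).
  have -> : n.+1%:R = 2 * h%:R + 2 :> R by rewrite /n -doubleS -mul2n natrM -natr1; ring.
  by move: h1 CL Lam256; clear; move: (C * Lam) (h%:R) => *; lra.
have on : odd n by rewrite /n /= odd_double.
have Nn : (N <= n.+1)%N.
  rewrite -(ler_nat R); apply: le_trans LamN _; apply: le_trans p1.
  by move: CL Lam0; clear; move: (C * Lam) => *; lra.
clearbody n.
have p0 : 0 < n.+1%:R :> R by exact: ltr0Sn.
set p : R := n.+1%:R in p0 p1 p2 *.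
pose e0 := 6 / (C * Lam).
have e00 : 0 <= e0 by rewrite divr_ge0// ltW.
have pe : p * e0 <= 3 * 100.
  rewrite /e0 mulrA ler_pdivrMr//.
  by move: p2; clear; move: (C * Lam) p => *; lra.
have a1 : 0 <= C / p by rewrite divr_ge0// ltW.
have a2 : 0 <= C * e0 by rewrite mulr_ge0// ltW.
(* Seven times 500 exceeds 3328 and seven times 40 exceeds 256. *)
pose Ups := 5 * 100 * (C / p) + 40 * (C * e0).
have U0 : 0 <= Ups.
  by rewrite /Ups; move: a1 a2; clear; move: (C / p) (C * e0) => *; lra.
pose q : R := expR (- (ln 2 / p)).
exists n, Lam, Ups, q; split.
  split => //.
    rewrite expR_gt0 /q -[X in _ < X]expR0 ltr_expR oppr_lt0 divr_gt0//.
    by rewrite ln_gt0// ltr1n.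
  rewrite /q -expRM_natl -/p mulrN mulrCA divff ?mulr1 ?gt_eqF//.
  by rewrite expRN lnK// posrE.
split => //.
- rewrite -/e0 /Ups; move: a1 a2; clear; move: (C / p) (C * e0) => *; lra.
- apply: expRN5_le.
  have : 46 <= p / (C * Lam) by rewrite ler_pdivlMr.
  by clear; move: (p / _) => *; lra.
rewrite -/e0; apply: le_trans gL; rewrite /growth_const -/p.
have Q : (1 + e0) ^+ n.+1 <= E.
  apply: le_trans (_ : expR e0 ^+ n.+1 <= _).
    by apply: lerXn2r; rewrite ?nnegrE ?expR_ge0 ?addr_ge0// expR_ge1Dx.
  by rewrite -expRM_natl ler_expR.
have Q0 : 0 <= (1 + e0) ^+ n.+1 by rewrite exprn_ge0// addr_ge0.
move: ((1 + e0) ^+ n.+1) Q Q0 => Q QE Q0.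
have -> : p * (Ups + 16 * C * e0) = C * (5 * 100 + 56 * (p * e0)).
  by rewrite /Ups; field; rewrite gt_eqF.
rewrite gE; clearbody E.
have -> : 384 * C * (3 * Q) + 48 * C + C * (5 * 100 + 56 * (p * e0)) * (3 * Q + 3) =
  C * (384 * (3 * Q) + 48 + (5 * 100 + 56 * (p * e0)) * (3 * Q + 3)) by ring.
rewrite ler_pM2l//.
have pe0 : 0 <= p * e0 by rewrite mulr_ge0// ltW.
have : (5 * 100 + 56 * (p * e0)) * (3 * Q + 3) <= 173 * 100 * (3 * E + 3).
  apply: ler_pM.
  - by move: pe0; clear; move: (p * e0) => *; lra.
  - by move: Q0; clear; lra.
  - by move: pe; clear; move: (p * e0) => *; lra.
  - by move: QE; clear; lra.
by move: QE; clear; move: ((5 * 100 + _) * _) (173 * 100 * _) => X Y h1 h2; lra.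
Qed.

(** The last condition of [barrier] for N0 = 60 Rr / y^3, tau = Rr / y and sg = 1 / y. The exponent
    is of order y^2, hence at least y, and beats the power y^N that bounds Rr; in the second term
    sg^(N+1) does so; in the third, L^2 H is of order z^3 against y = z^5. Spare powers of z take
    the constants, and each term gets a third of 1 / z. *)
Lemma barrier_error_le N (C Chat y z Rr L H : R) :
    1 <= z -> y = z ^+ 5 -> 1 <= C -> 0 <= L -> L <= Chat * z -> 0 <= H -> H <= 16 * z ->
    y <= Rr -> Rr <= y ^+ N ->
    8 * 60 * C <= z ->
    3 * (2 ^+ N.+3 * 60 * N.+1%:R ^+ N.+1) <= z ->
    3 * (24 * N.+3%:R * N.+2%:R * C * 60) <= z ->
    3 * (2 * N.+3%:R * N.+2%:R * 2 ^+ N.+1 * Chat ^+ 2 * 96) <= z ->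
  expR (- (N.+3%:R / (8 * C * (60 * Rr / y ^+ 3))) * (Rr / y)) * (2 ^+ N.+3 * (60 * Rr / y ^+ 3)) +
  (24 * N.+3%:R * N.+2%:R * C / Rr * ((60 * Rr / y ^+ 3) * y^-1 ^+ N.+1) * (Rr / y) +
   2 * N.+3%:R * N.+2%:R * 2 ^+ N.+1 * L ^+ 2 / Rr ^+ 2 * (H * (3 * Rr) * (1 + Rr / y))) <= z^-1.
Proof.
move=> z1 yE C1 L0 LC H0 Hz yR RN cA c1 c2 c3.
have z0 : 0 < z by apply: lt_le_trans z1.
have C0 : 0 < C by apply: lt_le_trans C1.
have zy : z * z <= y.
  by rewrite yE -expr2 ler_weXn2l.
have y1 : 1 <= y by rewrite yE exprn_ege1.
have y0 : 0 < y by apply: lt_le_trans y1.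
have R0 : 0 < Rr by apply: lt_le_trans yR.
have yN0 : 0 < y ^+ N by rewrite exprn_gt0.
have y31 : 1 <= y ^+ 3 by rewrite exprn_ege1.
have y30 : 0 < y ^+ 3 by apply: lt_le_trans y31.
set a1 := 2 ^+ N.+3 * 60 * _ in c1.
set a2 := 24 * _ * _ * C * 60 in c2.
set a3 := 2 * _ * _ * _ * _ * 96 in c3.
have third (a X : R) : 3 * a <= z -> X * y <= a -> X <= z^-1 / 3.
  move=> h1 h2; rewrite -(ler_pM2r y0); apply: le_trans h2 _.
  apply: le_trans (_ : z / 3 <= _); first by move: h1; clear; lra.
  rewrite mulrAC ler_pM2r ?invr_gt0//.
  by rewrite mulrC ler_pdivlMr.
have -> : z^-1 = z^-1 / 3 + (z^-1 / 3 + z^-1 / 3) by field; rewrite gt_eqF.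
apply: lerD; last apply: lerD.
- apply: (third a1) => //.
  have e1 : expR (- (N.+3%:R / (8 * C * (60 * Rr / y ^+ 3))) * (Rr / y)) <= expR (- y).
    rewrite ler_expR mulNr lerN2.
    have -> : N.+3%:R / (8 * C * (60 * Rr / y ^+ 3)) * (Rr / y) = N.+3%:R * (y * y) / (8 * 60 * C).
      by field; rewrite ?gt_eqF//= pnatr_eq0.
    have A0 : 0 < 8 * 60 * C by rewrite !mulr_gt0.
    rewrite ler_pdivlMr// mulrA mulrC ler_pM2r//.
    apply: le_trans cA _; apply: le_trans (_ : y <= _).
      by apply: le_trans zy; rewrite ler_peMl// ltW.
    by rewrite ler_peMl ?(ltW y0)// ler1n.
  have e2 : expR (- y) <= (N.+1%:R / y) ^+ N.+1.
    rewrite expRN -[X in _ <= X]invrK lef_pV2 ?posrE ?expR_gt0 ?invr_gt0 ?exprn_gt0 ?divr_gt0//.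
    by rewrite -exprVn invf_div expr_div_le_expR// ltW.
  have e3 : 2 ^+ N.+3 * (60 * Rr / y ^+ 3) <= 2 ^+ N.+3 * (60 * y ^+ N).
    rewrite ler_pM2l ?exprn_gt0// ler_pdivrMr//.
    apply: le_trans (_ : 60 * y ^+ N <= _); first by rewrite ler_pM2l.
    by rewrite ler_peMr// mulr_ge0// ltW.
  have := ler_pM (expR_ge0 _) _ (le_trans e1 e2) e3.
  move=> h; apply: le_trans (ler_wpM2r (ltW y0) (h _)) _.
    by rewrite mulr_ge0 ?exprn_ge0// divr_ge0 ?ltW// mulr_gt0.
  rewrite /a1 expr_div_n exprSr [y ^+ N.+1]exprSr.
  have yNn := gt_eqF yN0; have yn := gt_eqF y0.
  move: (y ^+ N) yNn {yN0 RN e1 e2 e3 h} => yN yNn.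
  by rewrite le_eqVlt; apply/orP; left; apply/eqP; field; rewrite yNn yn.
- apply: (third a2) => //.
  have -> : 24 * N.+3%:R * N.+2%:R * C / Rr * (60 * Rr / y ^+ 3 * y^-1 ^+ N.+1) * (Rr / y) * y =
    a2 * (Rr / y ^+ N / (y * y ^+ 3)).
    rewrite /a2 exprVn [y ^+ N.+1]exprSr.
    have yNn := gt_eqF yN0; have yn := gt_eqF y0; have Rn := gt_eqF R0.
    move: (y ^+ N) yNn => yN yNn.
    by field; rewrite yNn yn Rn.
  apply: ler_piMr.
    by rewrite /a2 !mulr_ge0// ltW.
  rewrite !ler_pdivrMr ?mulr_gt0// mul1r.
  by apply: le_trans RN _; apply: ler_peMl; [exact: ltW|exact: mulr_ege1].
- have e3 : z^-1 / 3 * z = 3^-1 by field; rewrite gt_eqF.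
  rewrite -(ler_pM2r z0) e3.
  have t1 : 1 + Rr / y <= 2 * (Rr / y).
    have : 1 <= Rr / y by rewrite ler_pdivlMr// mul1r.
    by clear; move: (Rr / y) => *; lra.
  have h1 : H * (3 * Rr) * (1 + Rr / y) <= 16 * z * (3 * Rr) * (2 * (Rr / y)).
    apply: ler_pM => //; rewrite ?addr_ge0 ?divr_ge0 ?mulr_ge0 ?(ltW R0) ?(ltW y0)//.
    by rewrite ler_wpM2r// mulr_ge0// ltW.
  have h2 : L ^+ 2 <= Chat ^+ 2 * z ^+ 2.
    rewrite -exprMn; apply: lerXn2r; rewrite ?nnegrE//; exact: le_trans LC.
  have P0 : 0 <= 2 * N.+3%:R * N.+2%:R * 2 ^+ N.+1 :> R by rewrite !mulr_ge0// exprn_ge0.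
  apply: le_trans (_ : 2 * N.+3%:R * N.+2%:R * 2 ^+ N.+1 * (Chat ^+ 2 * z ^+ 2) / Rr ^+ 2 *
     (16 * z * (3 * Rr) * (2 * (Rr / y))) * z <= _).
    rewrite ler_pM2r//; apply: ler_pM => //.
    - by rewrite divr_ge0 ?exprn_ge0 ?mulr_ge0 ?exprn_ge0// ltW.
    - by rewrite !mulr_ge0 ?addr_ge0 ?divr_ge0// ltW.
    - by rewrite ler_pM2r ?invr_gt0 ?exprn_gt0// ler_wpM2l.
  have -> : 2 * N.+3%:R * N.+2%:R * 2 ^+ N.+1 * (Chat ^+ 2 * z ^+ 2) / Rr ^+ 2 *
     (16 * z * (3 * Rr) * (2 * (Rr / y))) * z = a3 / z.
    rewrite yE /a3; have zn := gt_eqF z0; have Rn := gt_eqF R0.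
    move: (2 ^+ N.+1) => P; by field; rewrite zn Rn.
  by rewrite ler_pdivrMr// mulrC; move: c3; clear; move: a3 => *; lra.
Qed.

End Constants.

(** * Oscillation of a normalised flow at time 0 *)

Section Oscillation.
Context {R : realType}.

Lemma scale_between (x y : R) : 0 < y -> y <= x ->
  exists k, y <= x / 16 ^+ k /\ x / 16 ^+ k < 16 * y.
Proof.
move=> y0 yx; have x0 : 0 < x by apply: lt_le_trans yx.
have P0 k : 0 < 16 ^+ k :> R by rewrite exprn_gt0.
have ex : exists k, x / 16 ^+ k < 16 * y.
  exists (Num.truncn (x / y)).
  have h := truncnS_gt (x / y); move: (Num.truncn _) h => k h.
  rewrite ltr_pdivrMr//; move: h; rewrite ltr_pdivrMr// => h; apply: lt_le_trans h _.
  rewrite mulrAC ler_pM2r// -exprS.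
  elim: k => [|k IH]; first by rewrite expr1; lra.
  rewrite exprS -natr1; have : 1 <= k.+1%:R :> R by rewrite ler1n.
  clear -IH.
  by move: (k.+1%:R) (16 ^+ k.+1) IH => *; lra.
case: (ex_minnP ex) => k hk kmin; exists k; split => //.
case: k hk kmin => [|k] _ kmin; first by rewrite divr1.
have [|h] := leP (16 * y) (x / 16 ^+ k); last by have := kmin _ h; rewrite ltnn.
rewrite exprS invfM => h; have : 16 * y / 16 <= x / 16 ^+ k / 16 by rewrite ler_pM2r ?invr_gt0.
by rewrite mulrAC divff ?mul1r ?pnatr_eq0// mulrA mulrAC.
Qed.

Lemma common_upper_bound (s : seq R) : exists2 z, 1 <= z & forall a, a \in s -> a <= z.
Proof.
exists (1 + \sum_(a <- s) `|a|); first by rewrite lerDl sumr_ge0.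
elim: s => // b s IH a; rewrite inE big_cons => /orP[/eqP->|/IH h].
  have := ler_norm b; have : 0 <= \sum_(a <- s) `|a| by rewrite sumr_ge0.
  by clear; move: (\sum_(_ <- _) _) => *; lra.
by apply: le_trans h _; rewrite lerD2l lerDr.
Qed.

Lemma flow_opp K (s C L l0 w0 H Z : R) (B : site K -> site K -> R -> R) W
    (v : R -> site K -> R) :
  flow s C L l0 w0 H Z B W v -> flow s C L l0 w0 H Z B W (fun t x => - v t x).
Proof.
case=> c d b me sy ge up lo W0 Ww bu; split; try assumption.
- by move=> x t; apply: (continuousN (c x t)).
- move=> x t h; apply: (is_derive_eq (is_deriveN (d x t h))).
  rewrite opprD mulrN -sumrN; congr (_ - _); apply: eq_bigr => y _.
  by rewrite -mulrN opprB opprK addrC.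
- by move=> x t; rewrite normrN.
Qed.

(** z dominates the losses in K and the constants, and y separates the scales. The exponents 53 and
    27 fit Rr = s^(1 - alpha) with alpha <= 1/3 and s = y^80, as 160/3 > 53 and 80/3 < 27. The
    number g is the height q^k at which the induction around Z stops. *)
Lemma flow_oscillation (C Chat : R) (N : nat) : 1 <= C -> 0 <= Chat ->
  exists (p : nat) (kap z0 : R), [/\ (0 < p)%N, 0 < kap & 1 <= z0] /\
  forall K (s L l0 w0 H Z : R) (B : site K -> site K -> R -> R) (W : site K -> R -> R)
    (v : R -> site K -> R) (z y Rr : R),
    flow s C L l0 w0 H Z B W v -> z0 <= z -> y = z ^+ 5 ->
    0 <= L -> L <= Chat * z -> l0 <= Chat * y -> 0 <= H -> H <= 16 * z ->
    0 <= w0 -> z0 * (s * w0) <= 1 -> z0 * s <= K%:R -> `|Z| <= K%:R / 2 ->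
    y ^+ 53 <= Rr -> Rr <= s -> s <= y ^+ 27 * Rr -> s <= y ^+ N ->
  exists g : R, [/\ 0 <= g, g ^+ (4 * p) <= Rr / s &
    forall i j, ball Z Rr i -> ball Z Rr j -> `|v 0 i - v 0 j| <= kap * g].
Proof.
move=> C1 Chat0.
have C0 : 0 < C by apply: lt_le_trans C1.
(* The lower bound on p serves to have g^(N+3) >= 1 / z: g^(4p) = rho / r0 is at least y^-28 =
   z^-140, since s / Rr <= y^27 and one more y takes [Lam]. *)
have [n [Lam [Ups [q [[on Nn Lam256 /andP[q0 q1] qn] [U0 HU Hexp HG]]]]]] :=
  scale_constants (N.+3 * 140) C1.
have Lam0 : 0 < Lam by apply: lt_le_trans Lam256; rewrite ltr0n.
have Lam1 : 1 <= Lam by apply: le_trans Lam256; rewrite ler1n.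
pose e0 := 6 / (C * Lam); pose kap1 := e0 / (1 - q) + 1.
have e00 : 0 <= e0 by rewrite divr_ge0// ltW// mulr_gt0.
have kap11 : 1 <= kap1 by rewrite lerDr divr_ge0// subr_ge0 ltW.
have kap10 : 0 < kap1 by apply: lt_le_trans kap11.
pose P : R := 2 ^+ n.+1.
have P0 : 0 < P by rewrite exprn_gt0.
pose b1 := 8 * 60 * C.
pose b2 : R := 3 * (2 ^+ N.+3 * 60 * N.+1%:R ^+ N.+1).
pose b3 : R := 3 * (24 * N.+3%:R * N.+2%:R * C * 60).
pose b4 : R := 3 * (2 * N.+3%:R * N.+2%:R * 2 ^+ N.+1 * Chat ^+ 2 * 96).
pose b5 := 16 * Lam.
pose b6 : R := 3 * 100 * (Lam * n.+1%:R * 2 ^+ n).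
pose b7 : R := 100 * 8 * 96 * (P * Chat ^+ 2 * 16).
pose b8 : R := 192 * N.+2%:R * C ^+ 2 * 60.
pose b9 := 64 * Chat.
have [z0 z01 hz0] := common_upper_bound [:: b1; b2; b3; b4; b5; b6; b7; b8; b9].
have [[[h1 h2] h3 [h4 h5]] [[h6 h7] h8 h9]] : [/\ (b1 <= z0 /\ b2 <= z0), b3 <= z0 & (b4 <= z0 /\ b5 <= z0)] /\
   [/\ (b6 <= z0 /\ b7 <= z0), b8 <= z0 & b9 <= z0].
  split; split; try split; apply: hz0; rewrite !inE eqxx ?orbT; exact: isT.
exists n.+1, (4 * kap1), z0; split.
  by split => //; rewrite mulr_gt0.
move=> K s L l0 w0 H Z B W v z y Rr F zz yE L0 LC lC H0 Hz w00 sw sK ZK yR Rs sR sN.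
have s0 : 0 < s.
  have y0 : 0 < y by rewrite yE exprn_gt0// (lt_le_trans _ (le_trans z01 zz)).
  by apply: lt_le_trans Rs; apply: lt_le_trans yR; rewrite exprn_gt0.
have sw0 : 0 <= s * w0 by rewrite mulr_ge0// ltW.
have sw6 : b6 * (s * w0) <= 1 by apply: le_trans sw; exact: ler_wpM2r.
have sw1 : s * w0 <= 1 by apply: le_trans sw; exact: ler_peMl.
have sK5 : b5 * s <= K%:R by apply: le_trans sK; rewrite ler_pM2r.
have {hz0 z01 sw sK}z1 : 1 <= z by apply: le_trans zz.
move: (le_trans h1 zz) (le_trans h2 zz) (le_trans h3 zz) (le_trans h4 zz) (le_trans h5 zz) => {h1 h2 h3 h4 h5} h1 h2 h3 h4 h5.
move: (le_trans h6 zz) (le_trans h7 zz) (le_trans h8 zz) (le_trans h9 zz) => {h6 h7 h8 h9} h6 h7 h8 h9.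
move=> {zz z0}.
have z0 : 0 < z by apply: lt_le_trans z1.
have zk k : z <= z ^+ k.+1 by rewrite exprS; apply: ler_peMr; [exact: ltW|exact: exprn_ege1].
have zy : z <= y by rewrite yE.
have y1 : 1 <= y by apply: le_trans zy.
have y0 : 0 < y by apply: lt_le_trans y1.
have yk k : 0 < y ^+ k by rewrite exprn_gt0.
have yle k l : (k <= l)%N -> y ^+ k <= y ^+ l by exact: ler_weXn2l.
have L16y : 16 * Lam <= y by apply: le_trans zy.
have Ry : y <= Rr by apply: le_trans yR; rewrite -[X in X <= _]expr1; exact: yle.
have R0 : 0 < Rr by apply: lt_le_trans Ry.
have P16 k : 0 < 16 ^+ k :> R by rewrite exprn_gt0.
pose r0 := Lam * s.
have r00 : 0 < r0 by rewrite mulr_gt0.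
have [k [k1 k2]] : exists k, 16 * Rr <= r0 / 16 ^+ k /\ r0 / 16 ^+ k < 16 * (16 * Rr).
  apply: scale_between; rewrite ?mulr_gt0//.
  apply: ler_pM => //; first exact: ltW.
  by apply: le_trans Lam256; rewrite ler_nat.
(* 16^m is about y^12, so 2^m is about y^3, the gain wanted in N0. *)
have [m [m1 m2]] : exists m, 1 <= y ^+ 12 / 16 ^+ m /\ y ^+ 12 / 16 ^+ m < 16 * 1.
  by apply: scale_between => //; exact: exprn_ege1.
rewrite mulr1 in m2.
move: m1 m2; rewrite ler_pdivlMr// mul1r ltr_pdivrMr// => m1 m2.
have y4096 : 4096 <= y.
  by apply: le_trans L16y; move: Lam256; clear; move: Lam => *; lra.
have m0 : (0 < m)%N.
  rewrite lt0n; apply/eqP => mE; move: m2; rewrite mE expr0 mulr1 ltNge => /negP; apply.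
  apply: (@le_trans _ _ y); first by move: y4096; clear; lra.
  by rewrite -[X in X <= _]expr1; exact: yle.
pose rho := r0 / 16 ^+ k; pose re := r0 / 16 ^+ (k + m).
rewrite -/rho in k1 k2.
have reE : rho = re * 16 ^+ m.
  by rewrite /rho /re exprD invfM mulrA -mulrA mulVf ?mulr1// gt_eqF.
have re0 : 0 < re by rewrite divr_gt0.
have rho0 : 0 < rho by rewrite divr_gt0.
have rey : rho <= re * y ^+ 12 by rewrite reE ler_pM2l.
have yrho : y ^+ 53 <= rho.
  apply: le_trans yR _; apply: le_trans k1; rewrite ler_peMl ?(ltW R0)//.
  by rewrite ler1n.
have yre : y * y <= re.
  rewrite -(ler_pM2r (yk 12)); apply: le_trans rey; apply: le_trans yrho.
  by rewrite -expr2 -exprD; exact: yle.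
have re2R : re <= 2 * Rr.
  rewrite -(ler_pM2r (P16 m)) -reE; apply: le_trans (ltW k2) _.
  have : y <= y ^+ 12 by rewrite -[X in X <= _]expr1; exact: yle.
  move=> h.
  have h' : 4096 <= 16 * 16 ^+ m :> R.
    by apply: le_trans y4096 _; apply: le_trans h _; exact: ltW.
  have : 128 * Rr <= 16 ^+ m * Rr.
    by rewrite ler_pM2r//; move: h'; clear; move: (16 ^+ m) => *; lra.
  have -> : 2 * Rr * 16 ^+ m = 2 * (16 ^+ m * Rr) by ring.
  by clear; move: (16 ^+ m * Rr) => *; lra.
have pow4 i : (2 ^+ i) ^+ 4 = 16 ^+ i :> R.
  by rewrite -exprM mulnC exprM; congr (_ ^+ i); rewrite -natrX.
have pow4' i : (2^-1 ^+ 4) ^+ i = (16^-1) ^+ i :> R.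
  by congr (_ ^+ i); rewrite exprVn -natrX.
have root4 (a b : R) : 0 <= a -> 0 <= b -> a ^+ 4 <= b ^+ 4 -> a <= b.
  by move=> a0 b0; rewrite ler_pXn2r// nnegrE.
have LR : r0 <= Lam * (y ^+ 27 * Rr) by rewrite ler_pM2l.
(* 16^(k+m) = r0 / re is at most y^40: y^27 from s / Rr, y^12 from the m last scales, and y for the
   constants. *)
have TT : 2 ^+ (k + m) <= y ^+ 10.
  apply: root4; rewrite ?exprn_ge0//; first exact: ltW.
  rewrite pow4 -exprM -(ler_pM2l re0) /re divfK ?gt_eqF//.
  apply: le_trans LR _; rewrite -/re.
  have q1' : Lam * (y ^+ 27 * Rr) = (16 * Lam) * y ^+ 27 * (16 * Rr) / 256 by field.
  rewrite q1'.
  have q2' : (16 * Lam) * y ^+ 27 * (16 * Rr) <= y * y ^+ 27 * (re * y ^+ 12).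
    apply: ler_pM; [|by rewrite mulr_ge0// ltW|by rewrite ler_pM2r|exact: le_trans rey].
    by apply: mulr_ge0; [rewrite mulr_ge0// ltW|exact: ltW].
  have q3' : y * y ^+ 27 * (re * y ^+ 12) = re * y ^+ (10 * 4).
    by rewrite mulrCA -exprS -exprD.
  rewrite q3' in q2'.
  have q4' : 0 <= re * y ^+ (10 * 4) by rewrite mulr_ge0// ltW.
  by move: q2' q4'; clear; move: (16 * Lam * _ * _) (re * _) => *; lra.
(* Long against N0, so that the truncation empties, and short enough for [concentrate] to hold
   throughout. *)
pose tau := Rr / y.
have tau0 : 0 <= tau by rewrite divr_ge0// ltW.
have taus : tau <= s.
  by apply: le_trans Rs; rewrite ler_pdivrMr// ler_peMr// ltW.
have taurho : tau <= rho / (2 * Lam).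
  rewrite ler_pdivlMr ?mulr_gt0// /tau mulrAC ler_pdivrMr//.
  apply: le_trans (_ : Rr * y <= _); last first.
    rewrite ler_pM2r//; apply: le_trans k1; rewrite ler_peMl ?(ltW R0)//.
    by rewrite ler1n.
  rewrite ler_pM2l//; move: L16y Lam0; clear; move: Lam => *; lra.
have LsK : 16 * (Lam * s) <= K%:R.
  by rewrite mulrA; exact: sK5.
have bulk1 : `|Z| + 2 * r0 <= 3 / 4 * K%:R.
  by move: LsK ZK (ler0n R K); rewrite /r0; clear; move: (Lam * s) (`|Z|) (K%:R) => *; lra.
have bulk2 : 2 * r0 <= K%:R / 2.
  by move: LsK (ler0n R K); rewrite /r0; clear; move: (Lam * s) (K%:R) => *; lra.
have C64 : 64 * Chat <= y by apply: le_trans zy.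
have LCy : L <= Chat * y by apply: le_trans LC _; apply: ler_wpM2l.
have Cyy : 64 * (Chat * y) <= re.
  by apply: le_trans yre; rewrite mulrA ler_pM2r.
have re32 : 32 <= re.
  apply: le_trans yre; apply: le_trans (_ : y <= _); last by rewrite ler_peMr// ltW.
  by move: y4096; clear; lra.
have Lre : L <= re / 32.
  have := mulr_ge0 Chat0 (ltW y0).
  by move: LCy Cyy; clear; move: (Chat * y) => *; lra.
have lre : l0 <= 2 * re.
  have := mulr_ge0 Chat0 (ltW y0).
  by move: lC Cyy; clear; move: (Chat * y) => *; lra.
have short : 100 * (768 * (2 ^+ n.+1 * L ^+ 2 * H * rho ^+ 2)) <= re ^+ 3 * 2 ^- (k + m).
  have T0 : 0 < 2 ^+ (k + m) :> R by rewrite exprn_gt0.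
  rewrite ler_pdivlMr// -(ler_pM2r (yk 36)).
  have u1 : L ^+ 2 * H <= Chat ^+ 2 * 16 * z ^+ 3.
    have -> : Chat ^+ 2 * 16 * z ^+ 3 = (Chat * z) ^+ 2 * (16 * z) by ring.
    apply: ler_pM => //; first exact: exprn_ge0.
    by apply: lerXn2r; rewrite ?nnegrE//; exact: le_trans LC.
  have u2 : 100 * (768 * (P * L ^+ 2 * H * rho ^+ 2)) <= y * rho ^+ 2.
    have -> : 100 * (768 * (P * L ^+ 2 * H * rho ^+ 2)) = 100 * 8 * 96 * (P * (L ^+ 2 * H)) * rho ^+ 2.
      by clear; move: rho P H => *; ring.
    rewrite ler_pM2r ?exprn_gt0//.
    apply: le_trans (_ : b7 * z ^+ 3 <= _).
      have -> : b7 * z ^+ 3 = 100 * 8 * 96 * (P * (Chat ^+ 2 * 16 * z ^+ 3)).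
        by rewrite /b7; clear; move: z P Chat => *; ring.
      have A0 : 0 < 100 * 8 * 96 :> R by rewrite !mulr_gt0// ltr0n.
      by rewrite ler_pM2l// ler_pM2l.
    apply: le_trans (_ : z * z ^+ 3 <= _).
      by rewrite ler_pM2r// exprn_gt0.
    by rewrite yE -exprS ler_weXn2l.
  have u3 : y * rho ^+ 2 * 2 ^+ (k + m) * y ^+ 36 <= rho ^+ 3.
    have -> : rho ^+ 3 = rho * rho ^+ 2 by rewrite exprS.
    have -> : y * rho ^+ 2 * 2 ^+ (k + m) * y ^+ 36 = (y * y ^+ 36 * 2 ^+ (k + m)) * rho ^+ 2.
      by clear; move: (2 ^+ (k + m)) (y ^+ 36) (rho ^+ 2) => *; ring.
    rewrite ler_pM2r ?exprn_gt0//; apply: le_trans yrho.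
    rewrite -exprS; apply: le_trans (_ : y ^+ 37 * y ^+ 10 <= _); first by rewrite ler_pM2l.
    by rewrite -exprD; exact: yle.
  have u4 : rho ^+ 3 <= re ^+ 3 * y ^+ 36.
    rewrite (_ : y ^+ 36 = (y ^+ 12) ^+ 3); last by rewrite -exprM.
    by rewrite -exprMn; apply: lerXn2r; rewrite ?nnegrE ?(ltW rho0) ?mulr_ge0// ltW.
  apply: le_trans u4; apply: le_trans u3.
  by rewrite ler_pM2r// ler_pM2r.
have wsmall : 300 * (r0 * n.+1%:R * 2 ^+ n * w0) <= 1.
  have -> : 300 * (r0 * n.+1%:R * 2 ^+ n * w0) = b6 * (s * w0).
    by rewrite /b6 /r0; clear; move: (n.+1%:R) (2 ^+ n) => *; ring.
  exact: sw6.
have [a a1 cnt] := concentrate F on C1 Lam1 q0 q1 qn (erefl e0) U0 HU Hexp HG L0 w00 H0 s0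
  R0 m0 bulk1 bulk2 k1 re2R re32 Lre lre short wsmall tau0 taurho.
pose g := q ^+ k; pose G := kap1 * g; pose N0 := 60 * Rr / y ^+ 3.
have g0 : 0 < g by rewrite exprn_gt0.
have g1 : g <= 1 by rewrite exprn_ile1// ltW.
have G0 : 0 < G by rewrite mulr_gt0.
have gE : g ^+ (4 * n.+1) = rho / r0.
  rewrite /g -exprM (_ : (k * (4 * n.+1) = n.+1 * (4 * k))%N); last by rewrite mulnCA [RHS]mulnCA [(k * _)%N]mulnC.
  rewrite exprM qn exprM pow4' exprVn /rho.
  by rewrite mulrAC divff ?mul1r// gt_eqF.
have gle : g ^+ (4 * n.+1) <= Rr / s.
  rewrite gE ler_pdivrMr//.
  apply: le_trans (ltW k2) _.
  have -> : Rr / s * r0 = Lam * Rr by rewrite /r0; field; rewrite gt_eqF.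
  rewrite mulrA ler_pM2r//.
  by apply: le_trans Lam256; rewrite -natrM ler_nat.
have gz : z^-1 <= g ^+ N.+3.
  have : z^-1 ^+ 140 <= (g ^+ N.+3) ^+ 140.
    rewrite -exprM; apply: le_trans (_ : g ^+ (4 * n.+1) <= _); last first.
      apply: ler_wiXn2l => //; first exact: ltW.
      by apply: leq_trans Nn _; rewrite leq_pmull.
    have -> : z^-1 ^+ 140 = y ^- 28 by rewrite yE -exprM exprVn.
    rewrite gE ler_pdivlMr// mulrC ler_pdivrMr//.
    apply: le_trans LR _; rewrite [y ^+ 28]exprS.
    have -> : rho * (y * y ^+ 27) = y * (y ^+ 27 * rho).
      by clear; move: (y ^+ 27) rho => *; ring.
    apply: ler_pM; rewrite ?(ltW Lam0)//.
    - by rewrite mulr_ge0// ltW.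
    - by apply: le_trans L16y; rewrite ler_peMl ?(ltW Lam0)// ler1n.
    - rewrite ler_pM2l//; apply: le_trans k1; rewrite ler_peMl ?(ltW R0)//.
      by rewrite ler1n.
  by rewrite ler_pXn2r// nnegrE ?invr_ge0 ?exprn_ge0// ltW.
have GN : z^-1 <= G ^+ N.+3.
  apply: le_trans gz _; rewrite exprMn; apply: ler_peMl; last exact: exprn_ege1.
  by apply: exprn_ge0; exact: ltW.
have m2N : 30 * Rr * 2 ^- m <= N0.
  have mm : y ^+ 3 <= 2 * 2 ^+ m.
    apply: root4; rewrite ?mulr_ge0 ?exprn_ge0// ?(ltW y0)//.
    rewrite [(2 * _) ^+ 4]exprMn pow4 -exprM; apply: le_trans (ltW m2) _.
    by rewrite ler_pM2r// -natrX ler_nat.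
  have m20 : 0 < 2 ^+ m :> R by rewrite exprn_gt0.
  rewrite /N0 ler_pdivlMr// mulrAC ler_pdivrMr//.
  have -> : 60 * Rr * 2 ^+ m = 30 * Rr * (2 * 2 ^+ m).
    by clear; move: (2 ^+ m) => *; ring.
  by rewrite ler_pM2l// mulr_gt0.
have N01 : 1 <= N0.
  rewrite /N0 ler_pdivlMr// mul1r; apply: le_trans (_ : y ^+ 53 <= _); first exact: yle.
  by apply: le_trans yR _; rewrite ler_peMl ?(ltW R0)// ler1n.
have yy60 : 4096 * y <= y ^+ 3.
  apply: le_trans (_ : y * y <= _); first by rewrite ler_pM2r.
  by rewrite -expr2; exact: yle.
have N0R : N0 <= Rr.
  rewrite /N0 ler_pdivrMr// mulrC ler_pM2l//; move: yy60 y1; clear; move: (y ^+ 3) => *; lra.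
have count0 (w : R -> site K -> R) (b : R) : (forall t x, `|w t x - b| = `|v t x - a|) ->
    forall t, - tau <= t <= 0 -> \sum_(x | ball Z (2 * Rr) x && (G < `|w t x - b|)) 1 <= N0.
  move=> wb t ht; apply: le_trans m2N; apply: le_trans (cnt t ht).
  by rewrite le_eqVlt; apply/orP; left; apply/eqP; apply: eq_bigl => x; rewrite wb.
have sR1 : s <= K%:R / 16.
  apply: le_trans (_ : Lam * s <= _).
    by rewrite ler_peMl// ltW.
  by move: LsK; clear; move: (Lam * s) => *; lra.
have up (w : R -> site K -> R) (b : R) : flow s C L l0 w0 H Z B W w -> `|b| <= 1 ->
    (forall t x, `|w t x - b| = `|v t x - a|) -> forall x, ball Z Rr x -> w 0 x - b <= 2 * G.
  move=> Fw bb1 wb.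
  have Rr1 : 1 <= Rr by exact: le_trans Ry.
  apply: (barrier Fw bb1 G0 H0 C1 L0 _ Rr1 w00 _ N01 _ _ _ tau0 taus (sg := y^-1) (n := N) _ _ (count0 _ _ wb)).
  - by apply: le_trans Lre _; move: re2R R0; clear; lra.
  - rewrite ler_pdivlMr//; apply: le_trans sw1; rewrite mulrC.
    by rewrite ler_wpM2r.
  - have N0y : y * y <= N0.
      rewrite /N0 ler_pdivlMr// -expr2 -exprD; apply: le_trans (_ : y ^+ 53 <= _); first exact: yle.
      by apply: le_trans yR _; rewrite ler_peMl ?(ltW R0)// ler1n.
    apply: le_trans lC _; have : 64 * (Chat * y) <= y * y by rewrite mulrA ler_pM2r.
    by move: N0y (mulr_ge0 Chat0 (ltW y0)) (mulr_gt0 y0 y0); clear; move: N0 (Chat * y) (y * y) => *; lra.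
  - by move: N0R Rs sR1 ZK (ler0n R K); clear; move: (`|Z|) (K%:R) N0 => *; lra.
  - by move: Rs sR1 (ler0n R K); clear; move: (K%:R) => *; lra.
  - by rewrite invr_gt0.
  - have -> : Rr * y^-1 ^+ 2 = y * (Rr / y ^+ 3) by field; rewrite gt_eqF.
    have -> : 192 * N.+2%:R * C ^+ 2 * N0 = b8 * (Rr / y ^+ 3).
      by rewrite /N0 /b8; clear; move: (y ^+ 3) (N.+2%:R) => *; ring.
    by rewrite ler_pM2r ?divr_gt0//; exact: le_trans zy.
  - apply: le_trans GN; exact: (barrier_error_le z1 yE C1 L0 LC H0 Hz Ry (le_trans Rs sN)).
exists g; split; [exact: ltW|exact: gle|].
have opp : flow s C L l0 w0 H Z B W (fun t x => - v t x).
  exact: flow_opp.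
have near_a i : ball Z Rr i -> `|v 0 i - a| <= 2 * G.
  move=> iR; rewrite ler_norml; apply/andP; split; last exact: up iR.
  have := up _ (- a) opp _ _ i iR; rewrite normrN opprK.
  have e t x : `|- v t x + a| = `|v t x - a| by rewrite -normrN opprD opprK.
  move=> /(_ a1 e); clear; lra.
move=> i j /near_a ia /near_a ja.
have -> : v 0 i - v 0 j = (v 0 i - a) - (v 0 j - a) by ring.
apply: le_trans (ler_normB _ _) _; move: ia ja; rewrite /G -[X in _ -> _ -> _ <= X]mulrA.
by clear; move: (kap1 * g) (`|v 0 i - a|) => *; lra.
Qed.

End Oscillation.

(** * The maximum principle *)

Section MaximumPrinciple.
Context {R : realType}.

(** The truncation is a nondecreasing function of v, so each symmetrised product of differences is
    nonnegative; the killing has a sign because v > M >= 0 on the support. *)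
Lemma pospart_dissipation n (B : 'I_n -> 'I_n -> R) (W v : 'I_n -> R) (M : R) :
    (forall x y, B x y = B y x) -> (forall x y, 0 <= B x y) -> (forall x, 0 <= W x) -> 0 <= M ->
  \sum_x 2 * Num.max (v x - M) 0 * (\sum_y B x y * (v y - v x) - W x * v x) <= 0.
Proof.
move=> sB B0 W0 M0.
pose h x := Num.max (v x - M) 0.
have h0 x : 0 <= h x by rewrite le_max lexx orbT.
apply: (@le_trans _ _ (2 * \sum_x h x * \sum_y B x y * (v y - v x))).
  rewrite big_distrr/=; apply: ler_sum => x _; rewrite -/(h x) -mulrA ler_pM2l// mulrBr gerBl.
  have [->|hx] := eqVneq (h x) 0; first by rewrite mul0r.
  apply: mulr_ge0 => //; apply: mulr_ge0 => //; apply: le_trans M0 _.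
  have : 0 < h x by rewrite lt0r hx h0.
  by rewrite lt_max ltxx orbF subr_gt0 => /ltW.
rewrite (sum_antisym (B := B) (D := predT))// pmulr_rle0// oppr_le0.
apply: mulr_ge0 => //; apply: sumr_ge0 => x _; apply: sumr_ge0 => y _; apply: mulr_ge0 => //.
rewrite /h; move: (v x) (v y) => p q; case: (leP (p - M) 0) => h1; case: (leP (q - M) 0) => h2.
- by rewrite subrr mul0r.
- by apply: mulr_le0; clear -h1 h2; lra.
- by apply: mulr_ge0; clear -h1 h2; lra.
- by have -> : (p - M - (q - M)) * (p - q) = (p - q) ^+ 2; [ring|exact: sqr_ge0].
Qed.

(** The sum of squares of the positive parts of v - M starts at 0 and has nonpositive derivative, so
    Gronwall's inequality with zero rate and source keeps it at 0. *)
Lemma max_principle n (a b M : R) (B : 'I_n -> 'I_n -> R -> R) (W : 'I_n -> R -> R)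
    (v : R -> 'I_n -> R) : a <= b -> 0 <= M ->
    (forall x t, {for t, continuous (fun t => v t x)}) ->
    (forall x t, a < t < b -> is_derive t 1 (fun t => v t x)
      (\sum_y B x y t * (v t y - v t x) - W x t * v t x)) ->
    (forall x y t, a < t < b -> B x y t = B y x t) ->
    (forall x y t, a < t < b -> 0 <= B x y t) ->
    (forall x t, a < t < b -> 0 <= W x t) ->
    (forall x, v a x <= M) -> forall x, v b x <= M.
Proof.
move=> ab M0 cv dv sB B0 W0 va x.
pose F t := \sum_x Num.max (v t x - M) 0 ^+ 2.
have : F b <= expR (- 0 * (b - a)) * F a + 0.
  apply: (@gronwall_le R F (cst 0)) => //.
  - move=> t _; apply: continuous_sum_at => y.
    apply: (@continuous_comp _ _ _ (fun t => v t y - M) (fun z => Num.max z 0 ^+ 2)).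
      by apply: continuousB; [exact: cv|exact: cvg_cst].
    apply/differentiable_continuous/derivable1_diffP.
    exact: (ex_derive (is_derive := is_derive_pospart 0 _)).
  - move=> t tab; exists (\sum_x 2 * Num.max (v t x - M) 0 *
      (\sum_y B x y t * (v t y - v t x) - W x t * v t x)).
      apply: is_derive_sum_at => y.
      have d1 := is_deriveB (dv y t tab) (is_derive_cst M t 1).
      rewrite subr0 in d1.
      by have := is_derive1_comp (is_derive_pospart 0 _) d1.
    rewrite oppr0 mul0r add0r; apply: pospart_dissipation => // [y z|y z|y].
    + exact: sB.
    + exact: B0.
    + exact: W0.
  - by rewrite integral0.
rewrite addr0; have -> : F a = 0.
  by rewrite /F big1// => y _; rewrite max_r ?expr0n// subr_le0.
rewrite mulr0 => Fb.
have sq y : 0 <= Num.max (v b y - M) 0 ^+ 2 by exact: sqr_ge0.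
have : Num.max (v b x - M) 0 ^+ 2 <= 0.
  apply: le_trans Fb; rewrite /F (bigD1 x)//= lerDl; exact: sumr_ge0.
rewrite le_eqVlt ltNge sq orbF sqrf_eq0 => /eqP h.
by rewrite -subr_le0 -h le_max lexx.
Qed.

End MaximumPrinciple.

(** * From complex to real systems *)

Section ComplexParts.
Context {R : realType} {K : nat}.
Variable phi : R[i] -> R.
Hypothesis phiB : forall z w, phi (z - w) = phi z - phi w.
Hypothesis phiZ : forall a z, phi (a%:C%C * z) = a * phi z.

(** The coefficients are real, so a real-linear map sends solutions to solutions; [phi] stands for
    the real and the imaginary part at once. *)
Lemma part_opA (B : site K -> site K -> R -> R) W s (v : site K -> R[i]) j :
  phi (- opA B W s v j) =
    \sum_k B j k s * (phi (v k) - phi (v j)) - W j s * phi (v j).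
Proof.
have phi0 : phi 0 = 0 by rewrite -(subrr 0) phiB subrr.
have phiN z : phi (- z) = - phi z by rewrite -sub0r phiB phi0 sub0r.
have phiD z w : phi (z + w) = phi z + phi w by rewrite -{1}[w]opprK phiB phiN opprK.
rewrite /opA /opB /opW opprD opprK phiB phiZ; congr (_ - _).
rewrite (big_morph phi phiD phi0) [RHS](bigD1 j)//= subrr mulr0 add0r.
by apply: eq_bigr => k _; rewrite phiZ phiB.
Qed.

End ComplexParts.

(** * Extension of the solution to all times *)

Section Clamp.
Context {R : realType}.
Implicit Types (f : R -> R).

(** The projection onto [-s, 0]. Composition with it turns continuity on the closed interval into
    continuity at every time, as [flow] asks, and keeps the derivative inside. *)
Definition clamp (s t : R) : R := Num.max (- s) (Num.min t 0).

Lemma clamp_itv (s t : R) : 0 <= s -> - s <= clamp s t <= 0.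
Proof. by move=> s0; rewrite /clamp le_max lexx/= ge_max oppr_le0 s0/= ge_min lexx orbT. Qed.

Lemma clamp_id (s t : R) : - s <= t <= 0 -> clamp s t = t.
Proof. by move=> /andP[h1 h2]; rewrite /clamp min_l// max_r. Qed.

Lemma clamp_continuous (s : R) f : 0 <= s -> {within `[- s, 0], continuous f} ->
  forall t, {for t, continuous (fun t => f (clamp s t))}.
Proof.
move=> s0 /subspace_continuousP cf t.
have inI u : `[- s, 0]%classic (clamp s u) by rewrite /= in_itv/= clamp_itv.
have cc : {for t, continuous (clamp s)}.
  apply: (@continuous_max R R (fun=> - s) (fun t => Num.min t 0) t); first exact: cvg_cst.
  by apply: (@continuous_min R R id (fun=> 0) t); [exact: cvg_id|exact: cvg_cst].
move=> A nA; have := cf _ (inI t) A nA => wA.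
have H : \forall u \near t, clamp s u \in `[- s, 0] -> A (f (clamp s u)) := cc _ wA.
suff : \forall u \near t, A (f (clamp s u)) by [].
by near=> u; apply: (near H u) => //; exact: inI.
Unshelve. all: by end_near.
Qed.

Lemma clamp_is_derive (s t : R) f d : - s < t < 0 -> is_derive t 1 f d ->
  is_derive t 1 (fun t => f (clamp s t)) d.
Proof.
move=> /andP[h1 h2] df; apply: near_eq_is_derive df.
near=> u; rewrite clamp_id//; apply/andP; split; apply: ltW; near: u.
  exact: lt_nbhsr.
exact: lt_nbhsl.
Unshelve. all: by end_near.
Qed.

End Clamp.

(** * From the conditions on the coefficients to a normalised flow *)

Section Reduction.
Context {R : realType} {K : nat}.
Local Notation mu := (@lebesgue_measure R).
Local Notation coord := (@coord R K).
Implicit Types (B : site K -> site K -> R -> R) (W : site K -> R -> R).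

Lemma bdist_bulk (x : site K) : `|coord x| <= 3 / 4 * K%:R -> K%:R / 4 <= bdist R x.
Proof.
rewrite ler_norml => /andP[h1 h2]; rewrite /bdist.
have K1 : (K.+1%:Z)%:~R = K%:R + 1 :> R by rewrite natr1.
rewrite minEle; case: ifP => _; rewrite intr_norm; apply: le_trans (ler_norm _).
  by rewrite (intrD R (pos x)) K1 -/(coord x); clear -h1; lra.
by rewrite (intrB R _ (pos x)) K1 -/(coord x); clear -h2; lra.
Qed.

(** Take k = 0 and the least m with 2^m >= 2 K; the time -2 K / 2^m lies in [-1, 0). Since ln 2 >=
    1/2, this m is at most 10 ln K. *)
Lemma Xi_near_zero (c : R) : 10 <= c -> (4 <= K)%N -> exists2 t, Xi c K t & - 1 <= t < 0.
Proof.
move=> c10 K4.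
have K0 : 0 < K%:R :> R by rewrite ltr0n (leq_trans _ K4).
have ex : exists m, (K.*2 <= 2 ^ m)%N by exists K.*2; exact/ltnW/ltn_expl.
case: (ex_minnP ex) => m hm mmin.
have p2 k : 0 < 2 ^+ k :> R by rewrite exprn_gt0.
have hmR : 2 * K%:R <= 2 ^+ m :> R.
  by rewrite -natrX -natrM ler_nat mul2n.
exists (- (K%:R * 2 ^- m * (1 + 2 ^- 0))); last first.
  rewrite lerN2 oppr_lt0 expr0 invr1 mulrAC ler_pdivrMr// mul1r.
  rewrite divr_gt0 ?mulr_gt0// ?addr_gt0// andbT.
  by move: hmR; clear; move: (2 ^+ m) (K%:R) => *; lra.
have lK2 : ln 2 <= ln K%:R :> R by rewrite ler_ln ?posrE// ler_nat (leq_trans _ K4).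
have l2 : 2^-1 <= ln 2 :> R.
  have := @le_ln1Dx R (- 2^-1) ltac:(lra).
  have -> : 1 - 2^-1 = 2^-1 :> R by field.
  by rewrite lnV ?posrE//; clear; lra.
have lK : 0 <= ln K%:R :> R by apply: le_trans lK2; move: l2; clear; lra.
exists 0%N, m; split => //.
  by apply: mulr_ge0 => //; move: c10; clear; lra.
apply: (@le_trans _ _ (10 * ln K%:R)); last by rewrite ler_wpM2r.
case: m hm mmin {hmR} => [|m] _ mmin; first by rewrite mulr_ge0.
have h : (2 ^ m < K.*2)%N by rewrite ltnNge; apply/negP => /mmin; rewrite ltnn.
have : ln (2 ^+ m) <= ln (2 * K%:R) :> R.
  by rewrite ler_ln ?posrE ?mulr_gt0// -natrX -natrM ler_nat mul2n ltnW.
rewrite lnXn// [ln (2 * K%:R)]lnM ?posrE// -[ln 2 *+ m]mulr_natr -[m.+1%:R]natr1 => h1.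
have := ler_wpM2r (ler0n R m) l2.
move=> h2; move: h1 l2 lK2 h2; clear; lra.
Qed.

Lemma window_average_ball B (Z : int) (rr x : R) : 0 <= rr ->
  window_average B Z (Num.truncn rr) x = (Num.truncn rr)%:R^-1 * ball_energy B Z%:~R rr x.
Proof.
move=> rr0; rewrite /window_average /ball_energy; congr (_ * _).
have bE (i : site K) : (`|pos i - Z| <= (Num.truncn rr)%:Z) = ball Z%:~R rr i.
  rewrite /ball/= /coord -intrB -intr_norm -abszE lez_nat truncn_ge_nat//.
rewrite (eq_bigl _ _ bE); apply: eq_bigr => i _; apply: eq_bigl => j.
by rewrite bE andbC.
Qed.

(** If t < t0, the interval is cut at t0 and regularity at t0 is used twice, with the endpoints t
    and 0. As t0 >= -1 the part after t0 costs at most a factor 2, and 1 + (t0 - t) + 2 <= 3 (1 -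
    t). The prefactor 1 / M of the window average is undone by M <= rr. *)
Lemma regular_energy_le B (Z : int) (s t0 rho rr : R) :
    (forall x y, measurable_fun `[- s, 0] (B x y)) ->
    (forall x y t, - s <= t <= 0 -> 0 <= B x y t) ->
    - s <= t0 -> - 1 <= t0 < 0 -> regular `[- s, 0] B rho Z t0 ->
    1 <= rr -> rr <= K%:R -> forall t, - s <= t <= 0 ->
  (\int[mu]_(u in `[t, 0%R]) (ball_energy B Z%:~R rr u)%:E <=
     (3 * K%:R `^ rho * rr * (1 - t))%:E)%E.
Proof.
move=> mB B0 st0 /andP[t01 t00] reg rr1 rrK t /andP[ts t_le0].
have rr0 : 0 <= rr by apply: le_trans rr1.
pose M := Num.truncn rr; pose E := ball_energy B Z%:~R rr; pose P := K%:R `^ rho.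
have P0 : 0 <= P by exact: powR_ge0.
have M0 : (0 < M)%N by rewrite truncn_gt0.
have M0R : 0 < M%:R :> R by rewrite ltr0n.
have MK : (M <= K)%N.
  by rewrite -(ler_nat R); apply: le_trans rrK; rewrite truncn_le.
have mE : measurable_fun `[- s, 0] E by exact: ball_energy_meas.
have E0 u : - s <= u <= 0 -> 0 <= E u by exact: ball_energy_ge0.
have one a b s' : a <= b -> - s <= a -> b <= 0 -> - s <= s' <= 0 ->
    b - a = `|s' - t0| ->
    (`|oriented_integral s' t0 (window_average B Z M)| =
     \int[mu]_(u in `[a, b]) (window_average B Z M u)%:E)%E ->
    (\int[mu]_(u in `[a, b]) (E u)%:E <= (rr * (P * (1 + (b - a))))%:E)%E.
  move=> ab sa b0 s'I bE oE.
  have := reg s' M; rewrite /= in_itv/= M0 MK => /(_ s'I isT).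
  rewrite lee_pdivrMl ?ltr_pwDl// oE -EFinM -bE => h.
  have sub : `[a, b] `<=` `[- s, 0].
    by move=> u /=; rewrite !in_itv/= => /andP[u1 u2]; rewrite (le_trans sa u1) (le_trans u2 b0).
  have -> : (\int[mu]_(u in `[a, b]) (E u)%:E =
      M%:R%:E * \int[mu]_(u in `[a, b]) (window_average B Z M u)%:E)%E.
    rewrite -ge0_integralZl_EFin//; last 2 first.
    - move=> u /sub/=; rewrite in_itv/= => uI; rewrite lee_fin window_average_ball//.
      by rewrite mulr_ge0 ?invr_ge0// E0.
    - apply/measurable_EFinP; rewrite (_ : window_average B Z M = fun u => M%:R^-1 * E u).
        by apply: measurable_funM => //; exact: measurable_funS mE.
      by apply/funext => u; exact: window_average_ball.
    apply: eq_integral => u _; rewrite -EFinM window_average_ball//.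
    by rewrite mulrA divff ?mul1r// gt_eqF.
  apply: (@le_trans _ _ (M%:R%:E * ((1 + (b - a)) * P)%:E)%E).
    by rewrite lee_pmul2l ?lte_fin.
  rewrite -EFinM lee_fin [(1 + _) * P]mulrC; apply: ler_wpM2r.
    by rewrite mulr_ge0// addr_ge0// subr_ge0.
  by rewrite truncn_le.
have st0I : - s <= (0 : R) <= 0 by rewrite (le_trans ts t_le0) lexx.
have right : (\int[mu]_(u in `[t0, 0%R]) (E u)%:E <= (rr * (P * 2))%:E)%E.
  apply: le_trans (one t0 0 0 (ltW t00) st0 (lexx _) st0I _ _) _.
  - by rewrite !sub0r normrN ltr0_norm// .
  - rewrite /oriented_integral leNgt t00/= abseN gee0_abs//.
    apply: integral_ge0 => u /=; rewrite in_itv/= => /andP[u1 u2].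
    by rewrite lee_fin window_average_ball// mulr_ge0 ?invr_ge0// E0// (le_trans st0 u1).
  - rewrite lee_fin; apply: ler_wpM2l => //; apply: ler_wpM2l => //.
    by move: t01; clear; lra.
have last_step (x : R) : x <= 3 * (1 - t) -> rr * (P * x) <= 3 * P * rr * (1 - t).
  move=> h; have -> : 3 * P * rr * (1 - t) = rr * (P * (3 * (1 - t))) by ring.
  by apply: ler_wpM2l => //; apply: ler_wpM2l.
have [tt|tt] := leP t0 t.
  apply: le_trans (_ : (rr * (P * 2))%:E <= _)%E; last first.
    by rewrite lee_fin last_step//; move: t_le0; clear; lra.
  apply: subset_integral_le right => //.
    by apply: measurable_funS mE => // u /=; rewrite !in_itv/= => /andP[u1 ->]; rewrite (le_trans st0 u1).
  by move=> u /andP[u1 u2]; rewrite E0// u2 (le_trans st0 u1).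
have left : (\int[mu]_(u in `[t, t0]) (E u)%:E <= (rr * (P * (1 + (t0 - t))))%:E)%E.
  apply: (one t t0 t (ltW tt) ts (ltW t00)) => //.
  - by rewrite ts.
  - by rewrite distrC ger0_norm// subr_ge0 ltW.
  - rewrite /oriented_integral (ltW tt) gee0_abs//.
    apply: integral_ge0 => u /=; rewrite in_itv/= => /andP[u1 u2].
    by rewrite lee_fin window_average_ball// mulr_ge0 ?invr_ge0// E0// (le_trans ts u1) (le_trans u2 (ltW t00)).
have sub2 a b : - s <= a -> b <= 0 -> `[a, b] `<=` `[- s, 0].
  by move=> sa b0 u /=; rewrite !in_itv/= => /andP[u1 u2]; rewrite (le_trans sa u1) (le_trans u2 b0).
rewrite (@itv_bndbnd_setU _ _ _ (BLeft t0)) ?bnd_simp ?(ltW tt) ?(ltW t00)//.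
have un : [set` Interval (BLeft t) (BLeft t0)] `|` [set` Interval (BLeft t0) (BRight 0)] `<=` `[- s, 0].
  rewrite -itv_bndbnd_setU ?bnd_simp ?(ltW tt) ?(ltW t00)//; exact: sub2.
rewrite ge0_integral_setU//=; last 3 first.
- by apply/measurable_EFinP; apply: measurable_funS mE.
- by move=> u /un /=; rewrite in_itv/= lee_fin => /E0.
- apply/disj_set2P; rewrite -subset0 => u [/=]; rewrite !in_itv/= => /andP[_ u1] /andP[u2 _].
  by move: (lt_le_trans u1 u2); rewrite ltxx.
apply: (@le_trans _ _ ((rr * (P * (1 + (t0 - t))))%:E + (rr * (P * 2))%:E)%E).
  apply: leeD => //; apply: le_trans left.
  apply: ge0_subset_integral => //.
  - apply/measurable_EFinP; apply: measurable_funS mE => //; apply: sub2 => //; exact: ltW.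
  - by move=> u /(sub2 _ _ ts (ltW t00))/=; rewrite in_itv/= lee_fin => /E0.
  - by move=> u /=; rewrite !in_itv/= => /andP[-> /ltW].
rewrite -EFinD lee_fin -mulrDr -mulrDr; apply: last_step.
by move: t00 t_le0; clear; lra.
Qed.

(** Far pairs obey the bound without loss. For pairs closer than Chat K^xi the loss K^-xi is made up
    by the gap between their distance and rr >= Chat K^(2 xi). *)
Lemma lower_bound_of_condC2 (C Chat xi s : R) B W : 10 <= C -> 10 <= Chat -> (4 <= K)%N -> 0 <= xi ->
    condC2 C Chat `[- s, 0] B W xi ->
  forall x y t rr, - s <= t <= 0 -> Chat * (K%:R `^ xi) ^+ 2 <= rr -> x != y ->
    `|coord x| <= 3 / 4 * K%:R -> `|coord y| <= 3 / 4 * K%:R ->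
    `|coord x - coord y| <= rr -> 1 / (C * rr ^+ 2) <= B x y t.
Proof.
move=> C10 Ch10 K4 xi0 [c1 _ c3] x y t rr ts lrr xy hx hy drr.
have C0 : 0 < C by apply: lt_le_trans C10.
have Ch0 : 0 < Chat by apply: lt_le_trans Ch10.
have Ch1 : 1 <= Chat by apply: le_trans Ch10; lra.
have C1 : 1 <= C by apply: le_trans C10; lra.
have d1 : 1 <= `|coord x - coord y| := sdist_ge1 xy.
have d0 : 0 < `|coord x - coord y| by apply: lt_le_trans d1.
have rr0 : 0 < rr by apply: lt_le_trans drr.
have KC (z : site K) : `|coord z| <= 3 / 4 * K%:R -> K%:R / C <= bdist R z.
  move=> /bdist_bulk; apply: le_trans; apply: ler_wpM2l => //.
  by rewrite lef_pV2 ?posrE//; apply: le_trans C10; lra.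
have tI : `[- s, 0]%classic t by rewrite /= in_itv/=.
pose k := K%:R `^ xi.
have k1 : 1 <= k.
  have K1 : 1 <= K%:R :> R by rewrite ler1n (leq_trans _ K4).
  by rewrite -[X in X <= _](powRr0 K%:R); exact: ler_powR.
have k0 : 0 < k by apply: lt_le_trans k1.
have [near|far] := ltP `|coord x - coord y| (Chat * k).
  apply: le_trans (c1 t x y tI xy (KC _ hx) (KC _ hy)).
  rewrite sdistE powRN -/k -invfM div1r lef_pV2 ?posrE ?mulr_gt0 ?exprn_gt0//.
  apply: (@le_trans _ _ (k * (Chat * k) ^+ 2)).
    by rewrite ler_pM2l// lerXn2r ?nnegrE ?(ltW d0) ?mulr_ge0 ?(ltW k0) ?(ltW Ch0)// ltW.
  apply: (@le_trans _ _ ((Chat * k ^+ 2) ^+ 2)).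
    have -> : (Chat * k ^+ 2) ^+ 2 = k * (k * (Chat * k) ^+ 2) by ring.
    by rewrite ler_peMl// mulr_ge0 ?exprn_ge0 ?mulr_ge0// ltW.
  apply: (@le_trans _ _ (rr ^+ 2)).
    by rewrite lerXn2r ?nnegrE ?(ltW rr0)// mulr_ge0 ?exprn_ge0// ltW.
  by rewrite ler_peMl ?exprn_ge0// ltW.
have [h _] : ((K%:R / C <= Num.min (bdist R x) (bdist R y))%R : nat)%:R
            / (C * sdist R x y ^+ 2) <= B x y t
        /\ B x y t <= C / sdist R x y ^+ 2.
  by apply: c3 => //; rewrite sdistE.
apply: le_trans h; rewrite le_min (KC _ hx) (KC _ hy)/= sdistE !div1r.
rewrite lef_pV2 ?posrE ?mulr_gt0 ?exprn_gt0// ler_pM2l// lerXn2r ?nnegrE//; exact: ltW.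
Qed.

Section System.
Variables (phi : R[i] -> R) (B : site K -> site K -> R -> R) (W : site K -> R -> R).
Variables (u : R -> site K -> R[i]) (s M : R).
Hypothesis phiB : forall z w, phi (z - w) = phi z - phi w.
Hypothesis phiZ : forall a z, phi (a%:C%C * z) = a * phi z.
Hypothesis s0 : 0 <= s.
Hypothesis adm : admissible `[- s, 0] B W.
Hypothesis cu : forall x, {within `[- s, 0], continuous (fun t => phi (u t x))}.
Hypothesis du : forall x t, - s < t < 0 ->
  is_derive t 1 (fun t => phi (u t x)) (phi (- opA B W t (u t) x)).
Hypothesis u_init : forall x, `|phi (u (- s) x)| <= M.

Let v t x := phi (u (clamp s t) x).

Let inT t : - s <= t <= 0 -> `[- s, 0]%classic t.
Proof. by move=> h; rewrite /= in_itv. Qed.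

Let v_cont x t : {for t, continuous (fun t => v t x)}.
Proof. exact: (@clamp_continuous _ s (fun t => phi (u t x)) s0 (@cu x) t). Qed.

Let v_derive x t : - s < t < 0 -> is_derive t 1 (fun t => v t x)
  (\sum_y B x y t * (v t y - v t x) - W x t * v t x).
Proof.
move=> ts; have tI : - s <= t <= 0 by case/andP: ts => h1 h2; rewrite !ltW.
have := clamp_is_derive ts (@du x t ts); rewrite (part_opA phiB phiZ).
by rewrite /v clamp_id.
Qed.

(** The maximum principle from -s to the clamped time, for v and for -v. *)
Lemma part_bound t x : `|phi (u (clamp s t) x)| <= M.
Proof.
case: adm => mB sB B0 W0.
have M0 : 0 <= M by apply: le_trans (u_init x).
have := clamp_itv t s0; move: (clamp s t) => e eI.
have /andP[se e0] := eI.
have sub r : - s < r < e -> `[- s, 0]%classic r.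
  by move=> /andP[r1 r2]; apply: inT; rewrite (ltW r1) (le_trans (ltW r2) e0).
have sub' r : - s < r < e -> - s < r < 0.
  by move=> /andP[r1 r2]; rewrite r1 (lt_le_trans r2 e0).
have vE r y : - s <= r <= 0 -> v r y = phi (u r y) by move=> rI; rewrite /v clamp_id.
have s_I : - s <= - s <= 0 by rewrite lexx oppr_le0.
rewrite -(vE _ _ eI) ler_norml; apply/andP; split.
  rewrite -[v e x]opprK lerN2.
  apply: (@max_principle _ _ (- s) e M B W (fun t x => - v t x)) => //.
  - by move=> y r; apply: (continuousN (@v_cont y r)).
  - move=> y r rI; apply: (is_derive_eq (is_deriveN (@v_derive y r (sub' _ rI)))).
    rewrite opprD mulrN -sumrN; congr (_ - _); apply: eq_bigr => z _.
    by rewrite -mulrN opprB opprK addrC.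
  - by move=> y z r /sub; exact: sB.
  - by move=> y z r /sub; exact: B0.
  - by move=> y r /sub; exact: W0.
  - move=> y; rewrite (vE _ _ s_I) lerNl; have := u_init y; rewrite ler_norml.
    by case/andP.
apply: (@max_principle _ _ (- s) e M B W v) => //.
- by move=> y r /sub' h; exact: (@v_derive y r h).
- by move=> y z r /sub; exact: sB.
- by move=> y z r /sub; exact: B0.
- by move=> y r /sub; exact: W0.
- by move=> y; rewrite (vE _ _ s_I); have := u_init y; rewrite ler_norml; case/andP.
Qed.

(** [w0] is K^xi over the distance K / 4 to the boundary in the bulk, and the bound on K^(C xi)
    makes the condition on W applicable there. [H] comes from regularity at a time of [Xi] in [-1,
    0), which s >= 1 places inside the interval. *)
Lemma flow_of_system (C Chat CXi xi rho : R) (Z : int) :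
    10 <= C -> 10 <= Chat -> 10 <= CXi -> (4 <= K)%N -> 0 <= xi -> 1 <= s -> 0 < M ->
    K%:R `^ (C * xi) <= K%:R / 4 ->
    condC1 CXi `[- s, 0] B Z rho -> condC2 C Chat `[- s, 0] B W xi ->
  flow s C (Chat * K%:R `^ xi) (Chat * (K%:R `^ xi) ^+ 2) (4 * K%:R `^ xi / K%:R)
    (3 * K%:R `^ rho) Z%:~R B W (fun t x => v t x / M).
Proof.
move=> C10 Ch10 CXi10 K4 xi0 s1 M0 KC c1 c2.
case: adm => mB sB B0 W0.
have K0 : 0 < K%:R :> R by rewrite ltr0n (leq_trans _ K4).
have B0' x y t : - s <= t <= 0 -> 0 <= B x y t by move=> /inT; exact: B0.
split.
- by move=> x t; apply: continuousM; [exact: (@v_cont x t)|exact: cvg_cst].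
- move=> x t ts; have d1 := is_deriveM (@v_derive x t ts) (is_derive_cst M^-1 t 1).
  apply: (is_derive_eq d1); rewrite /cst scaler0 add0r/= /GRing.scale/= mulrBr big_distrr/=.
  congr (_ - _); last by rewrite mulrCA [v t x / M]mulrC.
  by apply: eq_bigr => y _; rewrite -mulrBl mulrCA [_ / M]mulrC.
- move=> x t; rewrite normrM normfV (gtr0_norm M0) ler_pdivrMr// mul1r.
  exact: part_bound.
- exact: mB.
- by move=> x y t /inT; exact: sB.
- exact: B0'.
- move=> x y t /inT ts; rewrite -sdistE => h; case: c2 => _ _ c3.
  by have [_] := c3 t x y ts h.
- exact: lower_bound_of_condC2 c2.
- by move=> x t /inT; exact: W0.
- move=> x t /inT ts /bdist_bulk h; case: c2 => _ c2 _.
  apply: le_trans (c2 t x ts (le_trans KC h)) _.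
  have h0 : 0 < bdist R x by apply: lt_le_trans h; rewrite divr_gt0.
  rewrite ler_pdivrMr// mulrAC ler_pdivlMr//.
  have -> : K%:R `^ xi * K%:R = 4 * (K%:R `^ xi * (K%:R / 4)) by field.
  rewrite -[4 * _ * _]mulrA ler_pM2l//; apply: ler_wpM2l h; exact: powR_ge0.
- move=> rr t rr1 rrK ts.
  have [t0 Xt0 t0I] := Xi_near_zero CXi10 K4.
  have st0 : - s <= t0.
    by case/andP: t0I => h _; apply: le_trans h; rewrite lerN2.
  have reg : regular `[- s, 0] B rho Z t0.
    have := c1 t0 Xt0; rewrite addr0; apply; apply: inT.
    by rewrite st0 ltW//; case/andP: t0I.
  apply: (regular_energy_le mB B0' st0 t0I reg rr1 _ ts).
  by apply: le_trans rrK _; rewrite ler_pdivrMr// ler_peMr ?ler1n// ltW.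
Qed.

End System.
End Reduction.

(** * Moduli of complex numbers and large powers of K *)

Section Moduli.
Context {R : realType}.

Lemma powR_unbounded (A d : R) : 0 < d -> exists N, forall k, (N <= k)%N -> A <= k%:R `^ d.
Proof.
move=> d0; exists (Num.truncn (`|A| `^ d^-1)).+1 => k Nk.
apply: le_trans (ler_norm A) _.
have -> : `|A| = (`|A| `^ d^-1) `^ d by rewrite -powRrM mulVf ?gt_eqF// powRr1.
apply: ge0_ler_powR; rewrite ?nnegrE ?powR_ge0 ?(ltW d0)//.
by apply: ltW; apply: lt_le_trans (truncnS_gt _) _; rewrite ler_nat.
Qed.

Lemma cabs_le (z : R[i]) : cabs z <= `|complex.Re z| + `|complex.Im z|.
Proof.
case: z => a b; rewrite /cabs /= -[X in _ <= X]ger0_norm ?addr_ge0// -sqrtr_sqr.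
apply: ler_wsqrtr; rewrite sqrrD -!normrX !(ger0_norm (sqr_ge0 _)) addrAC lerDl.
by rewrite mulrn_wge0// mulr_ge0.
Qed.

Lemma Re_le_cabs (z : R[i]) : `|complex.Re z| <= cabs z.
Proof. by case: z => a b; rewrite /cabs /= -sqrtr_sqr ler_wsqrtr// lerDl sqr_ge0. Qed.

Lemma Im_le_cabs (z : R[i]) : `|complex.Im z| <= cabs z.
Proof. by case: z => a b; rewrite /cabs /= -sqrtr_sqr ler_wsqrtr// lerDr sqr_ge0. Qed.

Lemma cabs_le_supnorm K (v : site K -> R[i]) x : cabs (v x) <= supnorm v.
Proof. by rewrite /supnorm; exact: (@le_bigmax _ _ _ 0 (fun x => cabs (v x))). Qed.

End Moduli.

Theorem theorem10p1 (R : realType) (Ccond Chat CXi : R)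
    (hCcond : 10 <= Ccond) (hChat : 10 <= Chat) (hCXi : 10 <= CXi) :
  exists q : R, 0 < q /\
  forall c3 : R, 0 < c3 ->
  exists (eps C : R) (K0 : nat), 0 < eps /\
  forall xi rho : R, 0 < xi -> xi <= eps -> 0 < rho -> rho <= eps ->
  forall K : nat, (K0 <= K)%N ->
  forall sigma : R, K%:R `^ c3 <= sigma -> sigma <= K%:R `^ (1 - c3) ->
  forall (B : site K -> site K -> R -> R) (W : site K -> R -> R)
    (u : R -> site K -> R[i]) (Z : int) (alpha : R),
  admissible `[- sigma, 0] B W ->
  solution (- sigma) 0 B W u ->
  `|Z|%:~R <= K%:R / 2 :> R ->
  0 <= alpha -> alpha <= 3^-1 ->
  condC1 CXi `[- sigma, 0] B Z rho ->
  condC2 Ccond Chat `[- sigma, 0] B W xi ->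
  forall j j' : site K,
  (`|pos j - Z| + `|pos j' - Z|)%:~R <= sigma `^ (1 - alpha) ->
  cabs (u 0 j - u 0 j') <= C * sigma `^ (- (q * alpha)) * supnorm (u (- sigma)).
Proof.
have C1 : 1 <= Ccond by apply: le_trans hCcond; rewrite ler1n.
have Ch0 : 0 <= Chat by apply: le_trans hChat.
(* 80 because sigma = y^80 for y = sigma^(1/80). *)
have [p [kap [z0 [[p0 kap0 z01] osc]]]] := flow_oscillation 80 C1 Ch0.
have pR : 0 < (4 * p)%:R :> R by rewrite ltr0n muln_gt0.
exists (4 * p)%:R^-1; split; first by rewrite invr_gt0.
move=> c3 c30.
(* As sigma >= K^c3, K^d is at most z = sigma^(1/400), and so are K^xi and K^rho for xi, rho <=
   d. *)
pose d := c3 / 400.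
have d0 : 0 < d by apply: divr_gt0 c30 _; rewrite ltr0n; exact: isT.
have dc : d <= c3 / 2 by rewrite ler_pM2l// lef_pV2 ?posrE ?ltr0n// ler_nat.
have C0 : 0 < Ccond by apply: lt_le_trans hCcond.
(* The second term gives C xi <= 1/2, hence K^(C xi) is at most the square root of K, which is at
   most K / 4 for K >= 16. *)
pose eps := Num.min d (2 * Ccond)^-1.
have [K1 HK1] := powR_unbounded (4 * z0) d0.
(* The factor 2 adds up the real and the imaginary part. *)
exists eps, (2 * kap), (maxn 16 K1); split.
  by rewrite lt_min d0 invr_gt0 mulr_gt0.
move=> xi rho xi0 xie rho0 rhoe K; rewrite geq_max => /andP[K16 KK1] s sK1 sK2.
have /andP[xid xiC] : (xi <= d) && (xi <= (2 * Ccond)^-1) by rewrite -le_min.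
have rhod : rho <= d by apply: le_trans rhoe _; rewrite ge_min lexx.
have {HK1} := HK1 K KK1.
set k : R := K%:R in sK1 sK2 *; set g := k `^ d => gz.
have k16 : 16 <= k by rewrite ler_nat.
have k1 : 1 <= k by apply: le_trans k16; rewrite ler1n.
have k0 : 0 < k by apply: lt_le_trans k1.
have kmon a b : a <= b -> k `^ a <= k `^ b by exact: ler_powR.
have kge1 a : 0 <= a -> 1 <= k `^ a by move=> a0; rewrite -[X in X <= _](powRr0 k); exact: kmon.
have s1 : 1 <= s by apply: le_trans sK1; apply: kge1; exact: ltW.
have s0 : 0 < s by apply: lt_le_trans s1.
have smon a b : a <= b -> s `^ a <= s `^ b by exact: ler_powR.
pose z := s `^ (400^-1); pose y := s `^ (80^-1).
have i400 : 0 <= 400^-1 :> R by rewrite invr_ge0 ler0n.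
have gzz : g <= z.
  rewrite /g /d powRrM; apply: (ge0_ler_powR i400); rewrite ?nnegrE ?powR_ge0 ?(ltW s0)//.
have z0z : z0 <= z.
  by apply: le_trans gzz; apply: le_trans gz; rewrite ler_peMl ?ler1n// (le_trans _ z01).
have z1 : 1 <= z by apply: le_trans z0z.
have yn n : y ^+ n = s `^ (80^-1 * n%:R) by rewrite /y powRrM powR_mulrn// powR_ge0.
have yE : y = z ^+ 5.
  rewrite /z -powR_mulrn ?powR_ge0// -powRrM /y; congr (_ `^ _); field; exact: isT.
pose X := k `^ xi.
have X1 : 1 <= X by apply: kge1; exact: ltW.
have Xz : X <= z by apply: le_trans gzz; exact: kmon.
have Pz : k `^ rho <= z by apply: le_trans gzz; exact: kmon.
have KC : k `^ (Ccond * xi) <= k / 4.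
  have h : Ccond * xi <= 2^-1.
    by apply: le_trans (ler_wpM2l (ltW C0) xiC) _; rewrite invfM mulrCA divff ?mulr1 ?gt_eqF.
  apply: le_trans (kmon _ _ h) _; rewrite ler_pdivlMr//.
  rewrite powR12_sqrt ?(ltW k0)//.
  have q4 : 4 <= Num.sqrt k.
    have -> : 4 = Num.sqrt (4 ^+ 2) :> R by rewrite sqrtr_sqr ger0_norm.
    by apply: ler_wsqrtr; rewrite -natrX.
  rewrite -[X in _ <= X](sqr_sqrtr (ltW k0)) expr2 ler_pM2l//; exact: lt_le_trans q4.
have g0 : 0 < g by apply: lt_le_trans (kge1 _ (ltW d0)).
have kB : k `^ (1 - d) = k / g.
  by rewrite powRB ?powRr1 ?(ltW k0)// (gt_eqF k0) implybT.
(* By d <= c3 / 2 the ratio K / sigma is at least K^(2 d): one factor K^d pays for [z0], the other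
   for K^xi in the killing rate. *)
have kg : k `^ (1 - c3) <= k / g.
  apply: (@le_trans _ _ (k `^ (1 - d))).
    by apply: kmon; rewrite lerD2l lerN2; move: dc c30; clear; lra.
  by rewrite kB.
have kgX : k `^ (1 - c3) * X <= k / g.
  rewrite /X -powRD; last by rewrite (gt_eqF k0) implybT.
  apply: (@le_trans _ _ (k `^ (1 - d))).
    by apply: kmon; move: dc xid; clear; lra.
  by rewrite kB.
have zs : z0 * s <= k.
  apply: (@le_trans _ _ (g * (k / g))); last by rewrite mulrCA divff ?mulr1// gt_eqF.
  have z00 : 0 <= z0 by apply: le_trans z01.
  apply: ler_pM; [exact: z00|exact: ltW| |exact: le_trans kg].
  by apply: le_trans gz; rewrite ler_peMl ?ler1n.
have zw : z0 * (s * (4 * X / k)) <= 1.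
  have -> : z0 * (s * (4 * X / k)) = (4 * z0) * (s * X) / k by ring.
  rewrite ler_pdivrMr// mul1r.
  apply: (@le_trans _ _ (g * (k / g))); last by rewrite mulrCA divff ?mulr1// gt_eqF.
  have X0 : 0 <= X by exact: powR_ge0.
  have z00 : 0 <= z0 by apply: le_trans z01.
  apply: ler_pM; [exact: mulr_ge0|exact: mulr_ge0 (ltW s0) X0|exact: gz|].
  by apply: le_trans kgX; exact: ler_wpM2r.
move=> B W u Z al adm sol ZK al0 al3 cC1 cC2 j j' jj.
pose Rr := s `^ (1 - al).
have yR : y ^+ 53 <= Rr by rewrite yn; apply: smon; move: al3; clear; lra.
have Rs : Rr <= s by rewrite -[X in _ <= X](powRr1 (ltW s0)); apply: smon; rewrite gerBl.
have sy : s <= y ^+ 27 * Rr.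
  rewrite yn -powRD; last by rewrite (gt_eqF s0) implybT.
  by rewrite -[X in X <= _](powRr1 (ltW s0)); apply: smon; move: al3; clear; lra.
have sy80 : s <= y ^+ 80.
  by rewrite yn mulVf ?powRr1 ?(ltW s0)// pnatr_eq0.
have K4 : (4 <= K)%N by apply: leq_trans K16.
pose M := supnorm (u (- s)).
have ballZ i : `|pos i - Z|%:~R <= Rr -> ball Z%:~R Rr i.
  by rewrite /ball/= /coord -intrB -intr_norm.
have part (phi : R[i] -> R) : (forall z w, phi (z - w) = phi z - phi w) ->
    (forall a z, phi (a%:C%C * z) = a * phi z) -> (forall z, `|phi z| <= cabs z) ->
    (forall x, {within `[- s, 0], continuous (fun t => phi (u t x))}) ->
    (forall x t, - s < t < 0 -> is_derive t 1 (fun t => phi (u t x)) (phi (- opA B W t (u t) x))) ->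
    `|phi (u 0 j - u 0 j')| <= kap * s `^ (- ((4 * p)%:R^-1 * al)) * M.
  move=> phiB phiZ phi_le cphi dphi.
  have init x : `|phi (u (- s) x)| <= M.
    by apply: le_trans (phi_le _) _; exact: cabs_le_supnorm.
  have M0 : 0 <= M by apply: le_trans (init j).
  have cl0 : clamp s 0 = 0 :> R by rewrite clamp_id// oppr_le0 ltW//= lexx.
  have e0 : 0 <= s `^ (- ((4 * p)%:R^-1 * al)) by exact: powR_ge0.
  (* The normalisation divides by M; for M = 0 the bound [part_bound] already gives 0. *)
  rewrite phiB; have [ME|Mn0] := eqVneq M 0.
    have b x : phi (u 0 x) = 0.
      have := part_bound phiB phiZ (ltW s0) adm cphi dphi init 0 x.
      by rewrite cl0 ME normr_le0 => /eqP.
    by rewrite !b subrr normr0 !mulr_ge0// ltW.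
  have Mp : 0 < M by rewrite lt0r Mn0.
  have F := flow_of_system phiB phiZ (ltW s0) adm cphi dphi init hCcond hChat hCXi K4
    (ltW xi0) s1 Mp KC cC1 cC2.
  have [] := osc _ _ _ _ _ _ _ _ _ _ z y Rr F z0z yE _ _ _ _ _ _ zw zs _ yR Rs sy sy80.
  - by rewrite mulr_ge0// powR_ge0.
  - by rewrite ler_wpM2l.
  - apply: ler_wpM2l => //; rewrite yE; apply: (@le_trans _ _ (z ^+ 2)).
      by apply: lerXn2r; rewrite ?nnegrE ?powR_ge0.
    by apply: ler_weXn2l.
  - by rewrite mulr_ge0// powR_ge0.
  - by apply: ler_pM; [exact: ler0n|exact: powR_ge0|rewrite ler_nat|exact: Pz].
  - by rewrite divr_ge0// mulr_ge0// powR_ge0.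
  - by rewrite -intr_norm.
  move=> h [h0 hp hosc].
  have nn (i : site K) : 0 <= `|pos i - Z|%:~R :> R by rewrite intr_norm normr_ge0.
  rewrite intrD in jj.
  have jR : ball Z%:~R Rr j by apply: ballZ; apply: le_trans jj; rewrite lerDl.
  have jR' : ball Z%:~R Rr j' by apply: ballZ; apply: le_trans jj; rewrite lerDr.
  have := hosc j j' jR jR'; rewrite cl0 -mulrBl normrM normfV (gtr0_norm Mp) ler_pdivrMr//.
  move=> /le_trans; apply; apply: ler_wpM2r => //; apply: ler_wpM2l; first exact: ltW.
  (* Compared at the power 4p, the claim is g^(4p) <= Rr / sigma = sigma^(-alpha). *)
  rewrite -(@ler_pXn2r _ (4 * p)) ?nnegrE// ?muln_gt0//.
  apply: le_trans hp _.
  rewrite -powR_mulrn// -powRrM mulNr mulrAC mulVf ?mul1r ?gt_eqF//.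
  rewrite /Rr ler_pdivrMr// -[X in _ <= _ * X](powRr1 (ltW s0)) -powRD; last first.
    by rewrite (gt_eqF s0) implybT.
  by rewrite addrC.
apply: le_trans (cabs_le _) _.
have -> : 2 * kap * s `^ (- ((4 * p)%:R^-1 * al)) * M =
  kap * s `^ (- ((4 * p)%:R^-1 * al)) * M + kap * s `^ (- ((4 * p)%:R^-1 * al)) * M.
  by move: (s `^ _) => A; ring.
apply: lerD; apply: part.
- by case=> a b [a' b'].
- by move=> a [b b'] /=; rewrite mul0r subr0.
- exact: Re_le_cabs.
- by move=> x; have [[]] := sol x.
- by move=> x t ts; have [_ /(_ t ts) []] := sol x.
- by case=> a b [a' b'].
- by move=> a [b b'] /=; rewrite mul0r addr0.
- exact: Im_le_cabs.
- by move=> x; have [[]] := sol x.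
- by move=> x t ts; have [_ /(_ t ts) []] := sol x.
Qed.
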